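(* Let $\Omega=\bigcup_{i=1}^n(\alpha_i,\beta_i)$ with $-\infty<\alpha_1<\beta_1<\alpha_2<\beta_2<\dots<\alpha_n<\beta_n<\infty$, and let $\mathsf D|_{C_c^\infty(\Omega)}$ be the operator $f\mapsto \frac{1}{2\pi i}f'$ in $L^2(\Omega)$ with domain $C_c^\infty(\Omega)$. (1) If $T$ is a closed symmetric extension of $\mathsf D|_{C_c^\infty(\Omega)}$, then there exists a partial isometry $B$ between subspaces $B_l$ and $B_r$ of $\mathbb C^n$ such that $$\mathscr D(T)=\{f\in\mathscr D_{\max}: f(\vec\alpha)\in B_l,\ Bf(\vec\alpha)=f(\vec\beta)\},\qquad Tf=\mathsf Df\ \text{ for } f\in\mathscr D(T).$$ Conversely, if $B$ is a partial isometry between subspaces $B_l$ and $B_r$ of $\mathbb C^n$ and the unbounded operator $T$ is defined by these formulas, then $T$ is a closed symmetric extension of $\mathsf D|_{C_c^\infty(\Omega)}$. (2) For $T$ as in (1) with associated $B, B_l,B_r$, the adjoint $T^*$ has domain $$\mathscr D(T^* )=\{f\in\mathscr D_{\max}: (B^*f(\vec\beta)-f(\vec\alpha))\perp B_l\},$$ and $T^*f=\mathsf Df$ for $f\in\mathscr D(T^* )$. (3) The operator $T$ is a self-adjoint extension of $\mathsf D|_{C_c^\infty(\Omega)}$ if and only if $B$ is unitary, i.e. $B_l=B_r=\mathbb C^n$.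
   Context: Write $J_i=(\alpha_i,\beta_i)$; $L^2(\Omega)$ is taken with respect to Lebesgue measure. Define $$\mathscr D_{\max}=\{f:\Omega\to\mathbb C : f\text{ is absolutely continuous on each }J_i\text{ and }f'\in L^2(\Omega)\}.$$ On $\mathscr D_{\max}$ we write $\mathsf Df=\frac{1}{2\pi i}f'$. For $f\in\mathscr D_{\max}$ the one-sided limits at the endpoints exist; set $f(\alpha_i):=f(\alpha_i+)$, $f(\beta_i):=f(\beta_i-)$, and $f(\vec\alpha)=(f(\alpha_1),\dots,f(\alpha_n))$, $f(\vec\beta)=(f(\beta_1),\dots,f(\beta_n))\in\mathbb C^n$. A partial isometry $B$ between subspaces $B_l$ and $B_r$ of $\mathbb C^n$ is a linear map $B:\mathbb C^n\to\mathbb C^n$ that maps $B_l$ isometrically onto $B_r$ and is zero on the orthogonal complement of $B_l$. *)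

(* Defs.v *)
From HB Require Import structures.
From mathcomp Require Import all_boot all_order all_algebra.
From mathcomp Require Import complex generic_quotient ring_quotient.
From mathcomp Require Import sesquilinear spectral.
From mathcomp Require Import ring lra.
From mathcomp Require Import all_classical all_reals all_analysis.
From mathcomp Require Import measurable_realfun.

Set Implicit Arguments.
Unset Strict Implicit.
Unset Printing Implicit Defensive.

Import Order.TTheory GRing.Theory Num.Def Num.Theory.
Import numFieldNormedType.Exports.

Local Open Scope classical_set_scope.
Local Open Scope ring_scope.
Local Open Scope quotient_scope.
Local Open Scope sesquilinear_scope.

Local Notation Re := (@complex.Re _).
Local Notation Im := (@complex.Im _).

Definition Omega (R : realType) (n : nat) (alpha beta : 'I_n -> R) : set R :=
  \bigcup_i `]alpha i, beta i[%classic.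

Lemma measurable_Omega (R : realType) (n : nat) (alpha beta : 'I_n -> R) :
  measurable (Omega alpha beta).
Proof.
rewrite /Omega; apply: fin_bigcup_measurable => // i _.
Qed.

Section square_integrable.
Context (R : realType) (n : nat) (alpha beta : 'I_n -> R).
Local Notation mu := (@lebesgue_measure R).
Local Notation D := (Omega alpha beta).
Implicit Types f g : R -> R[i].

Definition normc2 (z : R[i]) : R := Re z ^+ 2 + Im z ^+ 2.

Definition square_integrable f : Prop :=
  [/\ measurable_fun D (Re \o f), measurable_fun D (Im \o f) &
      (\int[mu]_(x in D) (normc2 (f x))%:E < +oo)%E].

Lemma ReD (z w : R[i]) : Re (z + w) = Re z + Re w.
Proof. by case: z w => [? ?] []. Qed.

Lemma ImD (z w : R[i]) : Im (z + w) = Im z + Im w.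
Proof. by case: z w => [? ?] []. Qed.

Lemma ReM (z w : R[i]) : Re (z * w) = Re z * Re w - Im z * Im w.
Proof. by case: z w => [? ?] []. Qed.

Lemma ImM (z w : R[i]) : Im (z * w) = Re z * Im w + Im z * Re w.
Proof. by case: z w => [? ?] []. Qed.

Lemma normc2_ge0 z : 0 <= normc2 z.
Proof. by rewrite addr_ge0// sqr_ge0. Qed.

Lemma measurable_normc2 f : measurable_fun D (Re \o f) ->
  measurable_fun D (Im \o f) -> measurable_fun D (normc2 \o f).
Proof. by move=> mr mi; apply: measurable_funD; exact: measurable_funX. Qed.

Lemma normc2_integrable f : square_integrable f ->
  mu.-integrable D (EFin \o (normc2 \o f)).
Proof.
case=> mr mi foo; apply/integrableP; split.
  by apply/measurable_EFinP; exact: measurable_normc2.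
under eq_integral do rewrite /= ger0_norm ?normc2_ge0//.
exact: foo.
Qed.

Definition L2pred : {pred R -> R[i]} := fun f => `[< square_integrable f >].

Lemma L2pred_submod_closed : submod_closed L2pred.
Proof.
have mD := measurable_Omega alpha beta.
split=> [|a f g].
  apply/asboolP; split; [exact: measurable_cst|exact: measurable_cst|].
  under eq_integral do rewrite /normc2 /= expr0n addr0.
  by rewrite integral0.
move=> /asboolP Sf /asboolP Sg; have [fr fi _] := Sf; have [gr gi _] := Sg.
have hr : measurable_fun D (Re \o (a *: f + g)).
  rewrite (_ : _ \o _ = fun x =>
    Re a * Re (f x) - Im a * Im (f x) + Re (g x)); last first.
    by apply/funext => x; rewrite -[LHS]/(Re (a * f x + g x)) ReD ReM.
  by apply: measurable_funD => //; apply: measurable_funB; exact: measurable_funM.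
have hi : measurable_fun D (Im \o (a *: f + g)).
  rewrite (_ : _ \o _ = fun x =>
    Re a * Im (f x) + Im a * Re (f x) + Im (g x)); last first.
    by apply/funext => x; rewrite -[LHS]/(Im (a * f x + g x)) ImD ImM.
  by apply: measurable_funD => //; apply: measurable_funD; exact: measurable_funM.
apply/asboolP; split=> //.
have If := normc2_integrable Sf; have Ig := normc2_integrable Sg.
have I : mu.-integrable D (EFin \o
    (fun x => 2 * normc2 a * normc2 (f x) + 2 * normc2 (g x))).
  rewrite (_ : _ \o _ = ((fun x => (2 * normc2 a)%:E * (normc2 (f x))%:E) \+
    (fun x => 2%:E * (normc2 (g x))%:E))%E); last exact/funext.
  by apply: integrableD => //; exact: integrableZl.
have : mu.-integrable D (EFin \o (normc2 \o (a *: f + g))).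
  apply: (le_integrable _ _ _ I) => //=.
    by apply/measurable_EFinP; exact: measurable_normc2.
  move=> x _; rewrite lee_fin !ger0_norm ?normc2_ge0//; last first.
    by rewrite addr_ge0// mulr_ge0 ?mulr_ge0 ?normc2_ge0.
  rewrite -[leLHS]/(normc2 (a * f x + g x)) /normc2 !(ReD, ImD, ReM, ImM).
  rewrite -subr_ge0 [leRHS](_ : _ = (Re a * Re (f x) - Im a * Im (f x) - Re (g x)) ^+ 2 +
     (Re a * Im (f x) + Im a * Re (f x) - Im (g x)) ^+ 2).
    by rewrite addr_ge0// sqr_ge0.
  by ring.
move=> /integrableP[_]; under eq_integral do rewrite /= ger0_norm ?normc2_ge0//.
exact.
Qed.

HB.instance Definition _ :=
  GRing.isSubmodClosed.Build R[i] (R -> R[i]) L2pred L2pred_submod_closed.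

Record L2fun := MkL2fun {
  L2fun_val :> R -> R[i];
  L2fun_valP : L2fun_val \in L2pred }.

HB.instance Definition _ := [isSub for L2fun_val].
HB.instance Definition _ := [Choice of L2fun by <:].
HB.instance Definition _ := [SubChoice_isSubLmodule of L2fun by <:].

Definition ae_null : {pred L2fun} :=
  fun f : L2fun => `[< {ae mu, forall x, D x -> f x = 0} >].

Lemma ae_imply (P Q : R -> Prop) : (forall x, P x -> Q x) ->
  {ae mu, forall x, P x} -> {ae mu, forall x, Q x}.
Proof. by apply: filterS; exact: (ae_filter_ringOfSetsType mu). Qed.

Lemma ae_imply2 (P Q S : R -> Prop) : (forall x, P x -> Q x -> S x) ->
  {ae mu, forall x, P x} -> {ae mu, forall x, Q x} -> {ae mu, forall x, S x}.
Proof. by apply: filterS2; exact: (ae_filter_ringOfSetsType mu). Qed.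

Lemma ae_null_zmod_closed : zmod_closed ae_null.
Proof.
split=> [|f g /asboolP f0 /asboolP g0]; apply/asboolP; first exact/aeW.
move: f0 g0; apply: ae_imply2 => x f0 g0 Dx.
by rewrite -[LHS]/(f x - g x) f0// g0// subr0.
Qed.

HB.instance Definition _ :=
  GRing.isZmodClosed.Build L2fun ae_null ae_null_zmod_closed.


(* L^2(Omega): square-integrable functions modulo equality a.e. on Omega *)
Definition L2 := Quotient.quot ae_null.

HB.instance Definition _ := GRing.Zmodule.on L2.
HB.instance Definition _ := EqQuotient.on L2.

Lemma pi_L2P (f g : L2fun) :
  \pi_L2 f = \pi_L2 g <-> {ae mu, forall x, D x -> f x = g x}.
Proof.
have E : (\pi_L2 f == \pi_L2 g) = (f - g \in ae_null).
  exact/esym/Quotient.idealrBE.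
split=> [/eqP|fg].
  rewrite E => /asboolP; apply: ae_imply => x fg Dx.
  by apply/eqP; rewrite -subr_eq0; apply/eqP; exact: fg.
apply/eqP; rewrite E; apply/asboolP; move: fg; apply: ae_imply => x fg Dx.
by rewrite -[LHS]/(f x - g x) fg// subrr.
Qed.

Lemma repr_L2 (f : L2fun) : {ae mu, forall x, D x -> repr (\pi_L2 f) x = f x}.
Proof. by apply/pi_L2P; rewrite reprK. Qed.

Definition L2scale (a : R[i]) (u : L2) : L2 := \pi_L2 (a *: repr u).

Lemma L2scale_pi a (f : L2fun) : L2scale a (\pi_L2 f) = \pi_L2 (a *: f).
Proof.
apply/pi_L2P; have := repr_L2 f; apply: ae_imply => x fx Dx.
by rewrite -[LHS]/(a * repr (\pi_L2 f) x) fx.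
Qed.

Lemma L2addE (f g : L2fun) : \pi_L2 (f + g) = \pi_L2 f + \pi_L2 g.
Proof. exact: Quotient.pi_add. Qed.

Lemma L2scaleA a b u : L2scale a (L2scale b u) = L2scale (a * b) u.
Proof. by elim/quotW: u => f; rewrite (L2scale_pi b) !L2scale_pi scalerA. Qed.

Lemma L2scale1 u : L2scale 1 u = u.
Proof. by elim/quotW: u => f; rewrite L2scale_pi scale1r. Qed.

Lemma L2scaleDr : right_distributive L2scale +%R.
Proof.
move=> a; elim/quotW=> f; elim/quotW=> g.
by rewrite -L2addE !L2scale_pi -L2addE scalerDr.
Qed.

Lemma L2scaleDl u : {morph L2scale^~ u : a b / a + b}.
Proof.
by elim/quotW: u => f a b; rewrite !L2scale_pi -L2addE scalerDl.
Qed.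

HB.instance Definition _ := GRing.Zmodule_isLmodule.Build R[i] L2
  L2scaleA L2scale1 L2scaleDr L2scaleDl.

Lemma L2scaleE a (f : L2fun) : \pi_L2 (a *: f) = a *: \pi_L2 f.
Proof. by rewrite -L2scale_pi. Qed.

Definition cintegral (F : R -> R[i]) : R[i] :=
  Complex (\int[mu]_(x in D) Re (F x)) (\int[mu]_(x in D) Im (F x)).

(* linear in the first argument, conjugate-linear in the second *)
Definition L2dot (u v : L2) : R[i] :=
  cintegral (fun x => repr u x * (repr v x)^*).

Definition cintegrable (F : R -> R[i]) :=
  mu.-integrable D (EFin \o (Re \o F)) /\
  mu.-integrable D (EFin \o (Im \o F)).

Lemma cintegralP (a : R[i]) F G : cintegrable F -> cintegrable G ->
  cintegral (fun x => a * F x + G x) = a * cintegral F + cintegral G.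
Proof.
have mD := measurable_Omega alpha beta.
case=> [Fr Fi] [Gr Gi].
have ZF c : mu.-integrable D (EFin \o (fun x => c * Re (F x))).
  by rewrite (_ : _ \o _ = fun x => c%:E * (Re (F x))%:E)%E//; exact: integrableZl.
have ZFi c : mu.-integrable D (EFin \o (fun x => c * Im (F x))).
  by rewrite (_ : _ \o _ = fun x => c%:E * (Im (F x))%:E)%E//; exact: integrableZl.
apply/eqP; rewrite eq_complex !(ReD, ImD, ReM, ImM) /=; apply/andP; split; apply/eqP.
  under eq_Rintegral do rewrite ReD ReM.
  rewrite RintegralD//; first by rewrite RintegralB// !RintegralZl.
  rewrite (_ : _ \o _ = (fun x => (Re a * Re (F x))%:E) \-
    (fun x => (Im a * Im (F x))%:E))%E; last exact/funext.
  by apply: integrableB => //; [exact: ZF|exact: ZFi].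
under eq_Rintegral do rewrite ImD ImM.
rewrite RintegralD//; first by rewrite RintegralD// !RintegralZl.
rewrite (_ : _ \o _ = (fun x => (Re a * Im (F x))%:E) \+
  (fun x => (Im a * Re (F x))%:E))%E; last exact/funext.
by apply: integrableD => //; [exact: ZFi|exact: ZF].
Qed.

Lemma ReMJ (z w : R[i]) : Re (z * w^*) = Re z * Re w + Im z * Im w.
Proof. by case: z w => [? ?] [? ?]; rewrite ReM /= mulrN opprK. Qed.

Lemma ImMJ (z w : R[i]) : Im (z * w^*) = Im z * Re w - Re z * Im w.
Proof. by case: z w => [? ?] [? ?]; rewrite ImM /= mulrN addrC. Qed.

Lemma L2fun_cintegrable (f g : L2fun) :
  cintegrable (fun x => f x * (g x)^*).
Proof.
have mD := measurable_Omega alpha beta.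
have /asboolP Sf := L2fun_valP f; have /asboolP Sg := L2fun_valP g.
have If := normc2_integrable Sf; have Ig := normc2_integrable Sg.
have [fr fi _] := Sf; have [gr gi _] := Sg.
have I : mu.-integrable D (EFin \o (fun x => normc2 (f x) + normc2 (g x))).
  rewrite (_ : _ \o _ = (fun x => (normc2 (f x))%:E) \+
    (fun x => (normc2 (g x))%:E))%E; last exact/funext.
  exact: integrableD.
split; apply: (le_integrable _ _ _ I) => //=.
- apply/measurable_EFinP.
  rewrite (_ : _ \o _ =
    fun x => Re (f x) * Re (g x) + Im (f x) * Im (g x)); last first.
    by apply/funext => x; rewrite /= ReMJ.
  by apply: measurable_funD; exact: measurable_funM.
- move=> x _; rewrite lee_fin ReMJ (ger0_norm (addr_ge0 (normc2_ge0 _) (normc2_ge0 _))).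
  have := sqr_ge0 (Re (f x) - Re (g x)); have := sqr_ge0 (Re (f x) + Re (g x)).
  have := sqr_ge0 (Im (f x) - Im (g x)); have := sqr_ge0 (Im (f x) + Im (g x)).
  by rewrite /normc2 ler_norml => ? ? ? ?; apply/andP; split; nra.
- apply/measurable_EFinP.
  rewrite (_ : _ \o _ =
    fun x => Im (f x) * Re (g x) - Re (f x) * Im (g x)); last first.
    by apply/funext => x; rewrite /= ImMJ.
  by apply: measurable_funB; exact: measurable_funM.
- move=> x _; rewrite lee_fin ImMJ (ger0_norm (addr_ge0 (normc2_ge0 _) (normc2_ge0 _))).
  have := sqr_ge0 (Im (f x) - Re (g x)); have := sqr_ge0 (Im (f x) + Re (g x)).
  have := sqr_ge0 (Re (f x) - Im (g x)); have := sqr_ge0 (Re (f x) + Im (g x)).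
  by rewrite /normc2 ler_norml => ? ? ? ?; apply/andP; split; nra.
Qed.

Lemma ae_eq_cintegral F G : cintegrable F -> cintegrable G ->
  {ae mu, forall x, D x -> F x = G x} -> cintegral F = cintegral G.
Proof.
have mD := measurable_Omega alpha beta.
case=> [/measurable_int Fr /measurable_int Fi].
case=> [/measurable_int Gr /measurable_int Gi] FG.
by congr Complex; congr fine; apply: ae_eq_integral => //;
  move: FG; apply: ae_imply => x FG Dx /=; rewrite FG.
Qed.

Lemma L2dotE (f g : L2fun) :
  L2dot (\pi_L2 f) (\pi_L2 g) = cintegral (fun x => f x * (g x)^*).
Proof.
apply: ae_eq_cintegral; [exact: L2fun_cintegrable|exact: L2fun_cintegrable|].
by have := repr_L2 f; have := repr_L2 g; apply: ae_imply2 => x fx gx Dx;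
  rewrite fx// gx.
Qed.

Lemma L2dot_linearl v : linear_for *%R (L2dot^~ v).
Proof.
elim/quotW: v => h a; elim/quotW=> f; elim/quotW=> g.
rewrite -L2scaleE -L2addE !L2dotE.
rewrite -cintegralP; try exact: L2fun_cintegrable.
congr cintegral; apply/funext => x.
by rewrite -[in LHS]/(a * _ + _) mulrDl mulrA.
Qed.

Lemma L2dotC u v : L2dot u v = (-1) ^+ false * (L2dot v u)^*.
Proof.
rewrite expr0 mul1r; congr Complex.
  by apply: eq_Rintegral => x _; rewrite !ReMJ mulrC [X in _ + X]mulrC.
rewrite -mulN1r -RintegralZl//.
- by apply: eq_Rintegral => x _; rewrite !ImMJ; ring.
- exact: measurable_Omega.
- by have [] := L2fun_cintegrable (repr v) (repr u).
Qed.

Lemma L2dot_linearr u : linear_for (conjC \; *%R) (L2dot u).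
Proof.
move=> a v w; rewrite L2dotC L2dot_linearl (L2dotC u v) (L2dotC u w).
by rewrite !expr0 !mul1r rmorphD rmorphM.
Qed.

HB.instance Definition _ := bilinear_isBilinear.Build R[i] L2 L2 R[i]
  *%R (conjC \; *%R) L2dot (L2dot_linearl, L2dot_linearr).

HB.instance Definition _ := isHermitianSesquilinear.Build R[i] L2
  false conjC L2dot L2dotC.

Lemma L2dot_gt0 u : u != 0 -> 0 < L2dot u u.
Proof.
have mD := measurable_Omega alpha beta.
elim/quotW: u => f f0; rewrite L2dotE.
have /asboolP Sf := L2fun_valP f; have If := normc2_integrable Sf.
rewrite (_ : cintegral _ =
    Complex (\int[mu]_(x in D) (normc2 \o f) x) 0); last first.
  congr Complex; first by apply: eq_Rintegral => x _; rewrite ReMJ -!expr2.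
  rewrite /Rintegral integral0_eq// => x _.
  by rewrite ImMJ mulrC subrr.
rewrite ltcE /= eqxx /= lt_neqAle Rintegral_ge0 ?andbT; last first.
  by move=> x _; exact: normc2_ge0.
apply: contra f0 => /eqP I0.
have {}I0 : (\int[mu]_(x in D) `|(EFin \o (normc2 \o f)) x| = 0)%E.
  under eq_integral do rewrite /= ger0_norm ?normc2_ge0//.
  rewrite -[LHS]fineK; last by apply: integrable_fin_num If.
  by move: I0; rewrite /Rintegral => <-.
have mf := measurable_int _ If.
move/ae_eq_integral_abs : I0 => /(_ mD mf) I0.
apply/eqP; rewrite -[RHS](_ : \pi_L2 0 = 0); last exact: pi_zeror.
apply/pi_L2P; move: I0; apply: ae_imply => x + Dx => /(_ Dx)[] /eqP.
rewrite /normc2 paddr_eq0 ?sqr_ge0// !sqrf_eq0 => /andP[/eqP r0 /eqP i0].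
by case: (f x) r0 i0 => ? ? /= -> ->.
Qed.

HB.instance Definition _ := isDotProduct.Build R[i] L2 L2dot L2dot_gt0.

End square_integrable.

(* Operators are identified with their graphs. *)
Section unbounded_operators.
Context (R : realType) (H : lmodType R[i]) (dot : {dot H for conjC}).
Implicit Types (T : set (H * H)).

Definition hnorm (u : H) : R := Num.sqrt (Re (dot u u)).

Definition linear_operator T : Prop :=
  [/\ T (0, 0),
      forall (a : R[i]) x y x' y', T (x, y) -> T (x', y') ->
        T (a *: x + x', a *: y + y') &
      forall x y y', T (x, y) -> T (x, y') -> y = y'].

Definition domain T : set H := [set x | exists y, T (x, y)].

Definition densely_defined T : Prop :=
  forall x e, 0 < e -> exists2 z, domain T z & hnorm (z - x) < e.

Definition closed_operator T : Prop :=
  forall (x_ y_ : nat -> H) x y, (forall k, T (x_ k, y_ k)) ->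
    hnorm (x_ k - x) @[k --> \oo] --> (0 : R) ->
    hnorm (y_ k - y) @[k --> \oo] --> (0 : R) -> T (x, y).

Definition symmetric_operator T : Prop :=
  densely_defined T /\
  forall x y x' y', T (x, y) -> T (x', y') -> dot y x' = dot x y'.

(* a graph in the usual sense as soon as T is densely defined *)
Definition adjoint T : set (H * H) :=
  [set uv | forall x y, T (x, y) -> dot y uv.1 = dot x uv.2].

Definition self_adjoint T : Prop := densely_defined T /\ adjoint T = T.

End unbounded_operators.

Section momentum.
Context (R : realType) (n : nat) (alpha beta : 'I_n -> R).
Local Notation L2 := (L2 alpha beta).
Implicit Types (f : R -> R[i]) (P : set (R -> R[i])).

(* A function on Omega is represented by any extension to R; values outside
   Omega are irrelevant (Cc_infty uses the extension by zero). *)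
Definition represents (u : L2) f : Prop :=
  {ae lebesgue_measure, forall x, Omega alpha beta x -> f x = repr u x}.

Definition abs_continuous (a b : R) f : Prop :=
  forall e : R, 0 < e -> exists2 d : R, 0 < d &
    forall (m : nat) (s t : 'I_m -> R),
      (forall k, [/\ a < s k, s k < t k & t k < b]) ->
      trivIset setT (fun k => `]s k, t k[%classic) ->
      \sum_k (t k - s k) < d ->
      \sum_k ComplexField.Normc.normc (f (t k) - f (s k)) < e.

(* derive1 has a junk value at points of non-differentiability; for f absolutely
   continuous on each interval these form a null set. *)
Definition cderive f : R -> R[i] := fun x =>
  Complex (derive1 (Re \o f) x) (derive1 (Im \o f) x).

Definition momentum f : R -> R[i] := fun x =>
  (2 * (pi : R)%:C%C * 'i)^-1 * cderive f x.

Definition Dmax : set (R -> R[i]) := [set f : R -> R[i] |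
  (forall i, abs_continuous (alpha i) (beta i) f) /\
  exists v : L2, represents v (cderive f)].

Definition Cc_infty : set (R -> R[i]) := [set f : R -> R[i] |
  (forall k x, derivable (derive1n k (Re \o f)) x 1 /\
               derivable (derive1n k (Im \o f)) x 1) /\
  exists K : set R, [/\ compact K, K `<=` Omega alpha beta &
    forall x, ~ K x -> f x = 0]].

(* the operator f |-> f' / (2 pi i) with domain the set of classes of the f in P
   (when f' is square-integrable for all f in P, e.g. P included in Dmax) *)
Definition momentum_on P : set (L2 * L2) := [set uv |
  exists f, [/\ P f, represents uv.1 f & represents uv.2 (momentum f)]].

Definition right_limit f (a : R) : R[i] :=
  Complex (lim (Re (f x) @[x --> a^'+])) (lim (Im (f x) @[x --> a^'+])).

Definition left_limit f (a : R) : R[i] :=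
  Complex (lim (Re (f x) @[x --> a^'-])) (lim (Im (f x) @[x --> a^'-])).

Definition at_alpha f : 'cV[R[i]]_n := \col_i right_limit f (alpha i).

Definition at_beta f : 'cV[R[i]]_n := \col_i left_limit f (beta i).

End momentum.

Section partial_isometry.
Context (R : realType) (n : nat).

(* dotmx is the standard Hermitian product on row vectors *)
Definition cdot (u v : 'cV[R[i]]_n) : R[i] := dotmx u^T v^T.

Definition partial_isometry (B : 'M[R[i]]_n) (Bl Br : {vspace 'cV[R[i]]_n}) :=
  [/\ (linfun (mulmx B) @: Bl)%VS = Br,
      forall v, v \in Bl -> cdot (B *m v) (B *m v) = cdot v v &
      forall v, (forall w, w \in Bl -> cdot v w = 0) -> B *m v = 0].

End partial_isometry.

(* Main.v *)
Require Import Defs.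
From HB Require Import structures.
From mathcomp Require Import finmap generic_quotient ring_quotient.
From mathcomp Require Import all_boot all_order all_algebra.
From mathcomp Require Import complex sesquilinear spectral.
From mathcomp Require Import ring lra.
From mathcomp Require Import all_classical all_reals all_analysis.
From mathcomp Require Import measurable_realfun.

(** An element of the maximal domain is determined by its derivative and its
    boundary values (f(alpha), f(beta)), and integration by parts on each
    interval gives the Green identity
      <Df, g> - <f, Dg> = (2 pi i)^-1 (f(beta) . g(beta)^* - f(alpha) . g(alpha)^* ).
    The closure of D on Cc_infty contains every f with zero boundary values, and
    its adjoint is the maximal operator.  Closed symmetric extensions therefore
    correspond to linear sets of pairs (p, q) on which p . p'^* = q . q'^*,
    which are exactly the graphs of partial isometries p |-> q; adjoints are
    computed on the boundary space C^n x C^n. *)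

Set Implicit Arguments.
Unset Strict Implicit.
Unset Printing Implicit Defensive.

Import Order.TTheory GRing.Theory Num.Def Num.Theory.
Import numFieldNormedType.Exports.

Local Open Scope classical_set_scope.
Local Open Scope ring_scope.

(** * Absolute continuity and densities *)

(** [Dmax] speaks of epsilon-delta absolute continuity on open intervals and of a pointwise
    derivative, whereas Green's identity needs f to be the integral of its derivative up to the
    endpoints. The bridge is the Lebesgue fundamental theorem of calculus, obtained by applying the
    Radon-Nikodym theorem to the Stieltjes measures of V and V - f, where V is the total variation
    of f. After that, membership in [Dmax] becomes [cdensity], and the operator becomes [graph_bv],
    which attaches to an L^2 class the boundary values of its only absolutely continuous
    representative on Omega. The delicate inclusion is that zero boundary values put f in the
    closure of the minimal operator: a test function close to f' has a primitive that need not
    vanish at the right endpoints, and this small defect is removed by smooth steps fixed in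
    advance. Closedness of the extension given by B is not proved by passing to the limit in
    boundary values: the extension is exhibited as the adjoint of its claimed adjoint. *)

Definition ac (R : realType) (a b : R) (f : R -> R) : Prop :=
  forall e : R, 0 < e -> exists2 d : R, 0 < d &
    forall (m : nat) (s t : 'I_m -> R),
      (forall k, [/\ a < s k, s k < t k & t k < b]) ->
      trivIset setT (fun k => `]s k, t k[%classic) ->
      \sum_k (t k - s k) < d -> \sum_k `|f (t k) - f (s k)| < e.

(** * Total variation of absolutely continuous functions *)

Section ac_total_variation.
Context (R : realType).
Implicit Types (a b x y : R) (f : R -> R).

(** Arbitrary finite index types and degenerate intervals are allowed so that subdivisions, indexed
    by dependent pairs, can serve as families. Degenerate indices contribute to neither sum and are
    dropped through [A]. *)
Lemma ac_finType a b f : ac a b f ->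
  forall e : R, 0 < e -> exists2 d : R, 0 < d &
    forall (I : finType) (s t : I -> R),
      (forall k, [/\ a < s k, s k <= t k & t k < b]) ->
      trivIset setT (fun k => `]s k, t k[%classic) ->
      \sum_k (t k - s k) < d -> \sum_k `|f (t k) - f (s k)| < e.
Proof.
move=> acf e e0; have [d d0 H] := acf e e0; exists d => // I s t st tst std.
pose A := [set k | s k < t k]%SET.
have split_sum (F : R -> R) : \sum_k `|F (t k) - F (s k)| =
    \sum_(k < #|A|) `|F (t (enum_val k)) - F (s (enum_val k))|.
  rewrite -(big_enum_val (fun k => `|F (t k) - F (s k)|)) /=.
  rewrite [RHS]big_mkcond; apply: eq_bigr => k _; rewrite inE.
  have [_ + _] := st k; rewrite le_eqVlt => /predU1P[->|->//].
  by rewrite ltxx subrr normr0.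
rewrite split_sum; apply: H => [k||].
- by have [? _ ?] := st (enum_val k); split => //; have := enum_valP k; rewrite inE.
- move=> i j _ _ ij; apply: enum_val_inj; exact: (tst _ _ Logic.I Logic.I ij).
- move: std; congr (_ < d).
  (* The total length is the variation of the identity, so [split_sum] applies to it as well. *)
  transitivity (\sum_k `|id (t k) - id (s k)|).
    by apply: eq_bigr => k _; rewrite /= ger0_norm// subr_ge0; case: (st k).
  rewrite (split_sum id); apply: eq_bigr => k _; rewrite /= ger0_norm// subr_ge0.
  by have [] := st (enum_val k).
Qed.

(** Subdividing every interval yields another disjoint family of the same total length, indexed by
    the pairs [J] of an interval and one of its cells; the sum over it is the sum of the
    variations. *)
Lemma variation_lt_ac a b f (e d : R) :
    (forall (I : finType) (s t : I -> R),
      (forall k, [/\ a < s k, s k <= t k & t k < b]) ->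
      trivIset setT (fun k => `]s k, t k[%classic) ->
      \sum_k (t k - s k) < d -> \sum_k `|f (t k) - f (s k)| < e) ->
    forall (I : finType) (s t : I -> R) (l : I -> seq R),
      (forall k, [/\ a < s k, s k <= t k & t k < b]) ->
      trivIset setT (fun k => `]s k, t k[%classic) ->
      (forall k, itv_partition (s k) (t k) (l k)) ->
      \sum_k (t k - s k) < d -> \sum_k variation (s k) (t k) f (l k) < e.
Proof.
move=> H I s t l st tst lP std.
pose J := {k : I & 'I_(size (l k))}.
pose p (k : I) (n : nat) := nth (t k) (s k :: l k) n.
have pmono k m n : (m < n <= size (l k))%N -> p k m < p k n.
  move=> /andP[mn nl]; have [pl _] := lP k.
  apply: (sorted_ltn_nth lt_trans) => //; rewrite inE/= ltnS//.
  by rewrite (leq_trans (ltnW mn)).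
have p0 k : p k 0%N = s k by [].
have pl k : p k (size (l k)) = t k.
  by have [_ /eqP <-] := lP k; rewrite /p nth_last; case: (l k).
have plem k m n : (m <= n <= size (l k))%N -> p k m <= p k n.
  move=> /andP[]; rewrite leq_eqVlt => /predU1P[->//|mn nl].
  by apply/ltW/pmono; rewrite mn.
have sple k n : (n <= size (l k))%N -> s k <= p k n.
  by move=> nl; rewrite -(p0 k) plem// nl.
have ptle k n : (n <= size (l k))%N -> p k n <= t k.
  by move=> nl; rewrite -(pl k) plem// nl leqnn.
have big (F : R -> R) : \sum_(u : J) `|F (p (tag u) (tagged u).+1) - F (p (tag u) (tagged u))|
    = \sum_k variation (s k) (t k) F (l k).
  rewrite -(sig_big_dep xpredT (fun _ => xpredT)
     (fun k (i : 'I_(size (l k))) => `|F (p k i.+1) - F (p k i)|)) /=.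
  by apply: eq_bigr => k _; rewrite /variation big_mkord.
rewrite -big; apply: H => [[k i]||]/=.
- have [? ? ?] := st k; split.
  + by rewrite (@lt_le_trans _ _ (s k))// sple// ltnW.
  + by rewrite plem// leqnSn/=.
  + by rewrite (@le_lt_trans _ _ (t k))// ptle.
- move=> [k i] [k' i'] _ _ [/= z []].
  rewrite !in_itv/= => /andP[z1 z2] /andP[z3 z4].
  have kk' : k = k'.
    apply: tst => //; exists z; split; rewrite /= in_itv/=; apply/andP; split.
    + by rewrite (le_lt_trans _ z1)// sple// ltnW.
    + by rewrite (lt_le_trans z2)// ptle.
    + by rewrite (le_lt_trans _ z3)// sple// ltnW.
    + by rewrite (lt_le_trans z4)// ptle.
  subst k'; congr existT; apply/val_inj/eqP; rewrite eqn_leq.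
  apply/andP; split; rewrite leqNgt; apply/negP => ii.
    have : p k i'.+1 <= p k i by apply: plem; rewrite ii ltnW.
    by rewrite leNgt (lt_trans z1).
  have : p k i.+1 <= p k i' by apply: plem; rewrite ii ltnW.
  by rewrite leNgt (lt_trans z3).
- move: std; congr (_ < d).
  transitivity (\sum_k variation (s k) (t k) id (l k)).
    apply: eq_bigr => k _; rewrite nondecreasing_variation//.
  rewrite -big; apply: eq_bigr => -[k i] _ /=; rewrite ger0_norm// subr_ge0.
  by rewrite plem// leqnSn/=.
Qed.

(** With tolerance 1, every subinterval shorter than [d] has variation at most 1, and finitely many
    steps of length [d / 2] lead from x to y. *)
Lemma ac_bounded_variation a b x y f : ac a b f ->
  a < x -> x <= y -> y < b -> bounded_variation x y f.
Proof.
move=> /ac_finType/(_ 1 ltr01)[d d0 /variation_lt_ac H] ax xy yb.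
apply/bounded_variationP => //.
have small u v : a < u -> u <= v -> v < b -> v - u < d ->
    total_variation u v f \is a fin_num.
  move=> au uv vb uvd; apply/bounded_variationP => //.
  exists 1 => _ [l lP <-]; apply/ltW.
  have := H 'I_1 (fun=> u) (fun=> v) (fun=> l); rewrite !big_ord1; apply => //.
  by move=> i j _ _ _; rewrite !ord1.
have [n] : exists n, y - x < d / 2 * n%:R.
  exists (truncn ((y - x) / (d / 2))).+1; rewrite mulrC -ltr_pdivrMr ?divr_gt0//.
  by rewrite truncnS_gt.
elim: n x ax xy => [|n IH] x ax xy yxn.
  by move: yxn; rewrite mulr0 subr_lt0 ltNge xy.
have [|yx] := ltP (y - x) d; first exact: small.
have xd : x <= x + d / 2 by rewrite lerDl divr_ge0// ltW.
have dy : x + d / 2 <= y by lra.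
rewrite (total_variationD f xd dy) fin_numD small ?IH//; try lra.
Qed.

(** Each total variation is a supremum nearly attained by one partition, and these partitions
    together are controlled by [variation_lt_ac]. This makes the total variation of f itself
    absolutely continuous. *)
Lemma ac_total_variation a b f : ac a b f ->
  forall e : R, 0 < e -> exists2 d : R, 0 < d &
    forall (I : finType) (s t : I -> R),
      (forall k, [/\ a < s k, s k <= t k & t k < b]) ->
      trivIset setT (fun k => `]s k, t k[%classic) ->
      \sum_k (t k - s k) < d ->
      \sum_k fine (total_variation (s k) (t k) f) < e.
Proof.
move=> acf e e0; have /(ac_finType acf)[d d0 H] : 0 < e / 2 by rewrite divr_gt0.
exists d => // I s t st tst std.
(* [e'] is the error made on each interval; the errors add up to at most [e / 2], and the successor
   keeps the denominator nonzero when [I] is empty. *)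
pose e' := e / 2 / #|I|.+1%:R.
have e'0 : 0 < e' by rewrite !divr_gt0.
have /choice[l lP] k : exists l, itv_partition (s k) (t k) l /\
    fine (total_variation (s k) (t k) f) <= variation (s k) (t k) f l + e'.
  have [ak] := st k; rewrite le_eqVlt => /predU1P[E|stk] kb.
    exists [::]; rewrite -E total_variationxx/=; split; first by split.
    by rewrite variation_nil add0r ltW.
  have bv : bounded_variation (s k) (t k) f by exact: (ac_bounded_variation acf _ (ltW _)).
  have fT : total_variation (s k) (t k) f \is a fin_num.
    by apply/bounded_variationP => //; exact: ltW.
  have [_ [_ [l lP <-] <-] lt] := ub_ereal_sup_adherent e'0 fT.
  exists l; split => //; apply/ltW.
  by rewrite -ltrBlDr -lte_fin EFinB fineK.
apply: (@le_lt_trans _ _ (\sum_k (variation (s k) (t k) f (l k) + e'))).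
  by apply: ler_sum => k _; case: (lP k).
rewrite big_split/= (splitr e) ltr_leD//.
  by apply: (variation_lt_ac H) => // k; case: (lP k).
rewrite sumr_const.
rewrite -[leLHS]mulr_natr /e' mulrAC.
rewrite ler_pdivrMr//.
by rewrite ler_pM2l ?divr_gt0// ler_nat cardT -cardE.
Qed.

End ac_total_variation.

(* By outer regularity, absolute continuity of F makes its Lebesgue-Stieltjes
   measure absolutely continuous with respect to the Lebesgue measure; the
   density of F is the Radon-Nikodym derivative. *)
Section stieltjes_density.
Context (R : realType).
Local Notation mu := (@lebesgue_measure R).
Variables (F : cumulative R R) (M : R).
Hypothesis F_bounded : forall s t, F t - F s <= M.
Hypothesis F_ac : forall e : R, 0 < e -> exists2 d : R, 0 < d &
    forall (m : nat) (s t : 'I_m -> R), (forall k, s k <= t k) ->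
      trivIset setT (fun k => `]s k, t k[%classic) ->
      \sum_k (t k - s k) < d -> \sum_k (F (t k) - F (s k)) <= e.

Let nu := lebesgue_stieltjes_measure F.

Let nuE s t : s <= t -> nu `]s, t]%classic = (F t - F s)%:E.
Proof.
move=> st; rewrite /nu /lebesgue_stieltjes_measure /measure_extension/=.
by rewrite measurable_mu_extE/= ?wlength_itv_bnd//; exact: is_ocitv.
Qed.

Let nu_finite : (nu setT < +oo)%E.
Proof.
rewrite -(bigcup_itvT false false).
have h : nu `]- n%:R, n%:R] @[n --> \oo] --> nu (\bigcup_n `]- n%:R, n%:R]%classic).
  apply: nondecreasing_cvg_mu => //; first exact: bigcup_measurable.
  by move=> *; apply/subsetPset/subset_itv; rewrite leBSide/= ?lerN2 ler_nat.
rewrite -(cvg_lim _ h)//; apply: (@le_lt_trans _ _ M%:E); last exact: ltry.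
apply: lime_le; first by apply/cvg_ex; eexists; exact: h.
by apply: nearW => n; rewrite nuE ?lee_fin// ge0_cp.
Qed.

Let fin_nu : fin_num_fun nu.
Proof.
move=> A mA; rewrite ge0_fin_numE ?measure_ge0//.
by rewrite (le_lt_trans _ nu_finite)// le_measure ?inE.
Qed.

Let nu_itvoo s t : s <= t -> (nu `]s, t[%classic <= (F t - F s)%:E)%E.
Proof.
by move=> st; rewrite -nuE// le_measure ?inE//; apply: subset_itvl; rewrite bnd_simp.
Qed.

(** An open set is a countable disjoint union of open intervals; each finite partial sum is
    controlled by the hypothesis, and the bound survives the limit. *)
Let nu_open (e d : R) (U : set R) :
    (forall (m : nat) (s t : 'I_m -> R), (forall k, s k <= t k) ->
      trivIset setT (fun k => `]s k, t k[%classic) ->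
      \sum_k (t k - s k) < d -> \sum_k (F (t k) - F (s k)) <= e) ->
  open U -> (mu U < d%:E)%E -> (nu U <= e%:E)%E.
Proof.
move=> H oU Ud.
pose I := open_disjoint_itv oU.
have mI n : measurable (I n) by apply: open_measurable; exact: open_disjoint_itv_open.
have tI : trivIset setT I := @open_disjoint_itv_trivIset _ _ oU.
have UI : U = \bigcup_q I q := open_disjoint_itv_bigcup oU.
have mU : measurable U by exact: open_measurable.
(* Finite measure excludes unbounded components and openness ([II]) excludes endpoints; an empty
   component is given the endpoints 0 and 0. *)
have /choice[st stP] n : exists st : R * R, st.1 <= st.2 /\ I n = `]st.1, st.2[%classic.
  have muI : (mu (I n) < +oo)%E.
    rewrite (@le_lt_trans _ _ (mu U))//; last by rewrite (lt_trans Ud)// ltry.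
    apply: le_measure; rewrite ?inE; [exact: mI|exact: mU|].
    by rewrite UI; exact: bigcup_sup.
  have [I0|/set0P[x0 Ix0]] := eqVneq (I n) set0.
    by exists (0, 0); rewrite I0 set_itvoo0.
  have /is_intervalP IE : is_interval (I n) := @open_disjoint_itv_is_interval _ _ oU n.
  have oI : open (I n) := @open_disjoint_itv_open _ _ oU n.
  have II x : I n x -> exists2 e : R, 0 < e & I n (x - e) /\ I n (x + e).
    move=> Ix; have /open_nbhs_nbhs/nbhs_ballP[r /= r0 rI] : open_nbhs x (I n) by [].
    exists (r / 2); first by rewrite divr_gt0.
    by split; apply: rI; rewrite /ball/= ?opprB ?subrKC ?opprD ?addNKr
       ?normrN ger0_norm ?divr_ge0// ?ltW// gtr_pMr// invf_lt1// ltr1n.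
  rewrite IE in muI II Ix0 *.
  case: (Rhull (I n)) muI II Ix0 => -[b1 s|[]] [b2 t|[]] //= muI II Ix0.
  - exists (s, t); split => /=.
      by move: Ix0; rewrite in_itv => /andP[/lteifW + /lteifW]; exact: le_trans.
    apply/seteqP; split => x /=.
      move=> /II[r r0 []]; rewrite !in_itv/= => /andP[/lteifW sx _] /andP[_ /lteifW xt].
      by apply/andP; split; [apply: (le_lt_trans sx)|apply: (lt_le_trans _ xt)]; lra.
    by rewrite !in_itv/= => /andP[/lteifS -> /lteifS ->].
  - by move: Ix0; rewrite in_itv/= andbF.
  - by move: muI; rewrite lebesgue_measure_itv/= ltry.
  - by move: muI; rewrite lebesgue_measure_itv/= ltNyr.
  - by move: muI; rewrite lebesgue_measure_itv/=.
have muI n : mu (I n) = ((st n).2 - (st n).1)%:E.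
  have [+ ->] := stP n; rewrite le_eqVlt lebesgue_measure_itv/= lte_fin.
  by case: ltgtP => //= ->; rewrite subrr.
have stt m : trivIset setT (fun k : 'I_m => `](st k).1, (st k).2[%classic).
  move=> i j _ _; have [_ <-] := stP i; have [_ <-] := stP j => ij.
  by apply/val_inj; exact: (tI _ _ Logic.I Logic.I ij).
have nuU : nu U = (\sum_(0 <= i <oo) nu (I i))%E.
  by rewrite UI; apply: measure_semi_bigcup => //; rewrite -UI.
have muU : mu U = (\sum_(0 <= i <oo) mu (I i))%E.
  by rewrite UI; apply: measure_semi_bigcup => //; rewrite -UI.
rewrite nuU; apply: lime_le; first exact: is_cvg_nneseries.
apply: nearW => m; apply: (@le_trans _ _ (\sum_(i < m) (F (st i).2 - F (st i).1))%:E).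
  rewrite big_mkord -sumEFin; apply: lee_sum => i _.
  by have [? ->] := stP i; exact: nu_itvoo.
rewrite lee_fin; apply: H => //; first by move=> k; have [] := stP k.
rewrite -lte_fin (le_lt_trans _ Ud)// muU -sumEFin.
rewrite (eq_bigr (fun i : 'I_m => mu (I i))) => [|i _]; last by rewrite muI.
by rewrite -(big_mkord xpredT (fun i => mu (I i))) nneseries_lim_ge.
Qed.

Lemma stieltjes_density : exists g : R -> R,
  mu.-integrable setT (EFin \o g) /\
  forall s t, s <= t -> F t - F s = \int[mu]_(x in `]s, t]) g x.
Proof.
pose nuf : {finite_measure set (measurableTypeR R) -> \bar R} :=
  HB.pack (lebesgue_stieltjes_measure F)
    (Measure_isFinite.Build _ _ _ (lebesgue_stieltjes_measure F) fin_nu).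
have dom : nuf `<< mu.
  move=> N N0 A mA AN; apply/eqP; rewrite eq_le measure_ge0 andbT.
  apply/lee_addgt0Pr => e e0; rewrite add0e.
  have [d d0 H] := F_ac e0.
  have muA : mu A = 0%E by exact: N0.
  have [U [oU AU Ud]] : exists U : set R, [/\ open U, A `<=` U & (mu (U `\` A) < d%:E)%E].
    apply: lebesgue_regularity_outer => //.
    by rewrite [X in (X < _)%E]muA ltry.
  have mU : measurable U by exact: open_measurable.
  apply: (@le_trans _ _ (nu U)); first by apply: le_measure; rewrite ?inE.
  apply: nu_open H oU _.
  rewrite -(setDUK AU) (le_lt_trans (measureU2 _ mA (measurableD mU mA)))//.
  by rewrite [X in (X + _)%E]muA add0e.
have [g [g0 gfin intg gE]] := radon_nikodym_sigma_finite dom.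
have gE' : EFin \o (fine \o g) = g by apply/funext => x /=; rewrite fineK.
exists (fine \o g); rewrite gE'; split=> // s t st.
rewrite /Rintegral; under eq_integral do rewrite /= fineK//.
rewrite -gE; last exact: measurable_itv.
by rewrite [X in fine X]nuE.
Qed.

End stieltjes_density.

(** * Densities of absolutely continuous functions *)

Section ac_density.
Context (R : realType).
Local Notation mu := (@lebesgue_measure R).
Implicit Types (a b x y : R) (f : R -> R).

(** [stieltjes_density] wants a monotone function on the whole line, so [K] is precomposed with the
    clamp [c] onto [x, y]. The clamp is monotone and 1-Lipschitz: it keeps disjoint intervals
    disjoint and does not increase total length. *)
Lemma nondecreasing_ac_density (K : R -> R) x y : x <= y ->
  {in `[x, y] &, {homo K : s t / s <= t}} ->
  (forall e : R, 0 < e -> exists2 d : R, 0 < d &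
    forall (m : nat) (s t : 'I_m -> R), (forall k, [/\ x <= s k, s k <= t k & t k <= y]) ->
      trivIset setT (fun k => `]s k, t k[%classic) ->
      \sum_k (t k - s k) < d -> \sum_k (K (t k) - K (s k)) <= e) ->
  exists g : R -> R, mu.-integrable setT (EFin \o g) /\
    forall s t, x <= s -> s <= t -> t <= y -> K t - K s = \int[mu]_(z in `]s, t]) g z.
Proof.
move=> xy ndK acK.
pose c z := if z <= x then x else if y <= z then y else z.
have cP z : [\/ z <= x /\ c z = x, [/\ x < z, y <= z & c z = y]
    | [/\ x < z, z < y & c z = z]].
  rewrite /c; case: (leP z x) => zx; first by constructor 1.
  by case: (leP y z) => yz; [constructor 2|constructor 3].
have cxy z : c z \in `[x, y].
  by rewrite in_itv/=; case: (cP z) => [[? ->]|[? ? ->]|[? ? ->]]; lra.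
have c_id z : x <= z -> z <= y -> c z = z.
  by case: (cP z) => [[? ->]|[? ? ->]|[? ? ->]]; lra.
have c_nd : {homo c : s t / s <= t}.
  by move=> s t; case: (cP s) => [[? ->]|[? ? ->]|[? ? ->]];
    case: (cP t) => [[? ->]|[? ? ->]|[? ? ->]]; lra.
have c_lip s t : s <= t -> c t - c s <= t - s.
  by case: (cP s) => [[? ->]|[? ? ->]|[? ? ->]];
    case: (cP t) => [[? ->]|[? ? ->]|[? ? ->]]; lra.
have c_oo s t z : c s < z -> z < c t -> s < z /\ z < t.
  by case: (cP s) => [[? ->]|[? ? ->]|[? ? ->]];
    case: (cP t) => [[? ->]|[? ? ->]|[? ? ->]]; split; lra.
pose F := K \o c.
have F_nd : {homo F : s t / s <= t} by move=> s t st; apply: ndK => //; exact: c_nd.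
have F_ac e : 0 < e -> exists2 d : R, 0 < d &
    forall (m : nat) (s t : 'I_m -> R), (forall k, s k <= t k) ->
      trivIset setT (fun k => `]s k, t k[%classic) ->
      \sum_k (t k - s k) < d -> \sum_k (F (t k) - F (s k)) <= e.
  move=> /acK[d d0 H]; exists d => // m s t st tst std; apply: H.
  - move=> k; have := cxy (s k); have := cxy (t k); rewrite !in_itv/=.
    by move=> /andP[_ ->] /andP[-> _]; split=> //; exact: c_nd.
  - move=> i j _ _ [z [/=]]; rewrite !in_itv/= => /andP[h1 h2] /andP[h3 h4].
    have [? ?] := c_oo _ _ _ h1 h2; have [? ?] := c_oo _ _ _ h3 h4.
    by apply: tst => //; exists z; split; rewrite /= in_itv/=; apply/andP.
  - by apply: le_lt_trans std; apply: ler_sum => k _; exact: c_lip.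
(* Right continuity is absolute continuity for families of one interval. *)
have F_rc z : F w @[w --> z^'+] --> F z.
  apply/cvgrPdist_le => e e0; have [d d0 H] := F_ac e e0.
  near=> w; have zw : z <= w by near: w; exact: nbhs_right_ge.
  rewrite distrC ger0_norm ?subr_ge0 ?F_nd//.
  have := H 1%N (fun=> z) (fun=> w); rewrite !big_ord1; apply => //.
    by move=> i j _ _ _; rewrite !ord1.
  by rewrite ltrBlDl; near: w; apply: nbhs_right_lt; rewrite ltrDl.
pose Fc : cumulative R R := HB.pack F (isCumulative.Build R _ R F F_nd F_rc).
have F_bd s t : Fc t - Fc s <= K y - K x.
  by apply: lerB; apply: ndK => //; rewrite ?in_itv/= ?lexx ?xy//; have := cxy s;
    have := cxy t; rewrite !in_itv/= => /andP[? ?] /andP[? ?].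
have [g [ig gE]] := @stieltjes_density _ Fc _ F_bd F_ac.
exists g; split=> // s t xs st ty; rewrite -gE// /= /F/= !c_id//.
  exact: le_trans st ty.
exact: le_trans xs st.
Unshelve. all: by end_near. Qed.

(* f is the difference of its total variation and a nondecreasing function. *)
Lemma ac_density a b f x y : ac a b f -> a < x -> x <= y -> y < b ->
  exists g : R -> R, mu.-integrable setT (EFin \o g) /\
    forall s t, x <= s -> s <= t -> t <= y -> f t - f s = \int[mu]_(z in `]s, t]) g z.
Proof.
move=> acf ax xy yb.
pose V z := fine (total_variation x z f).
have bvf : bounded_variation x y f by exact: ac_bounded_variation acf _ _ _.
have VB s t : x <= s -> s <= t -> t <= y -> V t - V s = fine (total_variation s t f).
  move=> xs st ty; have xt := le_trans xs st; have sy := le_trans st ty.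
  have fs : total_variation x s f \is a fin_num.
    by apply/bounded_variationP => //; exact: bounded_variationl bvf.
  have ft : total_variation s t f \is a fin_num.
    apply/bounded_variationP => //; apply: (ac_bounded_variation acf) => //.
      exact: lt_le_trans xs.
    exact: le_lt_trans yb.
  by rewrite /V (total_variationD f xs st) fineD// addrAC subrr add0r.
have f_le s t : x <= s -> s <= t -> t <= y -> `|f t - f s| <= V t - V s.
  move=> xs st ty; rewrite VB// -lee_fin fineK; first exact: total_variation_ge.
  apply/bounded_variationP => //; apply: (ac_bounded_variation acf) => //.
    exact: lt_le_trans xs.
  exact: le_lt_trans yb.
have acV e : 0 < e -> exists2 d : R, 0 < d &
    forall (m : nat) (s t : 'I_m -> R), (forall k, [/\ x <= s k, s k <= t k & t k <= y]) ->
      trivIset setT (fun k => `]s k, t k[%classic) ->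
      \sum_k (t k - s k) < d -> \sum_k (V (t k) - V (s k)) <= e.
  move=> /(ac_total_variation acf)[d d0 H]; exists d => // m s t st tst std.
  rewrite (eq_bigr (fun k => fine (total_variation (s k) (t k) f))) => [|k _]; last first.
    by have [? ? ?] := st k; rewrite VB.
  apply/ltW/H => // k; have [? ? ?] := st k; split => //.
    exact: lt_le_trans ax _.
  exact: le_lt_trans yb.
have [|g1 [ig1 g1E]] := @nondecreasing_ac_density V x y xy _ acV.
  move=> s t; rewrite !in_itv/= => /andP[? ?] /andP[? ?] st; rewrite -subr_ge0.
  by rewrite (le_trans _ (f_le s t _ _ _)).
have [|e e0|g2 [ig2 g2E]] := @nondecreasing_ac_density (fun z => V z - f z) x y xy.
- move=> s t; rewrite !in_itv/= => /andP[? ?] /andP[? ?] st.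
  have : `|f t - f s| <= V t - V s by exact: f_le.
  by have := ler_norm (f t - f s); lra.
(* Increments of [V - f] are at most twice those of [V], whence [e / 2]. *)
- have /acV[d d0 H] : 0 < e / 2 by rewrite divr_gt0.
  exists d => // m s t st tst std; apply: le_trans (_ : 2 * (e / 2) <= _); last by lra.
  apply: le_trans (_ : 2 * \sum_k (V (t k) - V (s k)) <= _); last first.
    by rewrite ler_pM2l// H.
  rewrite mulr_sumr; apply: ler_sum => k _; have [? ? ?] := st k.
  have : `|f (t k) - f (s k)| <= V (t k) - V (s k) by exact: f_le.
  by have := ler_norm (- (f (t k) - f (s k))); rewrite normrN; lra.
exists (g1 \- g2); split.
  by rewrite (_ : EFin \o _ = (EFin \o g1) \- (EFin \o g2))%E//; exact: integrableB.
move=> s t xs st ty; rewrite RintegralB//; last 2 first.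
- exact: integrableS ig1.
- exact: integrableS ig2.
by rewrite -g1E// -g2E//; lra.
Qed.

End ac_density.

(** [f] is a primitive of [g] on ]a, b[. Half-open intervals concatenate exactly and match the
    Stieltjes measure of ]s, t]; only interior points occur, so nothing is said about [f] at the
    endpoints. *)
Definition has_density (R : realType) (a b : R) (f g : R -> R) : Prop :=
  forall s t, a < s -> s <= t -> t < b ->
    f t - f s = \int[@lebesgue_measure R]_(x in `]s, t]) g x.

(** * The fundamental theorem of calculus for Lebesgue integrals *)

Section has_density.
Context (R : realType).
Local Notation mu := (@lebesgue_measure R).
Implicit Types (a b x y : R) (f g : R -> R).

Lemma integrable_setS g (D E : set R) : measurable D -> measurable E ->
  E `<=` D -> mu.-integrable D (EFin \o g) -> mu.-integrable E (EFin \o g).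
Proof. by move=> mD mE ED; exact: integrableS. Qed.

Lemma ac_has_density a b f x y : ac a b f -> a < x -> x <= y -> y < b ->
  exists g : R -> R, mu.-integrable setT (EFin \o g) /\ has_density x y f g.
Proof.
move=> acf ax xy yb; have [g [ig gE]] := ac_density acf ax xy yb.
by exists g; split => // s t xs st ty; apply: gE => //; exact: ltW.
Qed.

(** At a Lebesgue point x of [g], the primitive based at the midpoint [c] of a and x has derivative
    [g x], and [f] differs from it by the constant [f c] near x. *)
Lemma density_derive a b f g : mu.-integrable setT (EFin \o g) ->
  has_density a b f g ->
  {ae mu, forall x, a < x -> x < b -> derivable f x 1 /\ derive1 f x = g x}.
Proof.
move=> ig fg.
have locg : locally_integrable setT g by apply: open_integrable_locally => //; exact: openT.
have := lebesgue_differentiation locg.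
apply: filterS; first exact: (ae_filter_ringOfSetsType mu).
move=> x lx ax xb.
pose c := (a + x) / 2; have [ac' cx] : a < c /\ c < x by rewrite /c; split; lra.
have ii u v : mu.-integrable [set` Interval u v] (EFin \o g).
  by apply: integrable_setS ig => //; exact: measurable_itv.
have x1 : x < x + 1 by rewrite ltrDl.
have [dF F'] := @FTC1_lebesgue_pt _ g (BRight c) x _ x1 (ii _ _) cx lx.
set F := fun y => _ in dF F'.
have fF : {near x, (fun y => F y + f c) =1 f}.
  near=> y; have cy : c < y by near: y; exact: lt_nbhsr.
  have yb : y < b by near: y; exact: lt_nbhsl.
  by rewrite /= /F -(fg c y) ?(ltW cy)// subrK.
have dFc : derivable (fun y => F y + f c) x 1 by exact: derivableD dF (derivable_cst _ _ _).
split; first exact: near_eq_derivable dFc.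
have -> : derive1 f x = derive1 (fun y => F y + f c) x.
  by rewrite !derive1E; apply/esym/near_eq_derive.
rewrite derive1E [LHS](deriveD dF (derivable_cst _ _ _)) derive_cst addr0.
by rewrite -derive1E.
Unshelve. all: by end_near. Qed.

Lemma ae_eq_Rintegral (D : set R) g h : measurable D ->
  mu.-integrable D (EFin \o g) -> mu.-integrable D (EFin \o h) ->
  {ae mu, forall x, D x -> g x = h x} ->
  \int[mu]_(x in D) g x = \int[mu]_(x in D) h x.
Proof.
move=> mD ig ih gh; congr fine; apply: ae_eq_integral => //.
- exact: measurable_int ig.
- exact: measurable_int ih.
- by move: gh; apply: filterS; [exact: (ae_filter_ringOfSetsType mu)|move=> x /= H /H ->].
Qed.

(** The density [h] found by [ac_has_density] on a slightly larger interval ]c, d[ equals f' almost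
    everywhere by [density_derive], hence equals [g]. The interval is enlarged because [has_density]
    speaks of interior points only. *)
Lemma ac_FTC a b f g : ac a b f -> mu.-integrable setT (EFin \o g) ->
  {ae mu, forall x, a < x -> x < b -> derive1 f x = g x} -> has_density a b f g.
Proof.
move=> acf ig f'g s t sa st tb.
pose c := (a + s) / 2; pose d := (t + b) / 2.
have [ac' cs] : a < c /\ c < s by rewrite /c; split; lra.
have [td db] : t < d /\ d < b by rewrite /d; split; lra.
have cd : c <= d by lra.
have [h [ih fh]] := ac_has_density acf ac' cd db.
rewrite fh//; apply: ae_eq_Rintegral; first exact: measurable_itv.
- by apply: integrable_setS ih => //; exact: measurable_itv.
- by apply: integrable_setS ig => //; exact: measurable_itv.
- move: (density_derive ih fh) f'g.
  apply: filterS2; first exact: (ae_filter_ringOfSetsType mu).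
  move=> x fx gx /=; rewrite in_itv/= => /andP[sx xt].
  have cx : c < x by lra.
  have xd : x < d by lra.
  by have [_ <-] := fx cx xd; apply: gx; lra.
Qed.

(** Absolute continuity of the integral: the integral of |g| over the union [D] of the intervals is
    small once the measure of [D] is. *)
Lemma density_ac a b f g : mu.-integrable setT (EFin \o g) ->
  has_density a b f g -> ac a b f.
Proof.
move=> ig fg e e0; have [d [d0 H]] := integral_normr_continuous ig e0.
exists d => // m s t st tst std.
have mst (k : 'I_m) : measurable (`]s k, t k[%classic : set R) by exact: measurable_itv.
have ii u v : mu.-integrable [set` Interval u v] (EFin \o g).
  by apply: integrable_setS ig => //; exact: measurable_itv.
pose D := \big[setU/set0]_(k <- index_enum 'I_m) `]s k, t k[%classic.
have mD : measurable D by apply: bigsetU_measurable.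
have tstD : trivIset [set` index_enum 'I_m] (fun k => `]s k, t k[%classic).
  by apply: sub_trivIset tst.
have ng : measurable_fun setT (fun x => `|g x|%:E).
  by apply/measurable_EFinP; apply: measurableT_comp => //; apply/measurable_EFinP;
    exact: measurable_int ig.
have ing : mu.-integrable setT (EFin \o (fun x => `|g x|)).
  exact: (integrable_abse ig).
apply: (@le_lt_trans _ _ (\int[mu]_(x in D) `|g x|)); last first.
  apply: H => //.
  rewrite -[X in (X < _)%E]mul1e -(@integral_cst _ _ _ mu D mD 1).
  rewrite ge0_integral_bigsetU//; last exact: index_enum_uniq.
  rewrite (eq_bigr (fun k => (t k - s k)%:E)) ?sumEFin ?lte_fin// => k _.
  rewrite integral_cst// mul1e.
  transitivity (mu `]s k, t k[%classic) => //; rewrite lebesgue_measure_itv/= lte_fin.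
  by have [_ -> _] := st k.
rewrite [leRHS](_ : _ = \sum_k \int[mu]_(x in `]s k, t k[) `|g x|); last first.
  rewrite /Rintegral integral_bigsetU_EFin//.
  - rewrite -sum_fine// => k _.
    by apply: integrable_fin_num; [exact: measurable_itv|exact: integrable_setS ing].
  - exact: index_enum_uniq.
  - exact: measurable_funS ng.
apply: ler_sum => k _; have [ak sk kb] := st k.
rewrite fg//; last exact: ltW.
rewrite -Rintegral_itv_bndo_bndc; last exact: ii.
by apply: le_normr_Rintegral; [exact: measurable_itv|exact: ii].
Qed.

End has_density.

(** * Limits at the endpoints and integration by parts *)

Section density_limits.
Context (R : realType).
Local Notation mu := (@lebesgue_measure R).
Implicit Types (a b x y : R) (f g : R -> R).

Lemma integrable_patch (D : set R) g : measurable D ->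
  mu.-integrable D (EFin \o g) -> mu.-integrable setT (EFin \o (g \_ D : R -> R)).
Proof.
move=> mD ig.
have -> : EFin \o (g \_ D : R -> R) = (EFin \o g) \_ D by rewrite restrict_EFin.
by move: ig; rewrite integrable_mkcond.
Qed.

Lemma Rintegral_itv_small g (e : R) : mu.-integrable setT (EFin \o g) -> 0 < e ->
  exists2 d : R, 0 < d & forall (b1 b2 : bool) u v, v - u < d ->
    `|\int[mu]_(x in [set` Interval (BSide b1 u) (BSide b2 v)]) g x| < e.
Proof.
move=> ig e0; have [d [d0 H]] := integral_normr_continuous ig e0.
exists d => // b1 b2 u v uvd.
set I := [set` _].
have mI : measurable I by exact: measurable_itv.
apply: le_lt_trans (H I mI _).
  by apply: le_normr_Rintegral => //; exact: integrable_setS ig.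
rewrite [X in (X < _)%E](lebesgue_measure_itv (Interval (BSide b1 u) (BSide b2 v)))/=.
by rewrite lte_fin; case: ifP => _; rewrite -?EFinB lte_fin.
Qed.

Lemma Rintegral_itv_oc_split g a x (b : itv_bound R) :
  mu.-integrable setT (EFin \o g) -> a <= x -> (BRight x <= b)%O ->
  \int[mu]_(z in [set` Interval (BRight a) b]) g z =
  \int[mu]_(z in `]a, x]) g z + \int[mu]_(z in [set` Interval (BRight x) b]) g z.
Proof.
move=> ig ax xb.
have ii u v : mu.-integrable [set` Interval u v] (EFin \o g).
  by apply: integrable_setS ig => //; exact: measurable_itv.
by rewrite -(Rintegral_itvB (ii (BRight a) b) _ xb)// [RHS]addrC subrK.
Qed.

(** The limits exist because [g] is integrable up to the endpoints: [la] is obtained by integrating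
    back from the midpoint [c], and integrals over short intervals are small. *)
Lemma density_limits a b f g : a < b -> mu.-integrable setT (EFin \o g) ->
  has_density a b f g -> exists la lb : R,
  [/\ f x @[x --> a^'+] --> la, f x @[x --> b^'-] --> lb,
     forall x, a < x -> x < b -> f x = la + \int[mu]_(z in `]a, x]) g z &
     lb = la + \int[mu]_(z in `]a, b[) g z].
Proof.
move=> ab ig fg.
pose c := (a + b) / 2; have [ac' cb] : a < c /\ c < b by rewrite /c; split; lra.
pose la := f c - \int[mu]_(z in `]a, c]) g z.
pose lb := la + \int[mu]_(z in `]a, b[) g z.
have fE x : a < x -> x < b -> f x = la + \int[mu]_(z in `]a, x]) g z.
  move=> ax xb; rewrite /la; have [cx|xc] := leP c x.
    rewrite (@Rintegral_itv_oc_split _ a c (BRight x))// ?(ltW ac')//.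
    by rewrite -(fg c x)// addrA subrK subrKC.
  rewrite (@Rintegral_itv_oc_split _ a x (BRight c))// ?(ltW ax)// -?(fg x c) ?(ltW xc)//; last first.
    by rewrite bnd_simp ltW.
  by rewrite opprD opprB addrA addrAC subrK subrKC.
exists la, lb; split=> //.
- apply/cvgrPdist_lt => e e0; have [d d0 H] := Rintegral_itv_small ig e0.
  near=> x; have ax : a < x by near: x; exact: nbhs_right_gt.
  have xb : x < b by near: x; exact: nbhs_right_lt.
  rewrite fE// opprD addrA subrr sub0r normrN; apply: H.
  by rewrite ltrBlDl; near: x; apply: nbhs_right_lt; rewrite ltrDl.
- apply/cvgrPdist_lt => e e0; have [d d0 H] := Rintegral_itv_small ig e0.
  near=> x; have ax : a < x by near: x; exact: nbhs_left_gt.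
  have xb : x < b by near: x; exact: nbhs_left_lt.
  rewrite fE// /lb (@Rintegral_itv_oc_split _ a x (BLeft b))// ?(ltW ax)//.
  rewrite opprD addrACA subrr add0r addrAC subrr add0r; apply: H.
  by rewrite ltrBlDr addrC -ltrBlDr; near: x; apply: nbhs_left_gt; rewrite ltrBlDr ltrDl.
Unshelve. all: by end_near. Qed.

Lemma density_bounded a b f g : a < b -> mu.-integrable setT (EFin \o g) ->
  has_density a b f g ->
  exists2 M : R, 0 <= M & forall x, a < x -> x < b -> `|f x| <= M.
Proof.
move=> ab ig fg; have [la [_ [_ _ fE _]]] := density_limits ab ig fg.
exists (`|la| + \int[mu]_(z in setT) `|g z|).
  by rewrite addr_ge0// Rintegral_ge0.
move=> x ax xb; rewrite fE// (le_trans (ler_normD _ _))// lerD2l.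
have ing : mu.-integrable setT (EFin \o (fun x => `|g x|)) by exact: (integrable_abse ig).
rewrite (le_trans (le_normr_Rintegral _ _))//; first exact: integrable_setS ig.
rewrite /Rintegral fine_le//.
- by apply: integrable_fin_num => //; exact: integrable_setS ing.
- by apply: integrable_fin_num => //.
- apply: ge0_subset_integral => //; exact: measurable_int ing.
Qed.

Lemma density_continuous a b f g : mu.-integrable setT (EFin \o g) ->
  has_density a b f g -> {in `]a, b[, continuous f}.
Proof.
move=> ig fg x; rewrite in_itv/= => /andP[ax xb].
apply/cvgrPdist_lt => e e0; have [d d0 H] := Rintegral_itv_small ig e0.
near=> y.
have ay : a < y by near: y; exact: lt_nbhsr.
have yb : y < b by near: y; exact: lt_nbhsl.
have xyd : `|x - y| < d by near: y; exact: (nbhsx_ballx x d d0).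
have [xy|yx] := leP x y.
  by rewrite distrC fg// H//; move: xyd; rewrite ltr_distl => /andP[]; lra.
by rewrite fg ?(ltW yx)// H//; move: xyd; rewrite ltr_distl => /andP[]; lra.
Unshelve. all: by end_near. Qed.

Lemma ac_mul a b f g (M N : R) : 0 <= M -> 0 <= N ->
  (forall x, a < x -> x < b -> `|f x| <= M) ->
  (forall x, a < x -> x < b -> `|g x| <= N) ->
  ac a b f -> ac a b g -> ac a b (f \* g).
Proof.
move=> M0 N0 fM gN acf acg e e0.
pose K := M + N + 1; have K0 : 0 < K by rewrite /K; lra.
have e1 : 0 < e / 2 / K by rewrite !divr_gt0.
have [d1 d10 H1] := acf _ e1; have [d2 d20 H2] := acg _ e1.
exists (Num.min d1 d2); first by rewrite lt_min d10.
move=> m s t st tst; rewrite lt_min => /andP[std1 std2].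
have {}H1 := H1 m s t st tst std1; have {}H2 := H2 m s t st tst std2.
apply: (@le_lt_trans _ _ (\sum_k (K * `|f (t k) - f (s k)| + K * `|g (t k) - g (s k)|))).
  apply: ler_sum => k _; have [ask skt tkb] := st k.
  rewrite /= (_ : _ - _ = (f (t k) - f (s k)) * g (t k) + f (s k) * (g (t k) - g (s k))); last by ring.
  rewrite (le_trans (ler_normD _ _))// !normrM [X in X + _]mulrC lerD// ler_wpM2r//.
    by rewrite (le_trans (gN _ _ _)) /K//; lra.
  by rewrite (le_trans (fM _ _ _)) /K//; lra.
rewrite big_split/= -!mulr_sumr [ltRHS]splitr.
by apply: ltrD; rewrite mulrC -ltr_pdivlMr.
Qed.

(** The product is absolutely continuous because both factors are bounded, and Leibniz' rule
    computes its derivative almost everywhere. [ac_FTC] then identifies the density, which is cut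
    off outside ]a, b[ to be integrable on the line. *)
Lemma density_mul a b f g f1 g1 : a < b ->
  mu.-integrable setT (EFin \o f1) -> mu.-integrable setT (EFin \o g1) ->
  has_density a b f f1 -> has_density a b g g1 ->
  exists h : R -> R, [/\ mu.-integrable setT (EFin \o h),
    {in `]a, b[, h =1 (fun x => f1 x * g x + f x * g1 x)} &
    has_density a b (f \* g) h].
Proof.
move=> ab if1 ig1 ff1 gg1.
have [M M0 fM] := density_bounded ab if1 ff1.
have [N N0 gN] := density_bounded ab ig1 gg1.
have mI : measurable (`]a, b[ : set R) by exact: measurable_itv.
have mf : measurable_fun `]a, b[ f.
  apply: open_continuous_measurable_fun; first exact: interval_open.
  by move=> x; rewrite inE; exact: (density_continuous if1 ff1).
have mg : measurable_fun `]a, b[ g.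
  apply: open_continuous_measurable_fun; first exact: interval_open.
  by move=> x; rewrite inE; exact: (density_continuous ig1 gg1).
pose h0 x := f1 x * g x + f x * g1 x.
have bint (u v : R -> R) (K : R) : measurable_fun `]a, b[ v -> mu.-integrable setT (EFin \o u) ->
    (forall x, a < x -> x < b -> `|v x| <= K) ->
    mu.-integrable `]a, b[ (EFin \o (fun x => u x * v x)).
  move=> mv iu vK.
  have iK : mu.-integrable `]a, b[ (fun x => K%:E * (u x)%:E)%E.
    by apply: integrableZl => //; exact: (integrable_setS _ _ _ iu).
  apply: le_integrable iK => //.
    apply/measurable_EFinP; apply: measurable_funM => //.
    by apply: (@measurable_funS _ _ _ _ setT) => //; apply/measurable_EFinP; exact: measurable_int iu.
  move=> x; rewrite /= in_itv/= => /andP[ax xb]; rewrite lee_fin !normrM mulrC ler_wpM2r//.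
  by rewrite (le_trans (vK _ _ _))// ler_norm.
have ih0 : mu.-integrable `]a, b[ (EFin \o h0).
  rewrite (_ : _ \o _ = (EFin \o (fun x => f1 x * g x)%R) \+ (EFin \o (fun x => g1 x * f x)%R))%E; last first.
    by apply/funext => x; rewrite /= -EFinD /h0 (mulrC (f x)).
  by apply: integrableD => //; [exact: bint gN|exact: bint fM].
pose h : R -> R := h0 \_ `]a, b[.
have ih : mu.-integrable setT (EFin \o h).
  exact: integrable_patch.
exists h; split => //.
  by move=> x xab; rewrite /h patchE mem_set.
apply: ac_FTC => //.
  exact: (ac_mul M0 N0 fM gN (density_ac if1 ff1) (density_ac ig1 gg1)).
have D1 := density_derive if1 ff1; have D2 := density_derive ig1 gg1.
move: D1 D2; apply: filterS2; first exact: (ae_filter_ringOfSetsType mu).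
move=> x Df Dg ax xb; have [df f'] := Df ax xb; have [dg g'] := Dg ax xb.
rewrite derive1E [LHS](deriveM df dg) -!derive1E f' g' /h patchE mem_set; last first.
  by rewrite /= in_itv/= ax.
by rewrite /h0 /GRing.scale/= addrC (mulrC (g x)).
Qed.

Lemma density_integration_by_parts a b f g f1 g1 (fa fb ga gb : R) : a < b ->
  mu.-integrable setT (EFin \o f1) -> mu.-integrable setT (EFin \o g1) ->
  has_density a b f f1 -> has_density a b g g1 ->
  f x @[x --> a^'+] --> fa -> f x @[x --> b^'-] --> fb ->
  g x @[x --> a^'+] --> ga -> g x @[x --> b^'-] --> gb ->
  mu.-integrable `]a, b[ (EFin \o (fun x => f1 x * g x + f x * g1 x)) /\
  \int[mu]_(x in `]a, b[) (f1 x * g x + f x * g1 x) = fb * gb - fa * ga.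
Proof.
move=> ab if1 ig1 ff1 gg1 cfa cfb cga cgb.
have [h [ih hE fgh]] := density_mul ab if1 ig1 ff1 gg1.
have [la [lb [cla clb _ lbE]]] := density_limits ab ih fgh.
have fabE : la = fa * ga by apply: (cvg_unique _ cla) => //; apply: cvgM.
have fbbE : lb = fb * gb by apply: (cvg_unique _ clb) => //; apply: cvgM.
have mI : measurable (`]a, b[ : set R) by exact: measurable_itv.
split.
  have ihI : mu.-integrable `]a, b[ (EFin \o h) by exact: integrable_setS ih.
  apply: eq_integrable ihI => // x; rewrite inE => xab /=.
  by rewrite hE.
rewrite -fabE -fbbE lbE addrAC subrr add0r; apply: eq_Rintegral => x; rewrite inE => xab.
by rewrite hE.
Qed.

End density_limits.

(** * Smooth step functions *)

Definition smooth (R : realType) (f : R -> R) : Prop :=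
  forall k x, derivable (derive1n k f) x 1.

Section smooth.
Context (R : realType).
Implicit Types f g : R -> R.

(** Replaces formulas for iterated derivatives: it suffices to exhibit a class of differentiable
    functions stable under differentiation. *)
Lemma smooth_closed_class (S : (R -> R) -> Prop) :
  (forall f, S f -> (forall x, derivable f x 1) /\ S (derive1 f)) ->
  forall f, S f -> smooth f.
Proof.
move=> HS f Sf k; suff : S (derive1n k f) by move=> /HS[].
by elim: k => [|k IH]; rewrite ?derive1nS//; have [] := HS _ IH.
Qed.

Lemma smooth_derive1 f : smooth f -> smooth (derive1 f).
Proof. by move=> sf k x; rewrite -derive1Sn. Qed.

Lemma smooth_derivable f : smooth f -> forall x, derivable f x 1.
Proof. by move=> sf x; have := sf 0%N x; rewrite derive1n0. Qed.

Lemma smooth_primitive f : (forall x, derivable f x 1) -> smooth (derive1 f) -> smooth f.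
Proof.
move=> df sf [|k] x; first by rewrite derive1n0.
by rewrite derive1Sn.
Qed.

Lemma is_derive_derive1 f x : derivable f x 1 -> is_derive x (1 : R) f (derive1 f x).
Proof. by move=> df; rewrite derive1E; exact/derivableP. Qed.

Lemma derive1_is_derive f x d : is_derive x (1 : R) f d -> derive1 f x = d.
Proof. by move=> [_ <-]; rewrite derive1E. Qed.

Lemma smooth_lincomb f g (c : R) : smooth f -> smooth g ->
  smooth (fun x => c * f x + g x).
Proof.
move=> sf sg.
apply: (smooth_closed_class (S := fun h => exists f g, [/\ smooth f, smooth g &
  h = fun x => c * f x + g x])); last by exists f, g.
move=> _ [{sf}f [{sg}g [sf sg ->]]].
have D x : is_derive x (1 : R) (fun x => c * f x + g x) (c * derive1 f x + derive1 g x).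
  have df := is_derive_derive1 (@smooth_derivable f sf x).
  have dg := is_derive_derive1 (@smooth_derivable g sg x).
  exact: (@is_deriveD _ _ _ (c *: f) g x 1 _ _ (is_deriveZ c df) dg).
split=> [x|]; first by have [] := D x.
exists (derive1 f), (derive1 g); split; [exact: smooth_derive1|exact: smooth_derive1|].
by apply/funext => x; exact: derive1_is_derive.
Qed.

Lemma smooth_affine f (m d : R) : smooth f -> smooth (fun x => f (m * x + d)).
Proof.
move=> sf.
apply: (smooth_closed_class (S := fun h => exists c f, smooth f /\
  h = fun x => c * f (m * x + d))); last first.
  by exists 1, f; split => //; apply/funext => x; rewrite mul1r.
move=> _ [c [{sf}f [sf ->]]].
have D x : is_derive x (1 : R) (fun x => c * f (m * x + d)) ((c * m) * derive1 f (m * x + d)).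
  have df := is_derive_derive1 (@smooth_derivable f sf (m * x + d)).
  have dm : is_derive x (1 : R) (fun x => m * x + d) m.
    have := is_deriveD (is_deriveZ m (is_derive_id x (1 : R))) (is_derive_cst d x (1 : R)).
    by rewrite addr0 /GRing.scale/= mulr1.
  have := is_deriveZ c (@is_derive1_comp _ f (fun x => m * x + d) x _ _ df dm).
  by rewrite /GRing.scale/= [_ * m]mulrC mulrA.
split=> [x|]; first by have [] := D x.
exists (c * m), (derive1 f); split; first exact: smooth_derive1.
by apply/funext => x; exact: derive1_is_derive.
Qed.

End smooth.

(** * A smooth bump function on [0, 1] *)

Section bump.
Context (R : realType).
Implicit Types (p : {poly R}) (x y : R).

Let q x : R := x * (1 - x).

(* The functions P(x) q(x)^-k exp(-1/q(x)) with q(x) = x (1 - x), extended by 0,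
   form a class closed under differentiation. *)
Definition bump p (k : nat) (x : R) : R :=
  if (0 < x) && (x < 1) then p.[x] * (q x)^-1 ^+ k * expR (- (q x)^-1) else 0.

(** Factoring q^-(k+2) out of the product rule for P q^-k exp(-1/q) leaves the three terms P' q^2, -
    k P q' q and P q'. *)
Definition bump_derivative p (k : nat) : {poly R} :=
  let Q := 'X * (1 - 'X) : {poly R} in
  deriv p * Q ^+ 2 - k%:R *: (p * deriv Q * Q) + p * deriv Q.

Lemma horner_bounded p : exists2 C : R, 0 <= C & forall x, 0 < x -> x < 1 -> `|p.[x]| <= C.
Proof.
exists (\sum_(i < size p) `|p`_i|); first by apply: sumr_ge0.
move=> x x0 x1; rewrite horner_coef (le_trans (ler_norm_sum _ _ _))//.
apply: ler_sum => i _; rewrite normrM ler_piMr//.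
by rewrite ger0_norm ?exprn_ge0 ?exprn_ile1// ltW.
Qed.

(** With t = 1/q, the exponential series gives t^(k+2) <= (k+2)! exp(t), so t^k exp(-t) is at most
    (k+2)! q^2. Quadratic decay is what makes the derivative vanish at 0 and 1. *)
Lemma bump_estimate p k : exists2 C : R, 0 <= C &
  forall x, 0 < x -> x < 1 -> `|bump p k x| <= C * q x ^+ 2.
Proof.
have [C C0 pC] := horner_bounded p; exists (C * (k.+2)`!%:R); first by rewrite mulr_ge0.
move=> x x0 x1; rewrite /bump x0 x1/= normrM normrM -mulrA -mulrA ler_pM ?mulr_ge0//; first exact: pC.
have q0 : 0 < q x by rewrite mulr_gt0// subr_gt0.
have t0 : 0 < (q x)^-1 by rewrite invr_gt0.
rewrite ger0_norm ?exprn_ge0 ?(ltW t0)// ger0_norm ?expR_ge0// expRN.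
rewrite ler_pdivrMr ?expR_gt0//.
have e1 : (q x)^-1 ^+ k.+2 <= (k.+2)`!%:R * expR (q x)^-1.
  rewrite -ler_pdivrMl ?ltr0n ?fact_gt0// mulrC.
  by rewrite (le_trans _ (expR_ge1Dxn k.+1 (ltW t0)))// lerDr.
rewrite mulrAC -ler_pdivrMr ?exprn_gt0// (le_trans _ e1)//.
by rewrite -exprVn -exprD addn2.
Qed.

Lemma is_derive0_sqr (f : R -> R) x (C : R) : f x = 0 ->
  (forall y, `|f y| <= C * (y - x) ^+ 2) -> is_derive x (1 : R) f 0.
Proof.
move=> fx0 fC.
have C0 : 0 <= C by have := fC (x + 1); rewrite addrAC subrr add0r expr1n mulr1; exact: le_trans.
have cv : h^-1 *: (f (h *: 1 + x) - f x) @[h --> 0^'] --> (0 : R).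
  apply/cvgrPdist_lt => e e0; near=> h.
  have h0 : h != 0 by near: h; exact: nbhs_dnbhs_neq.
  rewrite sub0r normrN fx0 subr0 /GRing.scale/= mulr1 normrM normfV.
  rewrite mulrC ltr_pdivrMr ?normr_gt0// (le_lt_trans (fC _))//.
  rewrite addrK -real_normK ?num_real// expr2 mulrA ltr_pM2r ?normr_gt0//.
  have hC : `|h| < e / (C + 1).
    by near: h; apply: dnbhs0_lt; rewrite divr_gt0// ltr_wpDl.
  apply: (@le_lt_trans _ _ ((C + 1) * `|h|)); first by rewrite ler_wpM2r// lerDl.
  by rewrite mulrC -ltr_pdivlMr// ltr_wpDl.
split; first by apply/cvg_ex; exists 0.
exact: cvg_lim cv.
Unshelve. all: by end_near. Qed.

Lemma bump_out p k x : ~~ ((0 < x) && (x < 1)) -> bump p k x = 0.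
Proof. by rewrite /bump => /negbTE ->. Qed.

Let bump_derivative_identity k (z : R) : z != 0 -> forall Q' P P' E : R,
  P * z^-1 ^+ k * (E * - (- z^-1 ^+ 2 * Q')) +
  E * (P * (k%:R * z^-1 ^+ k.-1 * (- z^-1 ^+ 2 * Q')) + z^-1 ^+ k * P') =
  (P' * (z * z) - k%:R * (P * Q' * z) + P * Q') * z^-1 ^+ k.+2 * E.
Proof.
move=> z0 Q' P P' E; have zz : z * z^-1 = 1 by rewrite divff.
(* The exponent [k.-1] left by the product rule forces the case distinction on k. *)
rewrite !exprS; case: k => [|m] /=; rewrite ?expr0 ?exprS.
  have -> : (P' * (z * z) - 0 * (P * Q' * z) + P * Q') * (z^-1 * (z^-1 * 1)) * E
    = (P' * (z * z^-1) * (z * z^-1) + P * Q' * z^-1 ^+ 2) * E by ring.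
  by rewrite zz; ring.
move: (z^-1 ^+ m) => w.
have -> : (P' * (z * z) - m.+1%:R * (P * Q' * z) + P * Q') * (z^-1 * (z^-1 * (z^-1 * w))) * E
  = (P' * (z * z^-1) * (z * z^-1) * z^-1 - m.+1%:R * P * Q' * (z * z^-1) * z^-1 ^+ 2 + P * Q' * z^-1 ^+ 3) * w * E.
  by ring.
by rewrite zz; ring.
Qed.

(** Off [0, 1] the function is locally 0, and on ]0, 1[ the product rule applies. At 0 and 1 the
    bound by q^2 decides, as q(x) is at most the distance from x to either point. *)
Lemma is_derive_bump p k x :
  is_derive x (1 : R) (bump p k) (bump (bump_derivative p k) k.+2 x).
Proof.
have bound (y : R) : (y = 0 \/ y = 1) -> exists C, forall x, `|bump p k x| <= C * (x - y) ^+ 2.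
  move=> y01; have [C C0 bC] := bump_estimate p k; exists C => {}x.
  have [/andP[x0 x1]|/bump_out ->] := boolP ((0 < x) && (x < 1)); last first.
    by rewrite normr0 mulr_ge0// sqr_ge0.
  rewrite (le_trans (bC _ x0 x1))// ler_wpM2l//.
  have q0 : 0 <= q x by rewrite mulr_ge0 ?subr_ge0// ltW.
  have qx : q x <= x by rewrite /q; nra.
  have q1 : q x <= 1 - x by rewrite /q; nra.
  by case: y01 => ->; nra.
have [xI|xO] := boolP ((0 < x) && (x < 1)); last first.
  rewrite bump_out//.
  have [x0|x0] := ltP x 0.
    apply: (@near_eq_is_derive _ _ _ (cst 0 : R -> R)).
    near=> y; rewrite /= bump_out// negb_and -leNgt; apply/orP; left.
    by apply: ltW; near: y; exact: lt_nbhsl.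
  have [x1|x1] := ltP 1 x.
    apply: (@near_eq_is_derive _ _ _ (cst 0 : R -> R)).
    near=> y; rewrite /= bump_out// negb_and -!leNgt; apply/orP; right.
    by apply: ltW; near: y; exact: lt_nbhsr.
  have x01 : x = 0 \/ x = 1.
    by move: xO; rewrite negb_and -!leNgt => /orP[?|?]; [left|right]; apply/le_anti/andP.
  have [C bC] := bound _ x01.
  by apply: is_derive0_sqr bC; exact: bump_out.
have /andP[x0 x1] := xI.
have q0 : q x != 0 by rewrite gt_eqF// mulr_gt0// subr_gt0.
pose F := fun y => p.[y] * (q y)^-1 ^+ k * expR (- (q y)^-1).
have : is_derive x (1 : R) F (bump (bump_derivative p k) k.+2 x).
  pose Q := 'X * (1 - 'X) : {poly R}.
  have QE y : Q.[y] = q y by rewrite /Q hornerM hornerD hornerN hornerX hornerC.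
  have Qx0 : Q.[x] != 0 by rewrite QE.
  have dqV := @is_deriveV _ (horner Q) x _ 1 Qx0 (is_derive_poly Q x).
  have dqk := is_deriveX k dqV.
  have dE := @is_derive1_comp _ expR _ x _ _ (is_derive_expR _) (is_deriveN dqV).
  have := is_deriveM (is_deriveM (is_derive_poly p x) dqk) dE.
  set f1 := (X in is_derive _ _ X); set d1 := (X in is_derive _ _ f1 X).
  have powE (g : R -> R) m y : (g ^+ m) y = g y ^+ m by rewrite exprfctE.
  have -> : f1 = F.
    by apply/funext => y; rewrite /f1 /F -!QE -(powE (fun y => Q.[y]^-1)).
  have -> // : d1 = bump (bump_derivative p k) k.+2 x.
  rewrite /d1 /bump xI /bump_derivative -/Q -QE.
  rewrite -[X in X *: _ + _]/(p.[x] * ((fun y => Q.[y]^-1) ^+ k) x) powE.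
  rewrite /GRing.scale /= opprfctE.
  clearbody Q.
  rewrite !(hornerD, hornerN, hornerM, hornerZ, horner_exp) -exprVn.
  move: Q.[x] Qx0 (deriv Q).[x] p.[x] (deriv p).[x] (expR _).
  exact: bump_derivative_identity.
apply: near_eq_is_derive; near=> y.
rewrite /F /bump ifT//; apply/andP; split; near: y; [exact: lt_nbhsr|exact: lt_nbhsl].
Unshelve. all: by end_near. Qed.

Lemma smooth_bump p k : smooth (bump p k).
Proof.
apply: (smooth_closed_class (S := fun f => exists p k, f = bump p k)); last by exists p, k.
move=> _ [{}p [{}k ->]]; split=> [x|]; first by have [] := is_derive_bump p k x.
exists (bump_derivative p k), k.+2; apply/funext => x.
exact: derive1_is_derive (is_derive_bump p k x).
Qed.

End bump.

Section smooth_step.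
Context (R : realType).
Local Notation mu := (@lebesgue_measure R).

Lemma smooth_continuous (f : R -> R) : smooth f -> continuous f.
Proof.
move=> sf x; apply: differentiable_continuous; apply/derivable1_diffP.
exact: smooth_derivable.
Qed.

Let b : R -> R := bump 1 0.

Let b_ge0 x : 0 <= b x.
Proof.
by rewrite /b /bump; case: ifP => // _; rewrite hornerC expr0 !mul1r expR_ge0.
Qed.

Let b_gt0 x : 0 < x -> x < 1 -> 0 < b x.
Proof. by rewrite /b /bump => -> ->; rewrite hornerC expr0 !mul1r expR_gt0. Qed.

Let b_out x : ~~ ((0 < x) && (x < 1)) -> b x = 0.
Proof. exact: bump_out. Qed.

Let ib : mu.-integrable setT (EFin \o b).
Proof.
have -> : b = b \_ `[0, 1].
  apply/funext => x; rewrite patchE; case: ifPn => //; rewrite notin_setE/= in_itv/=.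
  by move=> /negP xI; apply: b_out; apply: contra xI => /andP[/ltW -> /ltW ->].
apply: integrable_patch; first exact: measurable_itv.
apply: continuous_compact_integrable; first exact: segment_compact.
have cb : continuous b by move=> x; exact: (smooth_continuous (@smooth_bump _ 1 0)).
exact: (continuous_subspaceT cb).
Qed.

Let B (x : R) : R := \int[mu]_(t in [set` Interval -oo%O (BRight x)]) b t.

Let is_derive_B x : is_derive x (1 : R) B (b x).
Proof.
have x1 : x < x + 1 by rewrite ltrDl.
have ii u v : mu.-integrable [set` Interval u v] (EFin \o b).
  by apply: integrable_setS ib => //; exact: measurable_itv.
have cb : {for x, continuous b} by exact: (smooth_continuous (@smooth_bump _ 1 0)).
have [dB B'] := @continuous_FTC1 _ b -oo%O x _ x1 (ii _ _) (ltNyr _) cb.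
by rewrite -B'; apply: is_derive_derive1.
Qed.

Let B_mvt u v : u < v -> exists2 c : R, c \in `]u, v[ & B v - B u = b c * (v - u).
Proof.
move=> uv; apply: (MVT uv) => //.
by apply: derivable_within_continuous => x _; have [] := is_derive_B x.
Qed.

Let B0 x : x <= 0 -> B x = 0.
Proof.
move=> x0; rewrite /B; transitivity (\int[mu]_(t in [set` Interval -oo%O (BRight x)]) (0 : R)).
  apply: eq_Rintegral => y; rewrite inE/= in_itv/= => yx; apply: b_out.
  by rewrite negb_and -!leNgt (le_trans yx).
by rewrite /Rintegral integral0.
Qed.

Let B_le u v : u <= v -> B u <= B v.
Proof.
rewrite le_eqVlt => /predU1P[->//|uv]; have [c _ E] := B_mvt uv.
by rewrite -subr_ge0 E mulr_ge0 ?b_ge0 ?subr_ge0 ?(ltW uv).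
Qed.

Let B1 x : 1 <= x -> B x = B 1.
Proof.
rewrite le_eqVlt => /predU1P[->//|x1]; have [c + E] := B_mvt x1.
rewrite in_itv/= => /andP[c1 _]; apply/eqP; rewrite -subr_eq0 E b_out ?mul0r//.
by rewrite negb_and -!leNgt (ltW c1) orbT.
Qed.

Let B1_gt0 : 0 < B 1.
Proof.
have [c + E] := B_mvt ltr01; rewrite in_itv/= => /andP[c0 c1].
by move: E; rewrite (B0 (lexx _)) !subr0 mulr1 => ->; exact: b_gt0.
Qed.

(** The primitive of a nonnegative bump divided by its total mass [B 1], which is positive by the
    mean value theorem because the bump is positive on ]0, 1[. *)
Lemma smooth_step : exists st : R -> R,
  [/\ smooth st, forall x, x <= 0 -> st x = 0, forall x, 1 <= x -> st x = 1 &
     forall x, 0 <= st x <= 1].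
Proof.
(* The summand 0 gives the function the shape treated by [smooth_lincomb]. *)
exists (fun x => (B 1)^-1 * B x + 0); split.
- apply: smooth_lincomb.
    apply: smooth_primitive => [x|]; first by have [] := is_derive_B x.
    rewrite (_ : derive1 B = b); first exact: smooth_bump.
    by apply/funext => x; exact: derive1_is_derive.
  have cst_smooth : smooth (cst 0 : R -> R).
    apply: (smooth_closed_class (S := fun f => f = cst 0)) => // _ ->; split=> [x|].
      exact: derivable_cst.
    by apply/funext => x; rewrite derive1_cst.
  exact: cst_smooth.
- by move=> x x0; rewrite (B0 x0) mulr0 addr0.
- by move=> x x1; rewrite (B1 x1) addr0 mulVf// gt_eqF.
- move=> x; rewrite addr0 mulrC ler_pdivrMr// mul1r divr_ge0 ?(ltW B1_gt0)//=; last first.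
    by have [x0|/ltW/B_le] := leP x 0; rewrite ?(B0 x0)// (B0 (lexx _)).
  have [x1|x1] := leP 1 x; first by rewrite (B1 x1).
  by rewrite B_le// ltW.
Qed.

End smooth_step.

(** * Density of test functions *)

Section approximation.
Import HBNNSimple.
Context (R : realType) (n : nat) (alpha beta : 'I_n -> R).
Hypothesis alpha_lt_beta : forall i, alpha i < beta i.
Hypothesis beta_lt_alpha : forall i j : 'I_n, (i < j)%N -> beta i < alpha j.
Local Notation mu := (@lebesgue_measure R).
Local Notation D := (Omega alpha beta).
Implicit Types f g : R -> R.

Lemma Omega_itv_disjoint i j x :
  alpha i < x -> x < beta i -> alpha j < x -> x < beta j -> i = j.
Proof.
move=> ai bi aj bj; apply/val_inj; case: (ltngtP i j) => // /beta_lt_alpha.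
  by rewrite ltNge (ltW (lt_trans aj bi)).
by rewrite ltNge (ltW (lt_trans ai bj)).
Qed.

Let mD : measurable D := measurable_Omega alpha beta.

Lemma Omega_itv i : `]alpha i, beta i[ `<=` D.
Proof. by move=> x xi; exists i. Qed.

Lemma lebesgue_measure_Omega : (mu D < +oo)%E.
Proof.
pose a := - \sum_i `|alpha i| - 1; pose b := \sum_i `|beta i| + 1.
have sub : D `<=` `[a, b].
  move=> x [i _]/=; rewrite !in_itv/= => /andP[ax xb]; apply/andP; split; rewrite /a /b.
    rewrite (bigD1 i)//=; have : 0 <= \sum_(j < n | j != i) `|alpha j| by exact: sumr_ge0.
    by move: (\sum_(j < n | j != i) _) => S; have := ler_norm (- alpha i); rewrite normrN; lra.
  rewrite (bigD1 i)//=; have : 0 <= \sum_(j < n | j != i) `|beta j| by exact: sumr_ge0.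
  by move: (\sum_(j < n | j != i) _) => S; have := ler_norm (beta i); lra.
apply: (@le_lt_trans _ _ (mu `[a, b])); first by apply: le_measure; rewrite ?inE.
by rewrite lebesgue_measure_itv; case: ifP => _; rewrite ?ltry//= -EFinB ltry.
Qed.

Definition sqint f : \bar R := (\int[mu]_(x in D) (f x ^+ 2)%:E)%E.

Let msq f : measurable_fun D f -> measurable_fun D (fun x => (f x ^+ 2)%:E).
Proof. by move=> mf; apply/measurable_EFinP; exact: measurable_funX. Qed.

Lemma le_sqint f g : measurable_fun D f -> measurable_fun D g ->
  (forall x, D x -> `|f x| <= `|g x|) -> (sqint f <= sqint g)%E.
Proof.
move=> mf mg fg; apply: ge0_le_integral => //; [|exact: msq|exact: msq|].
- by move=> x _; rewrite lee_fin sqr_ge0.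
- by move=> x Dx; rewrite lee_fin -(real_normK (num_real (f x))) -(real_normK (num_real (g x)))
    lerXn2r ?nnegrE// fg.
Qed.

Lemma eq_sqint f g : (forall x, D x -> f x = g x) -> sqint f = sqint g.
Proof. by move=> fg; apply: eq_integral => x; rewrite inE => /fg ->. Qed.

Lemma sqintD f g : measurable_fun D f -> measurable_fun D g ->
  (sqint (f \+ g)%R <= 2%:E * sqint f + 2%:E * sqint g)%E.
Proof.
move=> mf mg.
have f0 x : D x -> (0 <= (f x ^+ 2)%:E)%E by move=> _; rewrite lee_fin sqr_ge0.
have g0 x : D x -> (0 <= (g x ^+ 2)%:E)%E by move=> _; rewrite lee_fin sqr_ge0.
rewrite /sqint -(ge0_integralZl_EFin mu mD f0)//; last exact: msq.
rewrite -(ge0_integralZl_EFin mu mD g0)//; last exact: msq.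
rewrite -ge0_integralD//; last 4 first.
- by move=> x Dx; rewrite mule_ge0// f0.
- by apply: measurable_funeM; exact: msq.
- by move=> x Dx; rewrite mule_ge0// g0.
- by apply: measurable_funeM; exact: msq.
apply: ge0_le_integral => //.
- by move=> x _; rewrite lee_fin sqr_ge0.
- by apply: msq; exact: measurable_funD.
- by apply: emeasurable_funD; apply: measurable_funeM; exact: msq.
- by move=> x _; rewrite -!EFinM -EFinD lee_fin /=; have := sqr_ge0 (f x - g x); nra.
Qed.

Lemma sqintZ (c : R) f : measurable_fun D f ->
  sqint (fun x => c * f x) = ((c ^+ 2)%:E * sqint f)%E.
Proof.
move=> mf; rewrite /sqint -ge0_integralZl_EFin// ?sqr_ge0//; last exact: msq.
  by apply: eq_integral => x _; rewrite exprMn EFinM.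
by move=> x _; rewrite lee_fin sqr_ge0.
Qed.

(** The uniform margin [eta] encodes compact support in Omega and passes to linear combinations by
    taking a minimum. *)
Definition test_fun f := smooth f /\ exists2 eta : R, 0 < eta &
  forall x, (forall i, ~~ (alpha i + eta <= x <= beta i - eta)) -> f x = 0.

Lemma test_fun_lincomb (c : R) f g : test_fun f -> test_fun g ->
  test_fun (fun x => c * f x + g x).
Proof.
move=> [sf [e e0 fe]] [sg [d d0 gd]]; split; first exact: smooth_lincomb.
exists (Num.min e d); first by rewrite lt_min e0.
move=> x out; rewrite fe ?gd ?mulr0 ?addr0// => i; apply: contra (out i) => /andP[ax xb].
  have : Num.min e d <= d by rewrite ge_min lexx orbT.
  by move=> ?; apply/andP; split; lra.
have : Num.min e d <= e by rewrite ge_min lexx.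
by move=> ?; apply/andP; split; lra.
Qed.

Lemma test_fun_measurable f : test_fun f -> measurable_fun D f.
Proof.
move=> [sf _]; apply: (@measurable_funS _ _ _ _ setT) => //.
exact: continuous_measurable_fun (smooth_continuous sf).
Qed.

(** The L^2 closure of the real test functions, as a predicate that can be extended from intervals
    to Borel sets, simple functions and finally all square-integrable functions. *)
Definition test_approximable f := measurable_fun D f /\
  forall e : R, 0 < e -> exists2 phi, test_fun phi & (sqint (f \- phi)%R < e%:E)%E.

Lemma test_approximable_eq f g : (forall x, D x -> f x = g x) ->
  test_approximable f -> test_approximable g.
Proof.
move=> fg [mf af]; split.
  by apply: eq_measurable_fun mf => x; rewrite inE => /fg.
move=> e /af[phi tphi fphi]; exists phi => //.
by rewrite -(@eq_sqint (f \- phi))// => x Dx /=; rewrite fg.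
Qed.

Lemma test_approximable_limit f : measurable_fun D f ->
  (forall e : R, 0 < e -> exists2 g, test_approximable g & (sqint (f \- g)%R < e%:E)%E) ->
  test_approximable f.
Proof.
move=> mf af; split=> // e e0; have e4 : 0 < e / 4 by rewrite divr_gt0.
have [g [mg /(_ _ e4)[phi tphi gphi]] fg] := af _ e4.
exists phi => //.
rewrite (@eq_sqint _ ((f \- g) \+ (g \- phi))); last by move=> x _ /=; lra.
have mphi := test_fun_measurable tphi.
apply: le_lt_trans (sqintD _ _) _; [exact: measurable_funB|exact: measurable_funB|].
apply: (@lt_le_trans _ _ (2%:E * (e / 4)%:E + 2%:E * (e / 4)%:E)%E).
  by apply: lteD; rewrite lte_pmul2l.
by rewrite -!EFinM -EFinD lee_fin; lra.
Qed.

Lemma test_approximable_lincomb (c : R) f g :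
  test_approximable f -> test_approximable g ->
  test_approximable (fun x => c * f x + g x).
Proof.
move=> [mf af] [mg ag].
have mcf : measurable_fun D (fun x => c * f x) by exact: measurable_funM.
split; first exact: measurable_funD.
(* [sqintD] costs a factor 2 on each term, and the total 4 e / 5 leaves room for weak inequalities.
   The 1 in the denominator of [d] covers c = 0. *)
move=> e e0; pose d := e / 5 / (c ^+ 2 + 1).
have c0 : 0 < c ^+ 2 + 1 by rewrite ltr_wpDl// sqr_ge0.
have d0 : 0 < d by rewrite !divr_gt0.
have [phi tphi fphi] := af _ d0.
have e5 : 0 < e / 5 by rewrite divr_gt0.
have [psi tpsi gpsi] := ag _ e5.
exists (fun x => c * phi x + psi x); first exact: test_fun_lincomb.
have mphi := test_fun_measurable tphi; have mpsi := test_fun_measurable tpsi.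
rewrite (@eq_sqint _ ((fun x => c * (f \- phi) x) \+ (g \- psi))); last first.
  by move=> x _ /=; ring.
apply: le_lt_trans (sqintD _ _) _.
- by apply: measurable_funM => //; exact: measurable_funB.
- exact: measurable_funB.
rewrite sqintZ; last exact: measurable_funB.
apply: (@le_lt_trans _ _ (2%:E * ((c ^+ 2 + 1)%:E * d%:E) + 2%:E * (e / 5)%:E)%E).
  apply: leeD; last by rewrite lee_pmul2l// ltW.
  rewrite lee_pmul2l// lee_pmul ?lee_fin ?sqr_ge0 ?lerDl//; last exact: ltW.
  by apply: integral_ge0 => x _; rewrite lee_fin sqr_ge0.
by rewrite -!EFinM -EFinD lte_fin /d (mulrC _ (_ / _)) divfK ?gt_eqF//; lra.
Qed.

Lemma test_approximable0 : test_approximable (fun=> 0).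
Proof.
split; first exact: measurable_cst.
move=> e e0; exists (fun=> 0).
  split.
    apply: (smooth_closed_class (S := fun f => f = cst 0)) => // _ ->; split=> [x|].
      exact: derivable_cst.
    by apply/funext => x; rewrite derive1_cst.
  by exists 1.
rewrite /sqint integral0_eq ?lte_fin// => x _.
by rewrite /= subrr expr0n.
Qed.

Lemma test_approximable_sum (I : Type) (r : seq I) (c : I -> R) (f : I -> R -> R) :
  (forall i, test_approximable (f i)) ->
  test_approximable (fun x => \sum_(i <- r) c i * f i x).
Proof.
move=> af; elim: r => [|i r IH].
  by apply: test_approximable_eq test_approximable0 => x _; rewrite big_nil.
apply: (test_approximable_eq (f := fun x => c i * f i x + \sum_(i <- r) c i * f i x)).
  by move=> x _; rewrite big_cons.
exact: test_approximable_lincomb.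
Qed.

(** A step rising on [c + eta, c + 2 eta] minus a step rising on [d - 2 eta, d - eta] differs from
    the indicator by at most 1, and only on two intervals of total length 4 eta. *)
Lemma test_approximable_itv i (c d : R) : alpha i <= c -> d <= beta i ->
  test_approximable (\1_`]c, d[%classic : R -> R).
Proof.
move=> ac db; have mI : measurable (`]c, d[%classic : set R) by exact: measurable_itv.
have mf : measurable_fun D (\1_`]c, d[%classic : R -> R) by exact: measurable_indic.
have [dc|cd] := leP d c.
  apply: test_approximable_eq test_approximable0 => x _.
  by rewrite set_itv_ge ?indic0// bnd_simp -leNgt.
split=> // e e0; have [st [sst st0 st1 st01]] := smooth_step R.
(* The bound (d - c) / 4 keeps the two ramps apart; e / 8 makes the error 4 eta smaller than e. *)
pose eta : R := Num.min ((d - c) / 4) (e / 8).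
have eta0 : 0 < eta by rewrite lt_min !divr_gt0// subr_gt0.
have eta_dc : 4 * eta <= d - c.
  have : eta <= (d - c) / 4 by rewrite ge_min lexx.
  by lra.
have eta_e : 8 * eta <= e.
  have : eta <= e / 8 by rewrite ge_min lexx orbT.
  by lra.
have eta2 : 0 < 2 * eta by lra.
have eta_sum : c + 2 * eta - c + (d - (d - 2 * eta)) < e by lra.
pose u (x : R) : R := eta^-1 * x + (- (eta^-1 * c) - 1); pose v (x : R) : R := eta^-1 * x + (- (eta^-1 * d) + 2).
have uE x : u x = (x - c) / eta - 1 by rewrite /u; ring.
have vE x : v x = (x - d) / eta + 2 by rewrite /v; ring.
pose phi (x : R) : R := (-1) * st (v x) + st (u x).
have st_u0 x : x <= c + eta -> st (u x) = 0.
  by move=> xc; apply: st0; rewrite uE subr_le0 ler_pdivrMr//; lra.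
have st_u1 x : c + 2 * eta <= x -> st (u x) = 1.
  by move=> xc; apply: st1; rewrite uE lerBrDr ler_pdivlMr//; lra.
have st_v0 x : x <= d - 2 * eta -> st (v x) = 0.
  by move=> xd; apply: st0; rewrite vE -lerBrDr sub0r ler_pdivrMr//; lra.
have st_v1 x : d - eta <= x -> st (v x) = 1.
  by move=> xd; apply: st1; rewrite vE -lerBlDr ler_pdivlMr//; lra.
have tphi : test_fun phi.
  split; first by apply: smooth_lincomb; exact: smooth_affine.
  exists eta => // x /(_ i).
  rewrite negb_and -!ltNge /phi => /orP[xc|dx].
    by rewrite st_u0 ?st_v0//; lra.
  by rewrite st_v1 ?st_u1//; lra.
exists phi => //.
have mJ a b : measurable (`[a, b] : set R) by exact: measurable_itv.
pose h (x : R) : R := \1_`[c, c + 2 * eta]%classic x + \1_`[d - 2 * eta, d]%classic x.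
have hE : (sqint ((\1_`]c, d[%classic : R -> R) \- phi)%R <= \int[mu]_(x in D) (h x)%:E)%E.
  apply: ge0_le_integral => //.
  - by move=> x _; rewrite lee_fin sqr_ge0.
  - by apply: msq; apply: measurable_funB => //; exact: test_fun_measurable.
  - by apply/measurable_EFinP; apply: measurable_funD; exact: measurable_indic.
  move=> x _; rewrite lee_fin /= /h !indicE !mem_setE !in_itv/= /phi.
  have /andP[su0 su1] := st01 (u x); have /andP[sv0 sv1] := st01 (v x).
  have [xc|cx] := leP x c.
    rewrite (st_u0 x) ?(st_v0 x); try lra.
    by rewrite mulr0 addr0 subrr expr0n addr_ge0.
  have [dx|xd] := leP d x.
    rewrite (st_u1 x) ?(st_v1 x); try lra.
    by rewrite mulr1 addNr subrr expr0n addr_ge0.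
  have [xc2|cx2] := leP x (c + 2 * eta).
    rewrite (st_v0 x) ?(ltW cx); try lra.
    rewrite mulr0 add0r /= (le_trans (_ : _ <= 1))//; first nra.
    by rewrite lerDl.
  rewrite (st_u1 x) ?(ltW cx2)//.
  have [xd2|dx2] := leP (d - 2 * eta) x.
    by rewrite (ltW xd) andbF /= add0r; nra.
  by rewrite (st_v0 x) ?(ltW dx2)// mulr0 add0r andbF subrr expr0n addr_ge0.
apply: (le_lt_trans hE); rewrite /h.
under eq_integral do rewrite EFinD.
rewrite ge0_integralD//; last 2 first.
- by apply/measurable_EFinP; exact: measurable_indic.
- by apply/measurable_EFinP; exact: measurable_indic.
rewrite !integral_indic//.
apply: (@le_lt_trans _ _ (mu `[c, (c + 2 * eta)%R]%classic + mu `[(d - 2 * eta)%R, d]%classic)%E).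
  by apply: leeD; apply: le_measure; rewrite ?inE//; exact: measurableI.
by rewrite !lebesgue_measure_itv/= !lte_fin ltrDl gtrDl oppr_lt0 eta2 -!EFinB -EFinD lte_fin.
Qed.

(** On Omega a ray is a finite disjoint union of intervals. Rays are stable under intersection and
    generate the Borel sets, as the proof of [test_approximable_indic] requires. *)
Lemma test_approximable_gt (x0 : R) : test_approximable (\1_`]x0, +oo[%classic : R -> R).
Proof.
apply: (test_approximable_eq (f := fun x => \sum_(i < n) 1 * \1_`]Num.max x0 (alpha i), beta i[%classic x)).
  move=> x [i _ /=]; rewrite in_itv/= => /andP[ax xb].
  rewrite (bigD1 i)//= big1 => [|j ji].
    by rewrite mul1r addr0 !indicE !mem_setE !in_itv/= gt_max ax xb !andbT.
  rewrite mul1r indicE mem_setE in_itv/= gt_max.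
  apply/eqP; rewrite pnatr_eq0 eqb0; apply/negP => /andP[/andP[_ jx] xj].
  by move: ji; rewrite (Omega_itv_disjoint ax xb jx xj) eqxx.
apply: test_approximable_sum => i; apply: test_approximable_itv => //.
by rewrite le_max lexx orbT.
Qed.

(** Dominated convergence for (f - g_k)^2, which is dominated by 4 h^2 because |f| <= h in the
    limit. *)
Lemma test_approximable_dominated (f h : R -> R) (g : nat -> R -> R) :
  measurable_fun D f -> measurable_fun D h -> (sqint h < +oo)%E ->
  (forall k, test_approximable (g k)) ->
  (forall k x, D x -> `|g k x| <= h x) ->
  (forall x, D x -> g k x @[k --> \oo] --> f x) ->
  test_approximable f.
Proof.
move=> mf mh hoo ag gh gf; apply: test_approximable_limit => // e e0.
have mg k : measurable_fun D (g k) by have [] := ag k.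
have fh x : D x -> `|f x| <= h x.
  move=> Dx; have cg : `|g k x| @[k --> \oo] --> `|f x| by apply: cvg_norm; exact: gf.
  rewrite -(cvg_lim _ cg)//; apply: limr_le; first by apply/cvg_ex; eexists; exact: cg.
  by apply: nearW => k; exact: gh.
have h0 x : D x -> 0 <= h x by move=> /fh; apply: le_trans.
have cv : (\int[mu]_(x in D) ((f x - g k x) ^+ 2)%:E)%E @[k --> \oo] --> (\int[mu]_(x in D) (cst 0 x))%E.
  apply: (@dominated_cvg _ _ _ mu D mD (fun k x => ((f x - g k x) ^+ 2)%:E) (cst 0%E) (fun x => 4%:E * (h x ^+ 2)%:E)%E).
  - by move=> k; apply: msq; exact: measurable_funB.
  - move=> x Dx; apply/cvg_EFin; first by near=> k.
    rewrite /comp /= (_ : 0 = (f x - f x) * (f x - f x)); last by rewrite subrr mulr0.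
    by under eq_fun do rewrite expr2; apply: cvgM; apply: cvgB; [exact: cvg_cst|exact: gf|exact: cvg_cst|exact: gf].
  - by move=> x _.
  - apply: integrableZl => //; apply/integrableP; split; first exact: msq.
    by under eq_integral do rewrite /= ger0_norm ?sqr_ge0//.
  - move=> k x Dx; rewrite /= ger0_norm ?sqr_ge0// -EFinM lee_fin.
    have := gh k x Dx; have := fh x Dx; rewrite !ler_norml => /andP[? ?] /andP[? ?].
    by have := h0 x Dx; nra.
rewrite integral0 in cv.
have /fine_cvgP[fin /cvgrPdist_lt/(_ _ e0) cv'] := cv.
have [k [/= fk ck]] : exists k, (\int[mu]_(x in D) ((f x - g k x) ^+ 2)%:E)%E \is a fin_num /\
    `|0 - fine (\int[mu]_(x in D) ((f x - g k x) ^+ 2)%:E)%E| < e.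
  by have [k _ H] := filterI fin cv'; exists k; apply: (H k) => /=.
exists (g k) => //; rewrite /sqint -[X in (X < _)%E](fineK fk) lte_fin.
by move: ck; rewrite sub0r normrN; exact: le_lt_trans (ler_norm _).
Unshelve. all: by end_near. Qed.

Lemma test_approximable1 : test_approximable (fun=> 1).
Proof.
apply: (test_approximable_dominated (h := cst 1)
  (g := fun k => \1_`](- k%:R), +oo[%classic)) => //.
- rewrite /sqint; under eq_integral do rewrite expr1n.
  by rewrite integral_cst// mul1e lebesgue_measure_Omega.
- by move=> k; exact: test_approximable_gt.
- by move=> k x _; rewrite indicE; case: (_ \in _); rewrite ?normr1 ?normr0.
- move=> x _; apply/cvgrPdist_lt => e e0; near=> k.
  rewrite indicE mem_setE in_itv/= andbT (_ : - k%:R < x); first by rewrite subrr normr0.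
  rewrite ltrNl; apply: (le_lt_trans (ler_norm _)); rewrite normrN.
  by near: k; exact: nbhs_infty_gtr.
Unshelve. all: by end_near. Qed.

(** Dynkin's pi-lambda theorem on the rays: complements use the constant 1, and countable disjoint
    unions use dominated convergence with bound 1, which is square-integrable because Omega has
    finite measure. *)
Lemma test_approximable_indic (A : set R) : measurable A ->
  test_approximable (\1_A : R -> R).
Proof.
have one_c : test_approximable (cst 1) := test_approximable1.
have key : forall S, <<s (RGenOInfty.G (R:=R)) >> S -> test_approximable (\1_S : R -> R).
  apply: (@dynkin_induction _ (measurableTypeR R) (RGenOInfty.G (R:=R))
      (fun S => test_approximable (\1_S : R -> R))).
  - exact: RGenOInfty.measurableE.
  - move=> _ _ [x ->] [y ->]; exists (Num.max x y); apply/seteqP.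
    split=> z /=; rewrite !in_itv/= !andbT gt_max; first by move=> [-> ->].
    by move=> /andP[].
  - by rewrite indicT.
  - by move=> _ [x ->]; exact: test_approximable_gt.
  - move=> S mS aS; apply: (test_approximable_eq (f := fun x => (-1) * \1_S x + 1)).
      by move=> x _; rewrite !indicE in_setC; case: (x \in S) => /=; lra.
    exact: test_approximable_lincomb.
  - move=> F mF tF aF.
    have FE x : (fun k => (\sum_(i < k) 1 * (\1_(F i) x : R))%:E) =
        (fun k => \sum_(0 <= i < k) (\1_(F i) x)%:E)%E.
      by apply/funext => k; rewrite -sumEFin big_mkord; apply: eq_bigr => i _; rewrite mul1r.
    have F0 x i : (0 <= (\1_(F i) x : R)%:E)%E by rewrite lee_fin.
    have Fcvg x : (\sum_(i < k) 1 * (\1_(F i) x : R))%:E @[k --> \oo] --> (\1_(\bigcup_k F k) x : R)%:E.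
      rewrite FE (indic_bigcup x tF); exact: is_cvg_nneseries.
    have Fle k x : \sum_(i < k) 1 * (\1_(F i) x : R) <= 1.
      rewrite -lee_fin (le_trans (_ : _ <= (\1_(\bigcup_k F k) x : R)%:E)%E)//; last first.
        by rewrite lee_fin indicE; case: (_ \in _).
      rewrite (indic_bigcup x tF) -[leLHS]/((fun k => (\sum_(i < k) 1 * (\1_(F i) x : R))%:E) k) FE.
      exact: nneseries_lim_ge.
    apply: (test_approximable_dominated (h := cst 1)
      (g := fun k x => \sum_(i < k) 1 * \1_(F i) x)) => //.
    + by apply: measurable_indic; apply: bigcup_measurable => k _; exact: mF.
    + rewrite /sqint; under eq_integral do rewrite expr1n.
      by rewrite integral_cst// mul1e lebesgue_measure_Omega.
    + by move=> k; apply: test_approximable_sum => i.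
    + by move=> k x _; rewrite ger0_norm//; apply: sumr_ge0 => i _; rewrite mul1r.
    + by move=> x _; have /fine_cvgP[] := Fcvg x.
move=> mA; apply: key.
by rewrite -[X in X A]/((RGenOInfty.G (R:=R)).-sigma.-measurable) -RGenOInfty.measurableE.
Qed.

Lemma test_approximable_nnsfun (g : {nnsfun R >-> R}) : test_approximable g.
Proof.
have gE x : \sum_(y <- fset_set (range g)) y * \1_(g @^-1` [set y]) x = g x.
  by rewrite [RHS]fimfunE fsbig_finite.
have ag : test_approximable (fun x => \sum_(y <- fset_set (range g)) y * \1_(g @^-1` [set y]) x).
  by apply: test_approximable_sum => y; apply: test_approximable_indic.
by apply: test_approximable_eq ag => x _; exact: gE.
Qed.

Lemma test_approximable_ge0 f : measurable_fun D f -> (forall x, D x -> 0 <= f x) ->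
  (sqint f < +oo)%E -> test_approximable f.
Proof.
move=> mf f0 foo.
have mfE : measurable_fun D (EFin \o f) by exact/measurable_EFinP.
have f0E x : D x -> (0 <= (EFin \o f) x)%E by move=> /f0; rewrite /= lee_fin.
apply: (test_approximable_dominated (h := f) (g := fun k => nnsfun_approx mD mfE k)) => //.
- by move=> k; exact: test_approximable_nnsfun.
- move=> k x Dx; rewrite ger0_norm// -lee_fin nnsfun_approxE; exact: le_approx.
- move=> x Dx; have := cvg_nnsfun_approx mD mfE f0E Dx.
  by move=> /fine_cvgP[_]; exact.
Qed.

Lemma test_approximable_square_integrable f : measurable_fun D f ->
  (sqint f < +oo)%E -> test_approximable f.
Proof.
move=> mf foo.
pose fp x := Num.max (f x) 0; pose fn x := Num.max (- f x) 0.
have mfp : measurable_fun D fp by apply: measurable_maxr.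
have mfn : measurable_fun D fn by apply: measurable_maxr => //; exact: measurableT_comp.
apply: (test_approximable_eq (f := fun x => (-1) * fn x + fp x)).
  by move=> x _; rewrite /fn /fp; case: (leP 0 (f x)) => [?|?]; [rewrite max_r ?max_l|rewrite max_l ?max_r]; lra.
have le_f (g : R -> R) : measurable_fun D g -> (forall x, `|g x| <= `|f x|) -> (sqint g < +oo)%E.
  by move=> mg gf; apply: le_lt_trans foo; exact: le_sqint.
apply: test_approximable_lincomb; apply: test_approximable_ge0 => //.
- by move=> x _; rewrite /fn le_max lexx orbT.
- apply: le_f => // x; rewrite /fn; case: (leP (- f x) 0) => ?; rewrite ?normr0//.
  by rewrite normrN.
- by move=> x _; rewrite /fp le_max lexx orbT.
- by apply: le_f => // x; rewrite /fp; case: (leP (f x) 0) => ?; rewrite ?normr0.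
Qed.

End approximation.

(** * Representatives and boundary values *)

Local Open Scope quotient_scope.
Local Open Scope sesquilinear_scope.
Local Notation Re := (@complex.Re _).
Local Notation Im := (@complex.Im _).

Section L2_representatives.
Context (R : realType) (n : nat) (alpha beta : 'I_n -> R).
Local Notation mu := (@lebesgue_measure R).
Local Notation D := (Omega alpha beta).
Local Notation L2 := (L2 alpha beta).
Local Notation represents := (@represents R n alpha beta).
Implicit Types (u v w : L2) (f g : R -> R[i]).

Let mD : measurable D := measurable_Omega alpha beta.

Lemma represents_eq u f g : (forall x, D x -> f x = g x) -> represents u f -> represents u g.
Proof. by move=> fg; apply: ae_imply => x fx Dx; rewrite -fg// fx. Qed.

Lemma represents_inj u v f : represents u f -> represents v f -> u = v.
Proof.
elim/quotW: u => u; elim/quotW: v => v fu fv; apply/pi_L2P.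
move: fu fv (repr_L2 u) (repr_L2 v) => fu fv ru rv.
have {}fu' : {ae mu, forall x, D x -> f x = u x}.
  by apply: ae_imply2 fu ru => x H1 H2 Dx; rewrite H1// H2.
have {}fv' : {ae mu, forall x, D x -> f x = v x}.
  by apply: ae_imply2 fv rv => x H1 H2 Dx; rewrite H1// H2.
by apply: ae_imply2 fu' fv' => x H1 H2 Dx; rewrite -H1// H2.
Qed.

Lemma represents_repr u : represents u (repr u).
Proof. exact/aeW. Qed.

Lemma represents_lincomb (a : R[i]) u v f g : represents u f -> represents v g ->
  represents (a *: u + v) (fun x => a * f x + g x).
Proof.
move=> fu gv.
have E : a *: u + v = \pi_L2 (a *: repr u + repr v) by rewrite L2addE L2scaleE !reprK.
rewrite E; have := repr_L2 (a *: repr u + repr v).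
have fgu : {ae mu, forall x, D x -> a * f x + g x = (a *: repr u + repr v : L2fun alpha beta) x}.
  by apply: ae_imply2 fu gv => x H1 H2 Dx; rewrite H1// H2.
by move=> r; apply: ae_imply2 fgu r => x H1 H2 Dx; rewrite H1// H2.
Qed.

Lemma represents_scale (a : R[i]) u f : represents u f ->
  represents (a *: u) (fun x => a * f x).
Proof.
move=> fu; have E : a *: u = \pi_L2 (a *: repr u) by rewrite L2scaleE reprK.
rewrite E; apply: ae_imply2 fu (repr_L2 (a *: repr u)) => x H1 H2 Dx.
by rewrite H1// H2.
Qed.

Lemma square_integrable_represents f : square_integrable alpha beta f ->
  exists u, represents u f.
Proof.
move=> sf; have fP : f \in L2pred alpha beta by exact/asboolP.
exists (\pi_L2 (MkL2fun fP)); have := repr_L2 (MkL2fun fP).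
by apply: ae_imply => x fx Dx; rewrite fx.
Qed.

Lemma square_integrable_repr u : square_integrable alpha beta (repr u).
Proof. exact/asboolP/L2fun_valP. Qed.

Lemma bounded_square_integrable f (M : R) : measurable_fun D (Re \o f) ->
  measurable_fun D (Im \o f) -> (forall x, D x -> normc2 (f x) <= M) ->
  square_integrable alpha beta f.
Proof.
move=> mr mi fM; split=> //.
apply: (@le_lt_trans _ _ (\int[mu]_(x in D) (cst M%:E x))%E).
  apply: ge0_le_integral => //.
  - by move=> x _; rewrite lee_fin normc2_ge0.
  - by apply/measurable_EFinP; exact: measurable_normc2.
have fD : mu D \is a fin_num by rewrite ge0_fin_numE// lebesgue_measure_Omega.
by rewrite integral_cst// -[X in (_ * X)%E](fineK fD) -EFinM ltry.
Qed.

(** [L2dot] is defined through the representatives chosen by [repr]; Green's identity needs the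
    continuous ones instead. *)
Lemma cintegral_represents u v f g :
  measurable_fun D (Re \o f) -> measurable_fun D (Im \o f) ->
  measurable_fun D (Re \o g) -> measurable_fun D (Im \o g) ->
  represents u f -> represents v g ->
  L2dot u v = cintegral alpha beta (fun x => f x * (g x)^*).
Proof.
move=> fr fi gr gi fu gv; apply: ae_eq_cintegral.
- exact: L2fun_cintegrable.
- have sq (h : R -> R[i]) z : measurable_fun D (Re \o h) -> measurable_fun D (Im \o h) ->
      represents z h -> square_integrable alpha beta h.
    move=> hr hi hz; split=> //.
    have [zr zi] := square_integrable_repr z; apply: le_lt_trans.
    rewrite le_eqVlt; apply/orP; left; apply/eqP; apply: ae_eq_integral => //.
    + by apply/measurable_EFinP; exact: measurable_normc2.
    + by apply/measurable_EFinP; exact: measurable_normc2.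
    + by apply: ae_imply hz => x H Dx; rewrite /= H.
  have /asboolP fP := sq _ _ fr fi fu; have /asboolP gP := sq _ _ gr gi gv.
  exact: (L2fun_cintegrable (MkL2fun fP) (MkL2fun gP)).
- by apply: ae_imply2 fu gv => x H1 H2 Dx; rewrite H1// H2.
Qed.

(* The extension by 0 is integrable on R, so that integrals over arbitrary
   intervals make sense. *)
Definition re_ext u : R -> R := (Re \o repr u) \_ D.
Definition im_ext u : R -> R := (Im \o repr u) \_ D.

(** On a set of finite measure this follows from |h| <= h^2 + 1. *)
Lemma sqr_integrable_integrable (h : R -> R) : measurable_fun D h ->
  (\int[mu]_(x in D) (h x ^+ 2)%:E < +oo)%E -> mu.-integrable D (EFin \o h).
Proof.
move=> mh hoo.
have i1 : mu.-integrable D (fun x => (h x ^+ 2)%:E + 1)%E.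
  apply: integrableD => //.
    apply/integrableP; split; first by apply/measurable_EFinP; exact: measurable_funX.
    by under eq_integral do rewrite /= ger0_norm ?sqr_ge0//.
  apply/integrableP; split; first exact: measurable_cst.
  by under eq_integral do rewrite /= normr1; rewrite integral_cst// mul1e lebesgue_measure_Omega.
apply: le_integrable i1 => //; first exact/measurable_EFinP.
move=> x _; rewrite /= lee_fin (ger0_norm (_ : 0 <= h x ^+ 2 + 1)); last first.
  by rewrite addr_ge0// sqr_ge0.
by rewrite ler_norml; apply/andP; split; have := sqr_ge0 (h x - 1); have := sqr_ge0 (h x + 1); nra.
Qed.

Lemma repr_sqint u : [/\ measurable_fun D (Re \o repr u), measurable_fun D (Im \o repr u),
  (sqint alpha beta (Re \o repr u) < +oo)%E & (sqint alpha beta (Im \o repr u) < +oo)%E].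
Proof.
have [mr mi oo] := square_integrable_repr u; split=> //.
- apply: le_lt_trans oo; apply: ge0_le_integral => //.
  + by move=> x _; rewrite lee_fin sqr_ge0.
  + by apply/measurable_EFinP; exact: measurable_funX.
  + by apply/measurable_EFinP; exact: measurable_normc2.
  + by move=> x _; rewrite lee_fin /normc2 lerDl sqr_ge0.
- apply: le_lt_trans oo; apply: ge0_le_integral => //.
  + by move=> x _; rewrite lee_fin sqr_ge0.
  + by apply/measurable_EFinP; exact: measurable_funX.
  + by apply/measurable_EFinP; exact: measurable_normc2.
  + by move=> x _; rewrite lee_fin /normc2 lerDr sqr_ge0.
Qed.

Lemma integrable_re_ext u : mu.-integrable setT (EFin \o re_ext u).
Proof.
have [mr _ oo _] := repr_sqint u.
by apply: integrable_patch => //; exact: sqr_integrable_integrable.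
Qed.

Lemma integrable_im_ext u : mu.-integrable setT (EFin \o im_ext u).
Proof.
have [_ mi _ oo] := repr_sqint u.
by apply: integrable_patch => //; exact: sqr_integrable_integrable.
Qed.

Lemma re_extE u x : D x -> re_ext u x = Re (repr u x).
Proof. by move=> Dx; rewrite /re_ext patchE mem_set. Qed.

Lemma im_extE u x : D x -> im_ext u x = Im (repr u x).
Proof. by move=> Dx; rewrite /im_ext patchE mem_set. Qed.

(** Working form of [Dmax]: by [cdensity_ac] and [ac_cdensity] it says that [f] is absolutely
    continuous on each J_i with derivative in the class [u]. *)
Definition cdensity f u := forall i,
  has_density (alpha i) (beta i) (Re \o f) (re_ext u) /\
  has_density (alpha i) (beta i) (Im \o f) (im_ext u).

Lemma abs_continuous_ReIm a b f :
  abs_continuous a b f <-> ac a b (Re \o f) /\ ac a b (Im \o f).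
Proof.
have nc (z : R[i]) : [/\ `|Re z| <= ComplexField.Normc.normc z, `|Im z| <= ComplexField.Normc.normc z &
    ComplexField.Normc.normc z <= `|Re z| + `|Im z|].
  case: z => x y /=; split.
  - by rewrite -sqrtr_sqr ler_wsqrtr// lerDl sqr_ge0.
  - by rewrite -sqrtr_sqr ler_wsqrtr// lerDr sqr_ge0.
  - rewrite -[leRHS]ger0_norm ?addr_ge0// -sqrtr_sqr ler_wsqrtr// sqrrD.
    by rewrite !real_normK ?num_real// lerD2r lerDl mulrn_wge0 ?mulr_ge0.
have ReB (z w : R[i]) : Re (z - w) = Re z - Re w by case: z w => [? ?] [].
have ImB (z w : R[i]) : Im (z - w) = Im z - Im w by case: z w => [? ?] [].
split=> [acf|[acr aci]].
  split=> e /acf[d d0 H]; exists d => // m s t st tst std;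
    apply: le_lt_trans (H m s t st tst std); apply: ler_sum => k _ /=.
    by rewrite -ReB; have [] := nc (f (t k) - f (s k)).
  by rewrite -ImB; have [] := nc (f (t k) - f (s k)).
move=> e e0; have e2 : 0 < e / 2 by rewrite divr_gt0.
have [d1 d10 H1] := acr _ e2; have [d2 d20 H2] := aci _ e2.
exists (Num.min d1 d2); first by rewrite lt_min d10.
move=> m s t st tst; rewrite lt_min => /andP[std1 std2].
rewrite (splitr e); apply: le_lt_trans (ltrD (H1 m s t st tst std1) (H2 m s t st tst std2)).
rewrite -big_split; apply: ler_sum => k _ /=; rewrite -ReB -ImB.
by have [] := nc (f (t k) - f (s k)).
Qed.

Lemma cdensity_ac f w : cdensity f w ->
  (forall i, abs_continuous (alpha i) (beta i) f) /\ represents w (cderive f).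
Proof.
move=> fw; split.
  move=> i; apply/abs_continuous_ReIm; have [fr fi] := fw i.
  by split; [exact: density_ac (integrable_re_ext w) fr|exact: density_ac (integrable_im_ext w) fi].
have aeF := ae_filter_ringOfSetsType mu.
have H : {ae mu, forall x, forall i, alpha i < x -> x < beta i ->
    derive1 (Re \o f) x = re_ext w x /\ derive1 (Im \o f) x = im_ext w x}.
  apply: filter_forall => i; have [fr fi] := fw i.
  have Hr := density_derive (integrable_re_ext w) fr.
  have Hi := density_derive (integrable_im_ext w) fi.
  apply: ae_imply2 Hr Hi => x Hr Hi ax xb.
  by split; [have [] := Hr ax xb|have [] := Hi ax xb].
apply: ae_imply H => x H Dx; have [i _ /=] := Dx; rewrite in_itv/= => /andP[ax xb].
rewrite /cderive; have [-> ->] := H i ax xb.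
by rewrite re_extE// im_extE//; case: (repr w x).
Qed.

Lemma ac_cdensity f w : (forall i, abs_continuous (alpha i) (beta i) f) ->
  represents w (cderive f) -> cdensity f w.
Proof.
move=> acf fw i; have /abs_continuous_ReIm[fr fi] := acf i.
split.
  apply: ac_FTC fr (integrable_re_ext w) _; apply: ae_imply fw => x fw ax xb.
  have Dx : D x by exists i => //=; rewrite in_itv/= ax.
  by rewrite re_extE// -fw.
apply: ac_FTC fi (integrable_im_ext w) _; apply: ae_imply fw => x fw ax xb.
have Dx : D x by exists i => //=; rewrite in_itv/= ax.
by rewrite im_extE// -fw.
Qed.

Definition kappa : R[i] := 2 * (pi : R)%:C%C * 'i.

Lemma kappa_neq0 : kappa != 0.
Proof.
rewrite !mulf_neq0 ?neq0Ci ?pnatr_eq0//.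
by rewrite eq_complex /= eqxx andbT gt_eqF// pi_gt0.
Qed.

(** This sign turns the difference in Green's identity into the integral of the derivative of a
    product. *)
Lemma conj_kappaV : (kappa^-1)^* = - kappa^-1.
Proof.
rewrite rmorphV ?unitfE ?kappa_neq0// /kappa !rmorphM/= conjCi rmorph_nat mulrN invrN.
by congr (- (_ * _ * _)^-1); rewrite -[LHS]/(Complex _ _) oppr0.
Qed.

Lemma represents_momentum f v :
  represents v (momentum f) <-> represents (kappa *: v) (cderive f).
Proof.
split=> h.
  apply: represents_eq (represents_scale kappa h) => x _.
  by rewrite /momentum mulrA divff ?mul1r// kappa_neq0.
rewrite -[v]scale1r -(mulVf kappa_neq0) -scalerA.
exact: represents_scale.
Qed.

End L2_representatives.

(** * Boundary values and Green's identity *)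

Section boundary_values.
Context (R : realType) (n : nat) (alpha beta : 'I_n -> R).
Hypothesis alpha_lt_beta : forall i, alpha i < beta i.
Hypothesis beta_lt_alpha : forall i j : 'I_n, (i < j)%N -> beta i < alpha j.
Local Notation mu := (@lebesgue_measure R).
Local Notation D := (Omega alpha beta).
Local Notation L2 := (L2 alpha beta).
Local Notation represents := (@represents R n alpha beta).
Local Notation cdensity := (@cdensity R n alpha beta).
Implicit Types (u v w : L2) (f g : R -> R[i]).

Let mD : measurable D := measurable_Omega alpha beta.

Lemma complex_eq (z w : R[i]) : Re z = Re w -> Im z = Im w -> z = w.
Proof. by case: z w => [? ?] [? ?] /= -> ->. Qed.

Lemma Omega_in i x : alpha i < x -> x < beta i -> D x.
Proof. by move=> ax xb; exists i => //=; rewrite in_itv/= ax. Qed.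

(** For the class of f' this is the increment f(beta_i) - f(alpha_i), see [cdensity_boundaryE]. *)
Definition itv_integral (i : 'I_n) u : R[i] :=
  Complex (\int[mu]_(x in `]alpha i, beta i[) re_ext u x)
          (\int[mu]_(x in `]alpha i, beta i[) im_ext u x).

Lemma lim_of_cvg (F : set_system R) {FF : ProperFilter F} (h : R -> R) (l : R) :
  h x @[x --> F] --> l -> lim (h x @[x --> F]) = l.
Proof. by move=> hl; apply: cvg_lim. Qed.

Lemma cdensity_limits f w i : cdensity f w ->
  [/\ Re (f x) @[x --> (alpha i)^'+] --> Re (right_limit f (alpha i)),
      Im (f x) @[x --> (alpha i)^'+] --> Im (right_limit f (alpha i)),
      Re (f x) @[x --> (beta i)^'-] --> Re (left_limit f (beta i)) &
      Im (f x) @[x --> (beta i)^'-] --> Im (left_limit f (beta i))].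
Proof.
move=> /(_ i)[fr fi].
have [la [lb [cla clb _ _]]] := density_limits (alpha_lt_beta i) (integrable_re_ext w) fr.
have [ka [kb [cka ckb _ _]]] := density_limits (alpha_lt_beta i) (integrable_im_ext w) fi.
by rewrite /right_limit /left_limit /= (lim_of_cvg cla) (lim_of_cvg clb) (lim_of_cvg cka) (lim_of_cvg ckb).
Qed.

Lemma cdensity_limit_eq f i (za zb : R[i]) :
  Re (f x) @[x --> (alpha i)^'+] --> Re za -> Im (f x) @[x --> (alpha i)^'+] --> Im za ->
  Re (f x) @[x --> (beta i)^'-] --> Re zb -> Im (f x) @[x --> (beta i)^'-] --> Im zb ->
  right_limit f (alpha i) = za /\ left_limit f (beta i) = zb.
Proof.
move=> h1 h2 h3 h4; split; rewrite /right_limit /left_limit.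
  by rewrite (lim_of_cvg h1) (lim_of_cvg h2); case: (za).
by rewrite (lim_of_cvg h3) (lim_of_cvg h4); case: (zb).
Qed.

Lemma cdensity_boundaryE f w i : cdensity f w ->
  left_limit f (beta i) = right_limit f (alpha i) + itv_integral i w.
Proof.
move=> fw; have [cr1 ci1 cr2 ci2] := cdensity_limits i fw; have [fr fi] := fw i.
have [la [lb [cla clb _ E]]] := density_limits (alpha_lt_beta i) (integrable_re_ext w) fr.
have [ka [kb [cka ckb _ E']]] := density_limits (alpha_lt_beta i) (integrable_im_ext w) fi.
apply: complex_eq; rewrite ?Defs.ReD ?Defs.ImD.
  by rewrite (cvg_unique _ cr2 clb)// (cvg_unique _ cr1 cla)//.
by rewrite (cvg_unique _ ci2 ckb)// (cvg_unique _ ci1 cka).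
Qed.

Lemma re_ext_represents u f : represents u f ->
  {ae mu, forall x, D x -> re_ext u x = Re (f x) /\ im_ext u x = Im (f x)}.
Proof. by apply: ae_imply => x H Dx; rewrite re_extE// im_extE// H. Qed.

(** Only almost everywhere, since [repr] chooses representatives without regard to the linear
    structure. *)
Lemma re_ext_lincomb (a : R[i]) u v : {ae mu, forall x, D x ->
  re_ext (a *: u + v) x = (Re a * re_ext u x - Im a * im_ext u x) + re_ext v x /\
  im_ext (a *: u + v) x = (Re a * im_ext u x + Im a * re_ext u x) + im_ext v x}.
Proof.
have := re_ext_represents (represents_lincomb a (represents_repr u) (represents_repr v)).
apply: ae_imply => x H Dx; have [-> ->] := H Dx.
by rewrite !re_extE// !im_extE// Defs.ReD Defs.ImD Defs.ReM Defs.ImM.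
Qed.

Lemma integrable_lincomb3 (E : set R) (c1 c2 : R) (f1 f2 f3 : R -> R) : measurable E ->
  mu.-integrable E (EFin \o f1) -> mu.-integrable E (EFin \o f2) ->
  mu.-integrable E (EFin \o f3) ->
  mu.-integrable E (EFin \o (fun x => c1 * f1 x + c2 * f2 x + f3 x)) /\
  \int[mu]_(x in E) (c1 * f1 x + c2 * f2 x + f3 x) =
  c1 * (\int[mu]_(x in E) f1 x) + c2 * (\int[mu]_(x in E) f2 x) + \int[mu]_(x in E) f3 x.
Proof.
move=> mE i1 i2 i3.
have iZ (c : R) (h : R -> R) : mu.-integrable E (EFin \o h) -> mu.-integrable E (EFin \o (fun x => c * h x)).
  by move=> ih; rewrite (_ : _ \o _ = fun x => (c%:E * (h x)%:E)%E)//; exact: integrableZl.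
have i12 : mu.-integrable E (EFin \o (fun x => c1 * f1 x + c2 * f2 x)).
  rewrite (_ : _ \o _ = (fun x => (c1 * f1 x)%:E + (c2 * f2 x)%:E)%E)//.
  by apply: integrableD => //; exact: iZ.
split.
  rewrite (_ : _ \o _ = (fun x => (c1 * f1 x + c2 * f2 x)%:E + (f3 x)%:E)%E)//.
  exact: integrableD.
rewrite RintegralD// RintegralD//; [|exact: iZ|exact: iZ].
by rewrite !RintegralZl.
Qed.

Lemma Rintegral_re_ext_lincomb i (E : set R) (a : R[i]) u v : measurable E ->
  E `<=` `]alpha i, beta i[ ->
  \int[mu]_(x in E) re_ext (a *: u + v) x =
    Re a * (\int[mu]_(x in E) re_ext u x) + - Im a * (\int[mu]_(x in E) im_ext u x) +
    \int[mu]_(x in E) re_ext v x /\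
  \int[mu]_(x in E) im_ext (a *: u + v) x =
    Re a * (\int[mu]_(x in E) im_ext u x) + Im a * (\int[mu]_(x in E) re_ext u x) +
    \int[mu]_(x in E) im_ext v x.
Proof.
move=> mE Ei.
have iE (h : R -> R) : mu.-integrable setT (EFin \o h) -> mu.-integrable E (EFin \o h).
  exact: integrable_setS.
have [ir ii] := (iE _ (integrable_re_ext u), iE _ (integrable_im_ext u)).
have [jr ji] := (iE _ (integrable_re_ext v), iE _ (integrable_im_ext v)).
have [i1 <-] := integrable_lincomb3 (Re a) (- Im a) mE ir ii jr.
have [i2 <-] := integrable_lincomb3 (Re a) (Im a) mE ii ir ji.
split; apply: ae_eq_Rintegral => //.
- exact: iE (integrable_re_ext _).
- apply: ae_imply (re_ext_lincomb a u v) => x H /Ei; rewrite /= in_itv/= => /andP[ax xb].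
  by have [-> _] := H (Omega_in ax xb); rewrite mulNr.
- exact: iE (integrable_im_ext _).
- apply: ae_imply (re_ext_lincomb a u v) => x H /Ei; rewrite /= in_itv/= => /andP[ax xb].
  by have [_ ->] := H (Omega_in ax xb).
Qed.

Lemma itv_integral_lincomb i (a : R[i]) u v :
  itv_integral i (a *: u + v) = a * itv_integral i u + itv_integral i v.
Proof.
have [||hr hi] := @Rintegral_re_ext_lincomb i `]alpha i, beta i[%classic a u v.
- exact: measurable_itv.
- by [].
by apply: complex_eq; rewrite ?(Defs.ReD, Defs.ImD) ?(Defs.ReM, Defs.ImM) /= ?hr ?hi ?mulNr.
Qed.

Lemma cdensity_lincomb (a : R[i]) f g u v : cdensity f u -> cdensity g v ->
  cdensity (fun x => a * f x + g x) (a *: u + v).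
Proof.
move=> fu gv i; have [fr fi] := fu i; have [gr gi] := gv i.
have sub s t : alpha i < s -> t < beta i -> `]s, t]%classic `<=` `]alpha i, beta i[%classic.
  move=> sa tb x /=; rewrite !in_itv/= => /andP[sx xt].
  by rewrite (lt_trans sa)// (le_lt_trans xt).
split=> s t sa st tb /=; rewrite ?(Defs.ReD, Defs.ImD) ?(Defs.ReM, Defs.ImM);
  have [||hr hi] := @Rintegral_re_ext_lincomb i `]s, t]%classic a u v;
  [exact: measurable_itv|exact: sub| |exact: measurable_itv|exact: sub|].
- rewrite hr -(fr s t)// -(fi s t)// -(gr s t)//=; ring.
- rewrite hi -(fr s t)// -(fi s t)// -(gi s t)//=; ring.
Qed.

Lemma ae_exists_itv (P : R -> Prop) (a b : R) : a < b ->
  {ae mu, forall x, P x} -> exists x, [/\ a < x, x < b & P x].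
Proof.
move=> ab [N [mN N0 PN]]; apply: contrapT => H.
have sub : `]a, b[%classic `<=` N.
  move=> x /=; rewrite in_itv/= => /andP[ax xb]; apply: PN => /= Px.
  by apply: H; exists x.
have : (mu `]a, b[%classic <= mu N)%E.
  by apply: le_measure; rewrite ?inE//; exact: measurable_itv.
rewrite [X in (_ <= X)%E]N0 lebesgue_measure_itv/= lte_fin ab -EFinB lee_fin.
by rewrite leNgt subr_gt0 ab.
Qed.

(** A primitive varies little over short intervals ([Rintegral_itv_small]), and zeros of [h] occur
    arbitrarily close to the right of each point, because a nonempty open interval is not null. *)
Lemma density_ae_eq0 a b (h g : R -> R) : mu.-integrable setT (EFin \o g) ->
  has_density a b h g -> {ae mu, forall x, a < x -> x < b -> h x = 0} ->
  forall x, a < x -> x < b -> h x = 0.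
Proof.
move=> ig hg h0 x ax xb; apply/eqP; rewrite -normr_le0; apply/ler_addgt0Pl => e e0.
rewrite addr0; have [d d0 H] := Rintegral_itv_small ig e0.
have xm : x < Num.min b (x + d) by rewrite lt_min xb ltrDl.
have [y [xy]] := ae_exists_itv xm h0.
rewrite lt_min => /andP[yb yd] /(_ (lt_trans ax xy) yb) hy0.
have := H false false x y; rewrite -hg ?(ltW xy)// hy0 sub0r normrN.
by move=> /(_ _)/ltW; apply; rewrite ltrBlDl.
Qed.

(** The difference of the two functions is a primitive that vanishes almost everywhere. Consequently
    boundary values belong to the class and not to the chosen function. *)
Lemma cdensity_represents_inj u f g w z : represents u f -> represents u g ->
  cdensity f w -> cdensity g z -> forall x, D x -> f x = g x.
Proof.
move=> fu gu fw gz x [i _]; rewrite /= in_itv/= => /andP[ax xb].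
have h := cdensity_lincomb (-1) gz fw; have [hr hi] := h i.
have h0 : {ae mu, forall x, D x -> -1 * g x + f x = 0}.
  by apply: ae_imply2 fu gu => y H1 H2 Dy; rewrite H1// H2// mulN1r addNr.
have E : -1 * g x + f x = 0.
  apply: complex_eq.
    apply: (density_ae_eq0 (integrable_re_ext _) hr _ ax xb).
    by apply: ae_imply h0 => y H ay yb; rewrite /= H//; exact: Omega_in ay yb.
  apply: (density_ae_eq0 (integrable_im_ext _) hi _ ax xb).
  by apply: ae_imply h0 => y H ay yb; rewrite /= H//; exact: Omega_in ay yb.
by apply/eqP; rewrite -subr_eq0 addrC -mulN1r E.
Qed.

Lemma cdensity_eq f g w : (forall x, D x -> f x = g x) -> cdensity f w -> cdensity g w.
Proof.
move=> fg fw i; have [fr fi] := fw i.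
have E s : alpha i < s -> s < beta i -> f s = g s by move=> ? ?; apply: fg; exact: (@Omega_in i).
split=> s t sa st tb /=; rewrite -!E ?(lt_le_trans sa st)// ?(le_lt_trans st tb)//.
  exact: fr.
exact: fi.
Qed.

Lemma boundary_eq f g i : (forall x, D x -> f x = g x) ->
  right_limit f (alpha i) = right_limit g (alpha i) /\
  left_limit f (beta i) = left_limit g (beta i).
Proof.
move=> fg; have ab := alpha_lt_beta i.
have Er (h : R[i] -> R) : h (f x) @[x --> (alpha i)^'+] = h (g x) @[x --> (alpha i)^'+].
  apply/seteqP; split; apply: near_eq_cvg; near=> x; rewrite fg//;
    by apply: (@Omega_in i); near: x; [exact: nbhs_right_gt|exact: nbhs_right_lt].
have El (h : R[i] -> R) : h (f x) @[x --> (beta i)^'-] = h (g x) @[x --> (beta i)^'-].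
  apply/seteqP; split; apply: near_eq_cvg; near=> x; rewrite fg//;
    by apply: (@Omega_in i); near: x; [exact: nbhs_left_gt|exact: nbhs_left_lt].
by rewrite /right_limit /left_limit !Er !El.
Unshelve. all: by end_near. Qed.

Lemma lincomb_limits (a : R[i]) i f g w z : cdensity f w -> cdensity g z ->
  right_limit (fun x => a * f x + g x) (alpha i) =
    a * right_limit f (alpha i) + right_limit g (alpha i) /\
  left_limit (fun x => a * f x + g x) (beta i) =
    a * left_limit f (beta i) + left_limit g (beta i).
Proof.
move=> fw gz.
have [f1 f2 f3 f4] := cdensity_limits i fw; have [g1 g2 g3 g4] := cdensity_limits i gz.
have cvg_re (F : set_system R) (y y' : R[i]) : Filter F ->
    Re (f x) @[x --> F] --> Re y -> Im (f x) @[x --> F] --> Im y ->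
    Re (g x) @[x --> F] --> Re y' ->
    Re (a * f x + g x) @[x --> F] --> Re (a * y + y').
  move=> FF hr hi gr; rewrite Defs.ReD Defs.ReM; under eq_fun do rewrite Defs.ReD Defs.ReM.
  by apply: cvgD gr; apply: cvgB; apply: cvgMr.
have cvg_im (F : set_system R) (y y' : R[i]) : Filter F ->
    Re (f x) @[x --> F] --> Re y -> Im (f x) @[x --> F] --> Im y ->
    Im (g x) @[x --> F] --> Im y' ->
    Im (a * f x + g x) @[x --> F] --> Im (a * y + y').
  move=> FF hr hi gr; rewrite Defs.ImD Defs.ImM; under eq_fun do rewrite Defs.ImD Defs.ImM.
  by apply: cvgD gr; apply: cvgD; apply: cvgMr.
apply: cdensity_limit_eq.
- exact: (cvg_re _ _ _ _ f1 f2 g1).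
- exact: (cvg_im _ _ _ _ f1 f2 g2).
- exact: (cvg_re _ _ _ _ f3 f4 g3).
- exact: (cvg_im _ _ _ _ f3 f4 g4).
Qed.

(** The graph of the maximal operator with its boundary values recorded: [u] is the class of f, [v]
    that of f' / (2 pi i), and p, q collect the limits of f at the left and right endpoints. Later
    arguments about extensions run on this relation. *)
Definition graph_bv u v (p q : 'cV[R[i]]_n) : Prop := exists f,
  [/\ represents u f, cdensity f (kappa R *: v), at_alpha alpha f = p & at_beta beta f = q].

Lemma graph_bv_lincomb (a : R[i]) u v p q u' v' p' q' :
  graph_bv u v p q -> graph_bv u' v' p' q' ->
  graph_bv (a *: u + u') (a *: v + v') (a *: p + p') (a *: q + q').
Proof.
move=> [f [fu fv fp fq]] [g [gu gv gp gq]]; exists (fun x => a * f x + g x); split.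
- exact: represents_lincomb.
- by rewrite scalerDr scalerA mulrC -scalerA; exact: cdensity_lincomb.
- by apply/matrixP => i j; rewrite !mxE -fp -gp !mxE; have [] := lincomb_limits a i fv gv.
- by apply/matrixP => i j; rewrite !mxE -fq -gq !mxE; have [] := lincomb_limits a i fv gv.
Qed.

Lemma graph_bv_inj u v p q v' p' q' :
  graph_bv u v p q -> graph_bv u v' p' q' -> [/\ v = v', p = p' & q = q'].
Proof.
move=> [f [fu fv fp fq]] [g [gu gv gp gq]].
have fg := cdensity_represents_inj fu gu fv gv.
have {}fv := cdensity_eq fg fv.
split.
- have [_ c1] := cdensity_ac fv; have [_ c2] := cdensity_ac gv.
  by have /(scalerI (kappa_neq0 R)) := represents_inj c1 c2.
- by apply/matrixP => i j; rewrite -fp -gp !mxE; have [-> _] := boundary_eq i fg.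
- by apply/matrixP => i j; rewrite -fq -gq !mxE; have [_ ->] := boundary_eq i fg.
Qed.

Lemma cdensity_measurable f w : cdensity f w ->
  measurable_fun D (Re \o f) /\ measurable_fun D (Im \o f).
Proof.
move=> fw.
have oD : open D by apply: bigcup_open => i _; exact: interval_open.
split; apply: open_continuous_measurable_fun => // x; rewrite inE => -[i _ xi];
  have [fr fi] := fw i.
  exact: (density_continuous (integrable_re_ext w) fr).
exact: (density_continuous (integrable_im_ext w) fi).
Qed.

Lemma cdensity_square_integrable f w : cdensity f w -> square_integrable alpha beta f.
Proof.
move=> fw; have [mr mi] := cdensity_measurable fw.
have /choice[M MP] i : exists M : R, 0 <= M /\
    forall x, alpha i < x -> x < beta i -> normc2 (f x) <= M.
  have [fr fi] := fw i.
  have [A A0 fA] := density_bounded (alpha_lt_beta i) (integrable_re_ext w) fr.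
  have [B B0 fB] := density_bounded (alpha_lt_beta i) (integrable_im_ext w) fi.
  exists (A ^+ 2 + B ^+ 2); split; first by rewrite addr_ge0 ?sqr_ge0.
  move=> x ax xb; rewrite /normc2 -(real_normK (num_real (Re _))) -(real_normK (num_real (Im _))).
  by rewrite lerD// lerXn2r ?nnegrE//; [exact: fA|exact: fB].
apply: (bounded_square_integrable (M := \sum_i M i)) => // x [i _]; rewrite /= in_itv/= => /andP[ax xb].
rewrite (bigD1 i)//= (le_trans ((MP i).2 x ax xb))// lerDl sumr_ge0// => j _.
by have [] := MP j.
Qed.

Lemma square_integrable_cintegrable f g : square_integrable alpha beta f ->
  square_integrable alpha beta g -> cintegrable alpha beta (fun x => f x * (g x)^*).
Proof.
by move=> /asboolP fP /asboolP gP; exact: (L2fun_cintegrable (MkL2fun fP) (MkL2fun gP)).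
Qed.

Lemma cdensity_exists w (p : 'I_n -> R[i]) : exists2 f, cdensity f w &
  forall i, right_limit f (alpha i) = p i.
Proof.
pose J i x := (alpha i < x) && (x < beta i).
pose F i (x : R) : R[i] := p i + Complex (\int[mu]_(z in `]alpha i, x]) re_ext w z)
                              (\int[mu]_(z in `]alpha i, x]) im_ext w z).
pose f (x : R) : R[i] := \sum_(i < n | J i x) F i x.
have fE i x : alpha i < x -> x < beta i -> f x = F i x.
  move=> ax xb; rewrite /f (big_pred1 i)// => j; apply/idP/eqP => [/andP[jx xj]|->].
    by rewrite (Omega_itv_disjoint beta_lt_alpha ax xb jx xj).
  by rewrite /J ax.
have fw : cdensity f w.
  move=> i; split=> s t sa st tb /=; rewrite !(fE i) ?(lt_le_trans sa st)// ?(le_lt_trans st tb)//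
    /F ?(Defs.ReD, Defs.ImD)/= opprD addrACA subrr add0r.
  - rewrite (@Rintegral_itv_oc_split _ _ (alpha i) s (BRight t) (integrable_re_ext w)) ?(ltW sa)//.
    by rewrite addrAC subrr add0r.
  - rewrite (@Rintegral_itv_oc_split _ _ (alpha i) s (BRight t) (integrable_im_ext w)) ?(ltW sa)//.
    by rewrite addrAC subrr add0r.
exists f => // i; have [fr fi] := fw i; have ab := alpha_lt_beta i.
have [la [lb [cla _ E _]]] := density_limits ab (integrable_re_ext w) fr.
have [ka [kb [cka _ E' _]]] := density_limits ab (integrable_im_ext w) fi.
pose c := (alpha i + beta i) / 2.
have [ac cb] : alpha i < c /\ c < beta i by rewrite /c; split; lra.
apply: complex_eq.
  have := E _ ac cb; rewrite /= (fE i)// /F Defs.ReD/= => /addIr ->.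
  exact: lim_of_cvg cla.
have := E' _ ac cb; rewrite /= (fE i)// /F Defs.ImD/= => /addIr ->.
exact: lim_of_cvg cka.
Qed.

(** The left boundary values can be prescribed; the right ones are then forced by integrating the
    derivative. *)
Lemma graph_bv_exists v (p : 'cV[R[i]]_n) : exists u,
  graph_bv u v p (\col_i (p i 0 + itv_integral i (kappa R *: v))).
Proof.
have [f fv fp] := cdensity_exists (kappa R *: v) (fun i => p i 0).
have [u fu] := square_integrable_represents (cdensity_square_integrable fv).
exists u, f; split=> //; apply/matrixP => i j; rewrite !mxE ?fp ?[j]ord1//.
by rewrite (cdensity_boundaryE i fv) fp.
Qed.

Lemma Rintegral_Omega (h : R -> R) : mu.-integrable D (EFin \o h) ->
  \int[mu]_(x in D) h x = \sum_i \int[mu]_(x in `]alpha i, beta i[) h x.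
Proof.
move=> ih; have mJ i : measurable (`]alpha i, beta i[ : set R) by exact: measurable_itv.
have DE : D = \big[setU/set0]_(i <- index_enum 'I_n) `]alpha i, beta i[%classic.
  by rewrite /Omega -bigcup_seq; apply/seteqP; split=> x [i _ xi]; exists i => //=; rewrite mem_index_enum.
rewrite /Rintegral {1}DE integral_bigsetU_EFin//.
- rewrite -sum_fine// => i _; apply: integrable_fin_num => //.
  by apply: integrable_setS ih => //; exact: Omega_itv.
- exact: index_enum_uniq.
- move=> i j _ _ [x [/=]]; rewrite !in_itv/= => /andP[a1 b1] /andP[a2 b2].
  exact: (Omega_itv_disjoint beta_lt_alpha a1 b1 a2 b2).
- by rewrite -DE; exact: measurable_int ih.
Qed.

Lemma L2dot0l u : L2dot 0 u = 0.
Proof.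
have := L2dot_linearl u 1 0 0; rewrite scale1r addr0 mul1r => E.
by have := subrr (L2dot 0 u); rewrite {1}E addrK.
Qed.

Lemma L2dotZl (a : R[i]) u v : L2dot (a *: u) v = a * L2dot u v.
Proof. by have := L2dot_linearl v a u 0; rewrite addr0 L2dot0l addr0. Qed.

Lemma L2dotZr (a : R[i]) u v : L2dot u (a *: v) = a^* * L2dot u v.
Proof. by rewrite L2dotC L2dotZl (L2dotC u v) !expr0 !mul1r rmorphM. Qed.

(** As the conjugate of 1/kappa is -1/kappa, the left side is 1/kappa times the integral of f'
    conj(g) + f conj(g'), the derivative of f conj(g); integration by parts on every J_i leaves the
    boundary terms. *)
Lemma green_formula u v p q u' v' p' q' :
  graph_bv u v p q -> graph_bv u' v' p' q' ->
  L2dot v u' - L2dot u v' = (kappa R)^-1 * (cdot q q' - cdot p p').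
Proof.
move=> [f [fu fv <- <-]] [g [gu gv <- <-]].
set w := kappa R *: v in fv; set w' := kappa R *: v' in gv.
have vE : v = (kappa R)^-1 *: w by rewrite /w scalerA mulVf ?scale1r// kappa_neq0.
have vE' : v' = (kappa R)^-1 *: w' by rewrite /w' scalerA mulVf ?scale1r// kappa_neq0.
have -> : L2dot v u' = (kappa R)^-1 * L2dot w u'.
  by rewrite {1}vE L2dotZl.
have -> : L2dot u v' = - (kappa R)^-1 * L2dot u w'.
  by rewrite {1}vE' L2dotZr conj_kappaV.
rewrite mulNr opprK -mulrDr; congr (_ * _).
(* [W z] agrees with [repr z] on Omega but is assembled from [re_ext z] and [im_ext z], the
   functions that serve as densities. *)
pose W w (x : R) : R[i] := Complex (re_ext w x) (im_ext w x).
have WE z : represents z (W z).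
  by apply/aeW => x Dx; rewrite /W re_extE// im_extE//; case: (repr z x).
have mW z : measurable_fun D (Re \o W z) /\ measurable_fun D (Im \o W z).
  split; apply/measurable_EFinP; apply: (@measurable_funS _ _ _ _ setT) => //.
    exact: measurable_int (integrable_re_ext z).
  exact: measurable_int (integrable_im_ext z).
have sW z : square_integrable alpha beta (W z).
  have [mwr mwi] := mW z; split => //; have [_ _] := square_integrable_repr z.
  apply: le_lt_trans; rewrite le_eqVlt; apply/orP; left; apply/eqP.
  by apply: eq_integral => x; rewrite inE => Dx; rewrite /W /normc2/= re_extE// im_extE.
have [mfr mfi] := cdensity_measurable fv; have [mgr mgi] := cdensity_measurable gv.
have sf := cdensity_square_integrable fv; have sg := cdensity_square_integrable gv.
have [mwr mwi] := mW w; have [mwr' mwi'] := mW w'.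
rewrite (cintegral_represents mwr mwi mgr mgi (WE w) gu).
rewrite (cintegral_represents mfr mfi mwr' mwi' fu (WE w')).
have c1 := square_integrable_cintegrable (sW w) sg.
have c2 := square_integrable_cintegrable sf (sW w').
rewrite -[X in X + _]mul1r -cintegralP//.
have [c1r c1i] := c1; have [c2r c2i] := c2.
have iadd (h k : R -> R) : mu.-integrable D (EFin \o h) -> mu.-integrable D (EFin \o k) ->
    mu.-integrable D (EFin \o (fun x => h x + k x)).
  by move=> ih ik; rewrite (_ : _ \o _ = (fun x => (h x)%:E + (k x)%:E)%E)//; exact: integrableD.
have cE (y z : 'cV[R[i]]_n) : cdot y z = \sum_i y i 0 * (z i 0)^*.
  by rewrite /cdot dotmxE mxE; apply: eq_bigr => i _; rewrite !mxE.
rewrite !cE -sumrB.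
pose rhs i := left_limit f (beta i) * (left_limit g (beta i))^* -
   right_limit f (alpha i) * (right_limit g (alpha i))^*.
transitivity (\sum_i rhs i); last by apply: eq_bigr => i _; rewrite !mxE.
have ReE (z y : R[i]) : Re (z * y^*) = Re z * Re y + Im z * Im y by exact: Defs.ReMJ.
have ImE (z y : R[i]) : Im (z * y^*) = Im z * Re y - Re z * Im y by exact: Defs.ImMJ.
have sumRe (F : 'I_n -> R[i]) : Re (\sum_i F i) = \sum_i Re (F i).
  by elim/big_rec2: _ => // i x y _ <-; rewrite Defs.ReD.
have sumIm (F : 'I_n -> R[i]) : Im (\sum_i F i) = \sum_i Im (F i).
  by elim/big_rec2: _ => // i x y _ <-; rewrite Defs.ImD.
have mJ i : measurable (`]alpha i, beta i[ : set R) by exact: measurable_itv.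
have reC F : Re (cintegral alpha beta F) = \int[mu]_(x in D) Re (F x) by [].
have imC F : Im (cintegral alpha beta F) = \int[mu]_(x in D) Im (F x) by [].
(* The real and the imaginary part of f conj(g) each consist of two real products, hence two
   integrations by parts apiece. *)
apply: complex_eq; rewrite ?sumRe ?sumIm ?reC ?imC.
- under eq_Rintegral do rewrite mul1r Defs.ReD.
  rewrite Rintegral_Omega; last exact: iadd.
  apply: eq_bigr => i _.
  have [fr1 fi1 fr2 fi2] := cdensity_limits i fv; have [gr1 gi1 gr2 gi2] := cdensity_limits i gv.
  have [fr fi] := fv i; have [gr gi] := gv i.
  have [j1 k1] := density_integration_by_parts (alpha_lt_beta i) (integrable_re_ext w)
    (integrable_re_ext w') fr gr fr1 fr2 gr1 gr2.
  have [j2 k2] := density_integration_by_parts (alpha_lt_beta i) (integrable_im_ext w)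
    (integrable_im_ext w') fi gi fi1 fi2 gi1 gi2.
  rewrite /rhs Defs.ReD [Re (- _)](_ : _ = - Re (right_limit f (alpha i) * (right_limit g (alpha i))^*)); last first.
    by case: (_ * _).
  rewrite !ReE opprD addrACA -k1 -k2 -RintegralD//.
  by apply: eq_Rintegral => x _; rewrite /= !ReE /W/=; ring.
- under eq_Rintegral do rewrite mul1r Defs.ImD.
  rewrite Rintegral_Omega; last exact: iadd.
  apply: eq_bigr => i _.
  have [fr1 fi1 fr2 fi2] := cdensity_limits i fv; have [gr1 gi1 gr2 gi2] := cdensity_limits i gv.
  have [fr fi] := fv i; have [gr gi] := gv i.
  have [j1 k1] := density_integration_by_parts (alpha_lt_beta i) (integrable_im_ext w)
    (integrable_re_ext w') fi gr fi1 fi2 gr1 gr2.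
  have [j2 k2] := density_integration_by_parts (alpha_lt_beta i) (integrable_re_ext w)
    (integrable_im_ext w') fr gi fr1 fr2 gi1 gi2.
  rewrite /rhs Defs.ImD [Im (- _)](_ : _ = - Im (right_limit f (alpha i) * (right_limit g (alpha i))^*)); last first.
    by case: (_ * _).
  have comb (x y z t : R) : (x - y) - (z - t) = (x - z) - (y - t) by ring.
  rewrite !ImE comb -k1 -k2 -RintegralB//.
  by apply: eq_Rintegral => x _; rewrite /= !ImE /W/=; ring.
Qed.

End boundary_values.

(** * The minimal and the maximal operator *)

Section primitive_approximation.
Context (R : realType) (n : nat) (alpha beta : 'I_n -> R).
Hypothesis alpha_lt_beta : forall i, alpha i < beta i.
Hypothesis beta_lt_alpha : forall i j : 'I_n, (i < j)%N -> beta i < alpha j.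
Local Notation mu := (@lebesgue_measure R).
Local Notation D := (Omega alpha beta).
Local Notation sqint := (sqint alpha beta).
Local Notation test_fun := (test_fun alpha beta).
Implicit Types f g h : R -> R.

Let mD : measurable D := measurable_Omega alpha beta.

Lemma smooth_bounded f a b : smooth f ->
  exists2 M : R, 0 <= M & forall x, a <= x -> x <= b -> `|f x| <= M.
Proof.
move=> sf; have [ab|ba] := leP a b; last first.
  exists 0 => // x ax xb; have := lt_le_trans ba ax; by rewrite ltNge xb.
have cf : {within `[a, b], continuous (fun x => `|f x|)}.
  apply: continuous_subspaceT => x; apply: cvg_norm; exact: smooth_continuous.
have [c _ cM] := EVT_max ab cf; exists `|f c| => // x ax xb.
by apply: cM; rewrite in_itv/= ax.
Qed.

Lemma smooth_bounded_Omega f : smooth f ->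
  exists2 M : R, 0 <= M & forall x, D x -> `|f x| <= M.
Proof.
move=> sf.
have /choice[M MP] i : exists M : R, 0 <= M /\ forall x, alpha i <= x -> x <= beta i -> `|f x| <= M.
  by have [M M0 fM] := smooth_bounded (alpha i) (beta i) sf; exists M.
exists (\sum_i M i); first by apply: sumr_ge0 => i _; case: (MP i).
move=> x [i _]; rewrite /= in_itv/= => /andP[ax xb].
rewrite (bigD1 i)//= (le_trans ((MP i).2 x (ltW ax) (ltW xb)))// lerDl sumr_ge0// => j _.
by case: (MP j).
Qed.

Lemma smooth_measurable f : smooth f -> measurable_fun D f.
Proof.
move=> sf; apply: (@measurable_funS _ _ _ _ setT) => //.
exact: continuous_measurable_fun (smooth_continuous sf).
Qed.

Lemma sqint_le_bound f (K : R) : measurable_fun D f -> (forall x, D x -> `|f x| <= K) ->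
  (sqint f <= (K ^+ 2 * fine (mu D))%:E)%E.
Proof.
move=> mf fK; have Doo := lebesgue_measure_Omega alpha beta.
rewrite EFinM fineK ?ge0_fin_numE// -[leRHS]integral_cst//.
apply: ge0_le_integral => //.
- by move=> x _; rewrite lee_fin sqr_ge0.
- by apply/measurable_EFinP; exact: measurable_funX.
- move=> x Dx; rewrite lee_fin -(real_normK (num_real (f x))).
  by have := fK x Dx; have := normr_ge0 (f x); nra.
Qed.

Lemma smooth_sqint_lty f : smooth f -> (sqint f < +oo)%E.
Proof.
move=> sf; have [M M0 fM] := smooth_bounded_Omega sf.
by rewrite (le_lt_trans (sqint_le_bound (smooth_measurable sf) fM))// ltry.
Qed.

(** Integrate 2 t |f| <= f^2 + t^2 over Omega, with t chosen so that t times the measure [L] of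
    Omega is at most eta. *)
Lemma sqint_Rintegral_small (eta : R) : 0 < eta -> exists2 d : R, 0 < d &
  forall f, measurable_fun D f -> (sqint f < d%:E)%E ->
  forall E, measurable E -> E `<=` D -> `|\int[mu]_(x in E) f x| <= eta.
Proof.
move=> eta0; pose L := fine (mu D); have L0 : 0 <= L by rewrite fine_ge0.
have Doo := lebesgue_measure_Omega alpha beta.
pose t := eta / (L + 1); have t0 : 0 < t by rewrite divr_gt0// ltr_wpDl.
exists (eta * t); first by rewrite mulr_gt0.
move=> f mf fd E mE ED.
have foo : (sqint f < +oo)%E by rewrite (lt_trans fd)// ltry.
have If : mu.-integrable D (EFin \o f) by exact: sqr_integrable_integrable.
have IE : mu.-integrable E (EFin \o f) by exact: integrable_setS If.
have Isq : mu.-integrable D (EFin \o (fun x => f x ^+ 2)).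
  apply/integrableP; split; first by apply/measurable_EFinP; exact: measurable_funX.
  by under eq_integral do rewrite /= ger0_norm ?sqr_ge0//.
have In : mu.-integrable D (EFin \o (fun x => `|f x|)) by exact: integrable_abse If.
have Icst : mu.-integrable D (EFin \o (fun x => t ^+ 2)).
  apply/integrableP; split; first exact: measurable_cst.
  by rewrite integral_cst// lte_mul_pinfty// lee_fin.
have le0 : `|\int[mu]_(x in E) f x| <= \int[mu]_(x in E) `|f x| by exact: le_normr_Rintegral.
apply: (le_trans le0); clear le0.
have InE : mu.-integrable E (EFin \o (fun x => `|f x|)) by exact: integrable_abse IE.
have le1 : \int[mu]_(x in E) `|f x| <= \int[mu]_(x in D) `|f x|.
  rewrite /Rintegral fine_le//; [exact: integrable_fin_num|exact: integrable_fin_num|].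
  by apply: ge0_subset_integral => //; case/integrableP: In.
apply: (le_trans le1); clear le1.
have It : mu.-integrable D (EFin \o (fun x => (2 * t) * `|f x|)).
  by rewrite (_ : _ \o _ = fun x => ((2 * t)%:E * (`|f x|)%:E)%E)//; exact: integrableZl.
have Is : mu.-integrable D (EFin \o (fun x => f x ^+ 2 + t ^+ 2)).
  by rewrite (_ : _ \o _ = fun x => ((f x ^+ 2)%:E + (t ^+ 2)%:E)%E)//; exact: integrableD.
have : \int[mu]_(x in D) ((2 * t) * `|f x|) <= \int[mu]_(x in D) (f x ^+ 2 + t ^+ 2).
  apply: le_Rintegral => // x _; rewrite -(real_normK (num_real (f x))).
  by have := sqr_ge0 (`|f x| - t); nra.
rewrite RintegralZl// RintegralD// Rintegral_cst//.
have : \int[mu]_(x in D) f x ^+ 2 < eta * t.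
  rewrite /Rintegral -lte_fin fineK//; exact: integrable_fin_num Isq.
rewrite -/L.
move: (\int[mu]_(x in D) f x ^+ 2) (\int[mu]_(x in D) `|f x|) => S A HS HA.
have tL : t * L <= eta.
  by rewrite /t -mulrAC ler_pdivrMr ?ltr_wpDl// ler_wpM2l ?(ltW eta0)// lerDl.
have : 2 * t * A <= 2 * t * eta by nra.
by rewrite ler_pM2l// mulr_gt0.
Qed.

(** The step rises in the middle third of J_i, where 3 (x - alpha_i) / (beta_i - alpha_i) - 1 runs
    from 0 to 1. *)
Lemma smooth_inner_step i : exists (s : R -> R) (eta : R), [/\ 0 < eta, smooth s,
  forall x, x < alpha i + eta -> s x = 0, forall x, beta i - eta < x -> s x = 1 &
  forall x, `|s x| <= 1].
Proof.
have [st [sst st0 st1 stb]] := smooth_step R.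
have ab := alpha_lt_beta i; have ba0 : 0 < beta i - alpha i by rewrite subr_gt0.
pose m := 3 / (beta i - alpha i); have m0 : 0 < m by rewrite divr_gt0.
have mE : m * (beta i - alpha i) = 3 by rewrite /m mulfVK// gt_eqF.
exists (fun x => st (m * x + (- (m * alpha i) - 1))), ((beta i - alpha i) / 3); split.
- by rewrite divr_gt0.
- exact: smooth_affine.
- by move=> x xa; apply: st0; nra.
- by move=> x xb; apply: st1; nra.
- by move=> x; rewrite ger0_norm; case/andP: (stb (m * x + (- (m * alpha i) - 1))).
Qed.

Lemma smooth_sum (I : Type) (r : seq I) (c : I -> R) (f : I -> R -> R) :
  (forall i, smooth (f i)) -> smooth (fun x => \sum_(i <- r) c i * f i x) /\
  derive1 (fun x => \sum_(i <- r) c i * f i x) = fun x => \sum_(i <- r) c i * derive1 (f i) x.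
Proof.
move=> sf; elim: r => [|i r [IH IHd]].
  rewrite (_ : (fun _ => _) = cst 0); last by apply/funext => x; rewrite big_nil.
  split; last by apply/funext => x; rewrite derive1_cst big_nil.
  apply: (smooth_closed_class (S := fun f => f = cst 0)) => // _ ->; split=> [x|].
    exact: derivable_cst.
  by apply/funext => x; rewrite derive1_cst.
rewrite (_ : (fun _ => _) = fun x => c i * f i x + \sum_(j <- r) c j * f j x); last first.
  by apply/funext => x; rewrite big_cons.
split; first exact: smooth_lincomb.
apply/funext => x; rewrite big_cons; apply: derive1_is_derive.
have := is_derive_derive1 (@smooth_derivable _ _ IH x); rewrite IHd => d1.
have d2 := is_derive_derive1 (@smooth_derivable _ _ (sf i) x).
exact: is_deriveD.
Qed.

Lemma test_fun_integrable f : test_fun f -> mu.-integrable setT (EFin \o f).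
Proof.
move=> [sf [eta eta0 f0]].
rewrite (_ : f = f \_ D).
  apply: integrable_patch => //; apply: sqr_integrable_integrable => //.
    exact: smooth_measurable.
  exact: smooth_sqint_lty.
apply/funext => x; rewrite patchE; case: ifPn => // /negP Dx; apply: f0 => i.
apply/negP => /andP[ax xb]; apply: Dx; rewrite inE; exists i => //=; rewrite in_itv/=.
by apply/andP; split; lra.
Qed.

(* Phi is the primitive of phi corrected on each J_i by the integral of phi
   over J_i times a smooth step supported well inside J_i, which makes it vanish
   near both endpoints. *)
Lemma test_fun_corrected_primitive : exists2 K : R, 0 <= K &
  forall phi (c : R), test_fun phi ->
  (forall i, `|\int[mu]_(x in `]alpha i, beta i[) phi x| <= c) ->
  exists Phi, [/\ test_fun Phi, forall x, D x -> `|derive1 Phi x - phi x| <= c * K &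
   forall i x, alpha i < x -> x < beta i ->
     `|Phi x - \int[mu]_(t in `]alpha i, x]) phi t| <= c].
Proof.
have /choice[s /choice[eta sP]] := smooth_inner_step.
have s_smooth i : smooth (s i) by case: (sP i).
have /choice[M MP] i : exists M : R, 0 <= M /\ forall x, D x -> `|derive1 (s i) x| <= M.
  have [M M0 sM] := smooth_bounded_Omega (smooth_derive1 (s_smooth i)).
  by exists M.
(* This constant depends on the steps alone, so it is available before [phi] and [c] are chosen. *)
exists (\sum_i M i); first by apply: sumr_ge0 => i _; case: (MP i).
move=> phi c tphi phic; have ip := test_fun_integrable tphi.
have [sphi [e e0 phi0]] := tphi.
pose ci i := \int[mu]_(x in `]alpha i, beta i[) phi x.
pose P (x : R) : R := \int[mu]_(t in [set` Interval -oo%O (BRight x)]) phi t.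
have dP x : is_derive x (1 : R) P (phi x).
  have x1 : x < x + 1 by rewrite ltrDl.
  have ii u v : mu.-integrable [set` Interval u v] (EFin \o phi).
    by apply: integrable_setS ip => //; exact: measurable_itv.
  have cb : {for x, continuous phi} by exact: smooth_continuous.
  have [dB B'] := @continuous_FTC1 _ phi -oo%O x _ x1 (ii _ _) (ltNyr _) cb.
  by rewrite -B'; apply: is_derive_derive1.
have P' : derive1 P = phi by apply/funext => x; exact: derive1_is_derive (dP x).
have sP' : smooth P.
  by apply: smooth_primitive; [move=> x; case: (dP x)|rewrite P'].
pose S (x : R) : R := \sum_i ci i * s i x.
have [sS S'] := smooth_sum (index_enum 'I_n) ci s_smooth; rewrite -/S in sS S'.
pose Phi x := -1 * S x + P x.
have sPhi : smooth Phi by exact: smooth_lincomb.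
(* [Pi i x] is the part of the primitive that comes from J_i. It is 0 up to slightly beyond alpha_i
   and equals [ci i] from slightly before beta_i on, so subtracting [ci i * s i x] leaves a function
   supported well inside J_i. *)
pose Pi i (x : R) : R := \int[mu]_(t in `]alpha i, beta i[) (phi \_ [set` Interval -oo%O (BRight x)]) t.
have phi0D x : ~ D x -> phi x = 0.
  move=> Dx; apply: phi0 => i; apply/negP => /andP[ax xb]; apply: Dx; exists i => //=.
  by rewrite in_itv/=; apply/andP; split; lra.
have PE x : P x = \sum_i Pi i x.
  have ipx : mu.-integrable setT (EFin \o (phi \_ [set` Interval -oo%O (BRight x)] : R -> R)).
    by apply: integrable_patch; [exact: measurable_itv|apply: integrable_setS ip => //; exact: measurable_itv].
  rewrite -(Rintegral_Omega beta_lt_alpha); last exact: integrable_setS ipx.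
  rewrite /P Rintegral_mkcond [RHS]Rintegral_mkcond; congr Rintegral; apply/funext => t.
  rewrite [RHS]patchE; case: ifPn => //; rewrite notin_setE => /phi0D p0.
  by rewrite patchE p0; case: ifP.
have PhiE x : Phi x = \sum_i (Pi i x - ci i * s i x).
  by rewrite /Phi PE mulN1r addrC -sumrB.
have phi_itv i x : alpha i < x -> x < beta i -> (x < alpha i + e \/ beta i - e < x) -> phi x = 0.
  move=> ax xb xe; apply: phi0 => j; apply/negP => /andP[ajx xbj].
  have ij : i = j by apply: (Omega_itv_disjoint beta_lt_alpha ax xb); lra.
  by move: ajx xbj; rewrite -ij; case: xe; lra.
pose z i := Num.min e (eta i).
have z0 i : 0 < z i by rewrite lt_min e0; case: (sP i).
have ze i : z i <= e by rewrite ge_min lexx.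
have zeta i : z i <= eta i by rewrite ge_min lexx orbT.
have term0 i x : x < alpha i + z i \/ beta i - z i < x -> Pi i x - ci i * s i x = 0.
  have ab := alpha_lt_beta i; have [_ _ si0 si1 _] := sP i; case=> xz.
    rewrite si0; last by have := zeta i; lra.
    rewrite mulr0 subr0; transitivity (\int[mu]_(t in `]alpha i, beta i[) (0 : R)); last first.
      by rewrite /Rintegral integral0.
    apply: eq_Rintegral => t; rewrite inE/= in_itv/= => /andP[at_ tb].
    rewrite patchE; case: ifP => //; rewrite inE/= in_itv/= => tx.
    by apply: (@phi_itv i) => //; left; have := ze i; lra.
  rewrite si1; last by have := zeta i; lra.
  rewrite mulr1; apply/eqP; rewrite subr_eq0; apply/eqP.
  apply: eq_Rintegral => t; rewrite inE/= in_itv/= => /andP[at_ tb].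
  rewrite patchE; case: ifPn => //; rewrite notin_setE/= in_itv/= => /negP; rewrite -ltNge => xt.
  by apply/esym/(@phi_itv i) => //; right; have := ze i; lra.
exists Phi; split.
- split => //; exists (\big[Num.min/e]_i z i).
    by apply: lt_bigmin.
  move=> x xout; rewrite PhiE big1// => i _; apply: term0.
  have zi : \big[Num.min/e]_i z i <= z i := bigmin_le _ _ _.
  by have := xout i; rewrite negb_and -!ltNge => /orP[] H; [left|right]; lra.
- move=> x Dx; have -> : derive1 Phi x = - \sum_i ci i * derive1 (s i) x + phi x.
    apply: derive1_is_derive.
    have d1 := is_derive_derive1 (@smooth_derivable _ _ sS x); rewrite S' in d1.
    by rewrite -mulN1r; exact: is_deriveD.
  rewrite addrK normrN mulr_sumr (le_trans (ler_norm_sum _ _ _))// ler_sum// => i _.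
  by rewrite normrM ler_pM//; [exact: phic|exact: (MP i).2].
- move=> i x ax xb; rewrite PhiE (bigD1 i)//= big1 ?addr0; last first.
    move=> j ji; apply: term0.
    have := ji; rewrite neq_lt => /orP[/beta_lt_alpha H|/beta_lt_alpha H]; [right|left];
      by have := z0 j; lra.
  have -> : Pi i x = \int[mu]_(t in `]alpha i, x]) phi t.
    rewrite /Pi -Rintegral_mkcondr; congr Rintegral; apply/seteqP; split=> t /=; rewrite !in_itv/=.
      by move=> [/andP[-> _] ->].
    by move=> /andP[-> tx]; split=> //; rewrite (le_lt_trans tx).
  rewrite addrAC subrr add0r normrN normrM -[leRHS]mulr1 ler_pM//; first exact: phic.
  by case: (sP i).
Qed.

(** A test function [phi] close to g has small integral over each J_i, because g integrates to the
    difference of the endpoint limits of h, which is 0. The corrected primitive of [phi] is then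
    uniformly close to h, and its derivative is close to [phi]. *)
Lemma test_fun_approximates_primitive h g (e : R) : 0 < e ->
  mu.-integrable setT (EFin \o g) -> measurable_fun D g -> (sqint g < +oo)%E ->
  measurable_fun D h ->
  (forall i, has_density (alpha i) (beta i) h g) ->
  (forall i, h x @[x --> (alpha i)^'+] --> (0 : R)) ->
  (forall i, h x @[x --> (beta i)^'-] --> (0 : R)) ->
  exists Phi, [/\ test_fun Phi, (sqint (h \- Phi)%R < e%:E)%E &
    (sqint (g \- derive1 Phi)%R < e%:E)%E].
Proof.
move=> e0 ig mg goo mh hg h0a h0b.
have [K K0 KP] := test_fun_corrected_primitive.
pose L := fine (mu D); have L0 : 0 <= L by rewrite fine_ge0.
have KL0 : 0 <= K ^+ 2 * L by rewrite mulr_ge0// sqr_ge0.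
(* [C] dominates the coefficients of the two errors, 4 eta^2 L for h and 2 eta^2 K^2 L for the
   derivative; eta <= 1 lets one factor eta be dropped. *)
pose C := 4 * (K ^+ 2 * L) + 4 * L + 1; have C0 : 0 < C by rewrite /C; lra.
pose eta := Num.min 1 (e / C).
have eta0 : 0 < eta by rewrite lt_min ltr01 divr_gt0.
have eta1 : eta <= 1 by rewrite ge_min lexx.
have etaC : eta * C <= e by rewrite -ler_pdivlMr// ge_min lexx orbT.
have [d d0 small] := sqint_Rintegral_small eta0.
have m0 : 0 < Num.min d (e / 4) by rewrite lt_min d0 divr_gt0.
have [_ /(_ _ m0)[phi tphi gphi]] := test_approximable_square_integrable beta_lt_alpha mg goo.
have ip := test_fun_integrable tphi.
have mphi : measurable_fun D phi by case: tphi => sp _; exact: smooth_measurable.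
have gphid : (sqint (g \- phi)%R < d%:E)%E by rewrite (lt_le_trans gphi)// lee_fin ge_min lexx.
have mgp : measurable_fun D (g \- phi)%R by exact: measurable_funB.
have intB (E : set R) : measurable E -> E `<=` D ->
    `|\int[mu]_(x in E) g x - \int[mu]_(x in E) phi x| <= eta.
  move=> mE ED; rewrite -RintegralB//; [exact: small|exact: integrable_setS ig|exact: integrable_setS ip].
have lims i := density_limits (alpha_lt_beta i) ig (hg i).
have phi_le i : `|\int[mu]_(x in `]alpha i, beta i[) phi x| <= eta.
  have [la [lb [cla clb _ lab]]] := lims i.
  have E0 : \int[mu]_(x in `]alpha i, beta i[) g x = 0.
    have la0 : la = 0 by apply: cvg_unique cla (h0a i).
    have lb0 : lb = 0 by apply: cvg_unique clb (h0b i).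
    by move: lab; rewrite la0 lb0 add0r.
  have := intB `]alpha i, beta i[%classic (measurable_itv _) (@Omega_itv _ _ _ _ i).
  by rewrite E0 sub0r normrN.
have [Phi [tPhi Phi' PhiE]] := KP phi eta tphi phi_le.
have [sPhi _] := tPhi.
exists Phi; split => //.
  have hP x : D x -> `|(h \- Phi)%R x| <= 2 * eta.
    move=> [i _]; rewrite /= in_itv/= => /andP[ax xb].
    have [la [lb [cla _ -> // _]]] := lims i.
    have -> : la = 0 by apply: cvg_unique cla (h0a i).
    rewrite add0r.
    have sub : `]alpha i, x]%classic `<=` D.
      apply: subset_trans (@Omega_itv _ _ _ _ i) => t /=; rewrite !in_itv/= => /andP[-> tx].
      by rewrite (le_lt_trans tx).
    have := intB `]alpha i, x]%classic (measurable_itv _) sub.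
    have := PhiE i x ax xb; rewrite distrC.
    have tri (A B P : R) : `|B - P| <= eta -> `|A - B| <= eta -> `|A - P| <= 2 * eta.
      move=> h1 h2; rewrite (_ : A - P = (A - B) + (B - P)); last by rewrite addrA subrK.
      by rewrite (le_trans (ler_normD _ _))// mulrDl mul1r lerD.
    exact: tri.
  apply: le_lt_trans (sqint_le_bound _ hP) _.
    by apply: measurable_funB => //; exact: smooth_measurable.
  rewrite lte_fin -/L; have : eta ^+ 2 * L <= eta * L by rewrite ler_wpM2r// expr2 ger_pMl.
  by move: etaC; rewrite /C; nra.
have mP' : measurable_fun D (derive1 Phi) by apply: smooth_measurable; exact: smooth_derive1.
have -> : (g \- derive1 Phi)%R = ((g \- phi) \+ (phi \- derive1 Phi))%R.
  by apply/funext => x /=; rewrite addrA subrK.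
apply: le_lt_trans (sqintD mgp _) _; first exact: measurable_funB.
have P'le x : D x -> `|(phi \- derive1 Phi)%R x| <= eta * K.
  by move=> Dx; rewrite /= distrC; exact: Phi'.
have S2 := sqint_le_bound (measurable_funB mphi mP') P'le.
have S1 : (sqint (g \- phi)%R < (e / 4)%:E)%E.
  by rewrite (lt_le_trans gphi)// lee_fin ge_min lexx orbT.
apply: (@lt_le_trans _ _ ((2 * (e / 4))%:E + (2 * ((eta * K) ^+ 2 * L))%:E)%E).
  rewrite !EFinM; apply: lte_leD; last 2 first.
  - by rewrite lte_pmul2l.
  - by rewrite lee_pmul2l.
  by rewrite fin_numM// ge0_fin_numE ?(le_lt_trans S2)// ?ltry// integral_ge0// => x _; rewrite lee_fin sqr_ge0.
rewrite -EFinD lee_fin exprMn -mulrA.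
have : eta ^+ 2 * (K ^+ 2 * L) <= eta * (K ^+ 2 * L) by rewrite ler_wpM2r// expr2 ger_pMl.
by move: etaC; rewrite /C; nra.
Qed.

End primitive_approximation.

(* The library's Cauchy-Schwarz inequality is restricted to finite dimension. *)
Lemma cauchy_schwarz_lmod (C : numClosedFieldType) (U : lmodType C)
    (dot : {dot U for conjC}) (u v : U) :
  `|dot u v| ^+ 2 <= dot u u * dot v v.
Proof.
have [->|v0] := eqVneq v 0; first by rewrite linear0r normr0 expr0n; apply: mulr_ge0; apply: dnorm_ge0.
have V0 : 0 < dot v v by rewrite dnorm_gt0.
set V := dot v v in V0 *; set c := dot u v.
have Vc : V^* = V by apply: geC0_conj; exact: ltW.
have := dnorm_ge0 dot (u - (c / V) *: v).
have cV : (c / V)^* = c^* / V by rewrite rmorphM/= fmorphV/= Vc.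
rewrite dnormB/= dnormZ linearZr_LR/= -/V -/c !normCK cV rmorphM/=.
rewrite ?rmorphM/= ?fmorphV/= ?Vc ?conjCK.
rewrite (_ : _ - _ = dot u u - c * c^* / V); last by field; rewrite gt_eqF.
by rewrite subr_ge0 ler_pdivrMr.
Qed.

(** * Limits of inner products and closedness of adjoints *)

Section inner_product.
Context (R : realType) (H : lmodType R[i]) (dot : {dot H for conjC}).
Implicit Types (u v x y : H) (T : set (H * H)).

Lemma dot_self u : dot u u = (hnorm dot u ^+ 2)%:C%C.
Proof.
have := dnorm_ge0 dot u; rewrite lecE /= => /andP[/eqP i0 r0].
rewrite /hnorm sqr_sqrtr//; move: i0; case: (dot u u) => a b /= -> //.
Qed.

Lemma hnorm_ge0 u : 0 <= hnorm dot u.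
Proof. exact: sqrtr_ge0. Qed.

Lemma hnormN u : hnorm dot (- u) = hnorm dot u.
Proof. by rewrite /hnorm linearNl linearNr opprK. Qed.

Lemma norm_dot_le u v : `|dot u v| <= (hnorm dot u * hnorm dot v)%:C%C.
Proof.
have h0 : 0 <= (hnorm dot u * hnorm dot v)%:C%C :> R[i].
  by rewrite lecR mulr_ge0// hnorm_ge0.
have hE : (hnorm dot u * hnorm dot v)%:C%C ^+ 2 = dot u u * dot v v :> R[i].
  by rewrite !dot_self -rmorphXn -rmorphM exprMn.
rewrite -(@ler_pXn2r _ 2)// ?nnegrE// hE.
exact: cauchy_schwarz_lmod.
Qed.

(** Both sides are continuous in (x, y) by the Cauchy-Schwarz inequality, and the identity holds at
    pairs arbitrarily close to (x, y). *)
Lemma dot_eq_limit u v x y :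
  (forall e : R, 0 < e -> exists x' y', [/\ dot y' u = dot x' v,
     hnorm dot (x' - x) < e & hnorm dot (y' - y) < e]) ->
  dot y u = dot x v.
Proof.
move=> H0; apply/eqP; rewrite -subr_eq0 -normr_le0.
set c := dot y u - dot x v.
pose K := hnorm dot u + hnorm dot v + 1.
have K0 : 0 < K by rewrite /K; have := hnorm_ge0 u; have := hnorm_ge0 v; lra.
have cE : `|c| = (Num.sqrt (Re c ^+ 2 + Im c ^+ 2))%:C%C by rewrite normc_def.
rewrite cE -[0]/((0 : R)%:C%C) lecR; apply/ler_addgt0Pl => e e0; rewrite addr0.
have eK : 0 < e / K by rewrite divr_gt0.
have [x' [y' [E hx hy]]] := H0 _ eK.
rewrite -lecR -cE.
have -> : c = dot (x' - x) v - dot (y' - y) u.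
  by rewrite !linearBl /= E /c opprB; ring.
apply: (le_trans (ler_normB _ _)).
apply: (le_trans (lerD (norm_dot_le _ _) (norm_dot_le _ _))).
rewrite -rmorphD lecR.
have -> : e = e / K * K by rewrite mulfVK// gt_eqF.
have := hnorm_ge0 u; have := hnorm_ge0 v.
move: hx hy; rewrite /K; set d := e / _ => hx hy v0 u0.
rewrite !mulrDr mulr1 [X in _ <= X + _]addrC.
rewrite -[leLHS]addr0 lerD ?(ltW eK)// lerD// ler_wpM2r// ltW//.
Qed.

(** The identity defining the adjoint survives limits; it is conjugated first, to bring the
    converging pair into the left arguments as in [dot_eq_limit]. *)
Lemma adjoint_closed T : closed_operator dot (adjoint dot T).
Proof.
move=> x_ y_ x y Txy cx cy a b Tab /=.
rewrite (hermC dot b x) (hermC dot a y)/= !expr0 !mul1r; congr (_^*).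
apply/esym/dot_eq_limit => e e0.
move/cvgrPdist_lt: cx => /(_ e e0)[N _ NP]; move/cvgrPdist_lt: cy => /(_ e e0)[M _ MP].
pose k := maxn N M; exists (x_ k), (y_ k); split.
- by have := Txy k _ _ Tab; rewrite /= (hermC dot b) (hermC dot a)/= !expr0 !mul1r => /(can_inj conjCK).
- have := NP k (leq_maxl _ _); rewrite /= sub0r normrN ger0_norm ?hnorm_ge0//.
- have := MP k (leq_maxr _ _); rewrite /= sub0r normrN ger0_norm ?hnorm_ge0//.
Qed.

End inner_product.

(** * Density and closure of the minimal operator *)

Section minimal_operator.
Context (R : realType) (n : nat) (alpha beta : 'I_n -> R).
Hypothesis alpha_lt_beta : forall i, alpha i < beta i.
Hypothesis beta_lt_alpha : forall i j : 'I_n, (i < j)%N -> beta i < alpha j.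
Local Notation D := (Omega alpha beta).
Local Notation L2 := (L2 alpha beta).
Local Notation sqint := (sqint alpha beta).
Local Notation test_fun := (test_fun alpha beta).
Local Notation represents := (@represents R n alpha beta).
Local Notation graph_bv := (@graph_bv R n alpha beta).
Local Notation D0 := (momentum_on (Cc_infty alpha beta)).
Implicit Types (u v w : L2) (f g : R -> R[i]).

Let dot : {dot L2 for conjC} := @L2dot R n alpha beta.
Let mD : measurable D := measurable_Omega alpha beta.

Lemma hnorm_lt u f (e : R) : 0 < e -> represents u f ->
  measurable_fun D (Re \o f) -> measurable_fun D (Im \o f) ->
  (sqint (Re \o f) < (e ^+ 2 / 2)%:E)%E -> (sqint (Im \o f) < (e ^+ 2 / 2)%:E)%E ->
  hnorm dot u < e.
Proof.
move=> e0 fu mr mi hr hi.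
have E : Re (dot u u) = fine (sqint (Re \o f) + sqint (Im \o f)).
  rewrite [dot u u](cintegral_represents mr mi mr mi fu fu) /= /Rintegral; congr fine.
  rewrite -ge0_integralD//.
  - by apply: eq_integral => x _; rewrite Defs.ReMJ -!expr2 EFinD.
  - by move=> x _; rewrite lee_fin sqr_ge0.
  - by apply/measurable_EFinP; exact: measurable_funX.
  - by move=> x _; rewrite lee_fin sqr_ge0.
  - by apply/measurable_EFinP; exact: measurable_funX.
rewrite /hnorm -(@ltr_pXn2r _ 2)// ?nnegrE ?sqrtr_ge0 ?(ltW e0)//.
have r0 : 0 <= Re (dot u u) by have := dnorm_ge0 dot u; rewrite lecE => /andP[].
rewrite sqr_sqrtr// E.
have fin (h : R -> R) : (sqint h < (e ^+ 2 / 2)%:E)%E -> sqint h \is a fin_num.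
  move=> hh; rewrite ge0_fin_numE ?(lt_trans hh) ?ltry// integral_ge0// => x _.
  by rewrite lee_fin sqr_ge0.
rewrite fineD ?fin// [ltRHS](_ : _ = e ^+ 2 / 2 + e ^+ 2 / 2); last by rewrite -mulr2n -[RHS]mulr_natr mulfVK.
by rewrite ltrD// -lte_fin fineK// fin.
Qed.

Lemma test_fun_Cc_infty phi psi : test_fun phi -> test_fun psi ->
  Cc_infty alpha beta (fun x => Complex (phi x) (psi x)).
Proof.
move=> [sphi [d d0 phi0]] [spsi [e e0 psi0]]; split; first by move=> k x; split; [exact: sphi|exact: spsi].
pose m := Num.min d e; have m0 : 0 < m by rewrite lt_min d0.
have [md me] : m <= d /\ m <= e by rewrite !ge_min !lexx orbT.
exists (\big[setU/set0]_(i <- index_enum 'I_n) `[alpha i + m, beta i - m]%classic); split.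
- by apply: bigsetU_compact => i _; exact: segment_compact.
- rewrite -bigcup_seq => x [i _] /=; rewrite in_itv/= => /andP[ax xb].
  by apply: (@Omega_in _ _ _ _ i); lra.
- rewrite -bigcup_seq => x out.
  have {}out i : ~~ (alpha i + m <= x <= beta i - m).
    by apply/negP => H; apply: out; exists i; rewrite /= ?mem_index_enum// in_itv.
  rewrite phi0 ?psi0// => i; apply: contra (out i) => /andP[ax xb]; apply/andP; split; lra.
Qed.

Lemma test_fun_momentum phi psi : test_fun phi -> test_fun psi -> exists x y,
  [/\ D0 (x, y), represents x (fun t => Complex (phi t) (psi t)) &
      represents (kappa R *: y) (fun t => Complex (derive1 phi t) (derive1 psi t))].
Proof.
move=> tphi tpsi; pose f t : R[i] := Complex (phi t) (psi t).
have si (a b : R -> R) : smooth a -> smooth b -> square_integrable alpha beta (fun t => Complex (a t) (b t)).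
  move=> sa sb.
  have [M M0 aM] := smooth_bounded_Omega alpha beta sa; have [N N0 bN] := smooth_bounded_Omega alpha beta sb.
  apply: (bounded_square_integrable (M := M ^+ 2 + N ^+ 2)).
  - exact: smooth_measurable sa.
  - exact: smooth_measurable sb.
  - move=> x Dx; rewrite /normc2/= -(real_normK (num_real (a x))) -(real_normK (num_real (b x))).
    by rewrite lerD// lerXn2r ?nnegrE//; [exact: aM|exact: bN].
have [[sphi _] [spsi _]] := (tphi, tpsi).
have [x xf] := square_integrable_represents (si _ _ sphi spsi).
have [w wf] := square_integrable_represents (si _ _ (smooth_derive1 sphi) (smooth_derive1 spsi)).
have kE : kappa R *: ((kappa R)^-1 *: w) = w by rewrite scalerA mulfV ?scale1r// kappa_neq0.
exists x, ((kappa R)^-1 *: w); rewrite kE; split=> //.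
exists f; split=> //; first exact: test_fun_Cc_infty.
by apply/represents_momentum; rewrite kE.
Qed.

Lemma Cc_infty_dense : densely_defined dot D0.
Proof.
move=> u e e0; have [mr mi oor ooi] := repr_sqint u.
have e2 : 0 < e ^+ 2 / 2 by rewrite divr_gt0// exprn_gt0.
have [_ /(_ _ e2)[phi tphi hphi]] := test_approximable_square_integrable beta_lt_alpha mr oor.
have [_ /(_ _ e2)[psi tpsi hpsi]] := test_approximable_square_integrable beta_lt_alpha mi ooi.
have [x [y [xy xf yf]]] := test_fun_momentum tphi tpsi.
exists x; first by exists y.
rewrite -(hnormN dot) opprB.
have [[sphi _] [spsi _]] := (tphi, tpsi).
have rep := represents_lincomb (-1) xf (represents_repr u); rewrite scaleN1r in rep.
rewrite addrC.
have Er : Re \o (fun t => -1 * Complex (phi t) (psi t) + repr u t) = ((Re \o repr u) \- phi)%R.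
  by apply/funext => t /=; rewrite mulN1r Defs.ReD/= addrC.
have Ei : Im \o (fun t => -1 * Complex (phi t) (psi t) + repr u t) = ((Im \o repr u) \- psi)%R.
  by apply/funext => t /=; rewrite mulN1r Defs.ImD/= addrC.
apply: (hnorm_lt e0 rep); rewrite ?Er ?Ei//; apply: measurable_funB => //; exact: smooth_measurable.
Qed.

(** The factor has modulus 2 pi >= 1. Approximating the derivative, that is [kappa *: v], thus
    approximates [v]. *)
Lemma hnorm_le_kappa u : hnorm dot u <= hnorm dot (kappa R *: u).
Proof.
rewrite /hnorm ler_wsqrtr// dnormZ [X in X * _](_ : _ = (4 * pi ^+ 2)%:C%C); last first.
  rewrite normCK /kappa !rmorphM/= conjCi.
  apply: complex_eq; rewrite !(Defs.ReM, Defs.ImM)/=; ring.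
rewrite Defs.ReM /= mul0r subr0.
have r0 : 0 <= Re (dot u u) by have := dnorm_ge0 dot u; rewrite lecE => /andP[].
rewrite ler_peMl//; have := @pi_ge2 R; move: (pi : R) => p; nra.
Qed.

(** The real and imaginary parts of f are approximated separately, each simultaneously with its
    derivative. *)
Lemma graph_bv0_approx u v : graph_bv u v 0 0 -> forall e : R, 0 < e ->
  exists x y, [/\ D0 (x, y), hnorm dot (x - u) < e & hnorm dot (y - v) < e].
Proof.
move=> [f [fu fv f0 f1]] e e0; set w := kappa R *: v in fv.
have e2 : 0 < e ^+ 2 / 2 by rewrite divr_gt0// exprn_gt0.
have [mfr mfi] := cdensity_measurable fv.
have [mwr mwi oor ooi] := repr_sqint w.
have lims i := cdensity_limits alpha_lt_beta i fv.
have fa i : right_limit f (alpha i) = 0 by have := congr1 (fun z : 'cV__ => z i 0) f0; rewrite !mxE.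
have fb i : left_limit f (beta i) = 0 by have := congr1 (fun z : 'cV__ => z i 0) f1; rewrite !mxE.
have mr : measurable_fun D (re_ext w).
  by apply: (@measurable_funS _ _ _ _ setT) => //; apply/measurable_EFinP; exact: measurable_int (integrable_re_ext w).
have mi : measurable_fun D (im_ext w).
  by apply: (@measurable_funS _ _ _ _ setT) => //; apply/measurable_EFinP; exact: measurable_int (integrable_im_ext w).
have oor' : (sqint (re_ext w) < +oo)%E by rewrite (@eq_sqint _ _ _ _ _ (Re \o repr w))// => x Dx; exact: re_extE.
have ooi' : (sqint (im_ext w) < +oo)%E by rewrite (@eq_sqint _ _ _ _ _ (Im \o repr w))// => x Dx; exact: im_extE.
(* The [eq_ind] terms rewrite the limits of f at the endpoints, known to exist, into the limits 0
   that are required. *)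
have [phi [tphi p1 p2]] := test_fun_approximates_primitive alpha_lt_beta beta_lt_alpha e2
  (integrable_re_ext w) mr oor' mfr (fun i => (fv i).1)
  (fun i => let: And4 h _ _ _ := lims i in eq_ind _ (fun z => _ --> Re z) h _ (fa i))
  (fun i => let: And4 _ _ h _ := lims i in eq_ind _ (fun z => _ --> Re z) h _ (fb i)).
have [psi [tpsi q1 q2]] := test_fun_approximates_primitive alpha_lt_beta beta_lt_alpha e2
  (integrable_im_ext w) mi ooi' mfi (fun i => (fv i).2)
  (fun i => let: And4 _ h _ _ := lims i in eq_ind _ (fun z => _ --> Im z) h _ (fa i))
  (fun i => let: And4 _ _ _ h := lims i in eq_ind _ (fun z => _ --> Im z) h _ (fb i)).
have [x [y [xy xf yf]]] := test_fun_momentum tphi tpsi.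
have [[sphi _] [spsi _]] := (tphi, tpsi).
exists x, y; split=> //.
- rewrite -(hnormN dot) opprB addrC -scaleN1r.
  have rep := represents_lincomb (-1) xf fu.
  have Er : Re \o (fun t => -1 * Complex (phi t) (psi t) + f t) = ((Re \o f) \- phi)%R.
    by apply/funext => t /=; rewrite mulN1r Defs.ReD/= addrC.
  have Ei : Im \o (fun t => -1 * Complex (phi t) (psi t) + f t) = ((Im \o f) \- psi)%R.
    by apply/funext => t /=; rewrite mulN1r Defs.ImD/= addrC.
  by apply: (hnorm_lt e0 rep); rewrite ?Er ?Ei//; apply: measurable_funB => //; exact: smooth_measurable.
- apply: le_lt_trans (hnorm_le_kappa _) _; rewrite scalerBr -/w.
  rewrite -(hnormN dot) opprB addrC -scaleN1r.
  have rep := represents_lincomb (-1) yf (represents_repr w).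
  have {}rep : represents (-1 *: (kappa R *: y) + w)
      (fun t => Complex (re_ext w t - derive1 phi t) (im_ext w t - derive1 psi t)).
    apply: represents_eq rep => t Dt; rewrite re_extE// im_extE// mulN1r.
    by apply: complex_eq; rewrite ?Defs.ReD ?Defs.ImD/= addrC.
  apply: (hnorm_lt e0 rep).
  + by apply: (measurable_funB mr); apply: smooth_measurable; exact: smooth_derive1.
  + by apply: (measurable_funB mi); apply: smooth_measurable; exact: smooth_derive1.
  + exact: p2.
  + exact: q2.
Qed.

End minimal_operator.

(** * The adjoint of the minimal operator *)

Section maximal_operator.
Context (R : realType) (n : nat) (alpha beta : 'I_n -> R).
Hypothesis alpha_lt_beta : forall i, alpha i < beta i.
Hypothesis beta_lt_alpha : forall i j : 'I_n, (i < j)%N -> beta i < alpha j.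
Local Notation mu := (@lebesgue_measure R).
Local Notation D := (Omega alpha beta).
Local Notation L2 := (L2 alpha beta).
Local Notation represents := (@represents R n alpha beta).
Local Notation graph_bv := (@graph_bv R n alpha beta).
Local Notation D0 := (momentum_on (Cc_infty alpha beta)).
Implicit Types (u v w : L2) (f g : R -> R[i]) (p q : 'cV[R[i]]_n).

Let dot : {dot L2 for conjC} := @L2dot R n alpha beta.

Lemma smooth_ac a b (h : R -> R) : smooth h -> ac a b h.
Proof.
move=> sh e e0; have [M M0 hM] := smooth_bounded a b (smooth_derive1 sh).
have M1 : 0 < M + 1 by lra.
exists (e / (M + 1)); first by rewrite divr_gt0.
move=> m s t st _ std.
have lip k : `|h (t k) - h (s k)| <= M * (t k - s k).
  have [ask stk tkb] := st k.
  have [||c] := @MVT_segment R h (derive1 h) (s k) (t k) (ltW stk).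
  - by move=> x _; apply: is_derive_derive1; exact: (@smooth_derivable _ _ sh).
  - by apply: continuous_subspaceT => x; exact: smooth_continuous.
  rewrite in_itv/= => /andP[sc ct] ->.
  rewrite normrM (ger0_norm (x := t k - s k)) ?subr_ge0 ?(ltW stk)// ler_wpM2r ?subr_ge0 ?(ltW stk)//.
  by apply: hM; lra.
apply: le_lt_trans (ler_sum _ (fun k _ => lip k)) _.
rewrite -mulr_sumr; move: std; rewrite ltr_pdivlMr//.
have : 0 <= \sum_k (t k - s k) by apply: sumr_ge0 => k _; have [_ stk _] := st k; rewrite subr_ge0 ltW.
by move: (\sum_k _) => S; nra.
Qed.

Lemma endpoint_notin_Omega i : ~ D (alpha i) /\ ~ D (beta i).
Proof.
split=> -[j _]; rewrite /= in_itv/= => /andP[h1 h2]; case: (ltngtP i j) => [/beta_lt_alpha|/beta_lt_alpha|/val_inj E];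
  have := alpha_lt_beta i; have := alpha_lt_beta j; rewrite -?E in h1 h2 *; lra.
Qed.

(** The endpoints lie outside the compact support, so f vanishes near them. *)
Lemma minimal_graph_bv u v : D0 (u, v) -> graph_bv u v 0 0.
Proof.
move=> [f [[sf [K [cK KD fK]]] /= uf /represents_momentum vf]].
have sr : smooth (Re \o f) by move=> k x; case: (sf k x).
have si : smooth (Im \o f) by move=> k x; case: (sf k x).
have near0 (z : R) (F : set_system R) : Filter F -> F --> z -> ~ D z -> \forall x \near F, f x = 0.
  move=> FF Fz Dz; apply: filterS (fun x => fK x) _; apply: Fz.
  apply: (@open_nbhs_nbhs R z (~` K)); split; first by rewrite openC; exact: compact_closed.
  by move=> /KD.
have lim0 (z : R) (F : set_system R) : ProperFilter F -> F --> z -> ~ D z ->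
    Complex (lim (Re (f x) @[x --> F])) (lim (Im (f x) @[x --> F])) = 0.
  move=> FF Fz /(near0 z F _ Fz) h; apply: complex_eq => /=; apply: lim_of_cvg;
    apply: cvg_near_cst; apply: filterS h => x ->//.
exists f; split=> //.
- apply: ac_cdensity vf => i; apply/abs_continuous_ReIm; split; exact: smooth_ac.
- apply/matrixP => i j; rewrite !mxE; apply: (lim0 (alpha i)); last by have [] := endpoint_notin_Omega i.
  exact: cvg_within.
- apply/matrixP => i j; rewrite !mxE; apply: (lim0 (beta i)); last by have [] := endpoint_notin_Omega i.
  exact: cvg_within.
Qed.

Lemma itv_integral0 i : itv_integral i (0 : L2) = 0.
Proof. by have := itv_integral_lincomb i (-1) (0 : L2) 0; rewrite scaler0 addr0 mulN1r addNr. Qed.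

(** These are the elements of the kernel of the maximal operator: [s] has the constant value p_i on
    J_i. *)
Lemma locally_constant_exists p : exists s, graph_bv s 0 p p.
Proof.
have [s sp] := graph_bv_exists alpha_lt_beta beta_lt_alpha (0 : L2) p; exists s.
move: sp; congr (graph_bv _ _ _ _); apply/matrixP => i j.
by rewrite !mxE scaler0 itv_integral0 addr0 [j]ord1.
Qed.

Lemma cdot_sum p q : cdot p q = \sum_i p i 0 * (q i 0)^*.
Proof. by rewrite /cdot dotmxE mxE; apply: eq_bigr => i _; rewrite !mxE. Qed.

(* Green's identity for a primitive of y and a locally constant function. *)
Lemma L2dot_locally_constant y s p : graph_bv s 0 p p ->
  L2dot y s = cdot (\col_i itv_integral i y) p.
Proof.
move=> sp; pose v := (kappa R)^-1 *: y.
have [z zv] := graph_bv_exists alpha_lt_beta beta_lt_alpha v 0.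
have := green_formula alpha_lt_beta beta_lt_alpha zv sp.
have kv : kappa R *: v = y by rewrite scalerA mulfV ?scale1r// kappa_neq0.
rewrite kv (_ : L2dot z 0 = 0); last by rewrite L2dotC L2dot0l rmorph0 mulr0.
rewrite subr0 {1}/v L2dotZl => /(mulfI (invr_neq0 (kappa_neq0 R))) ->.
rewrite !cdot_sum [X in _ - X]big1 ?subr0; last by move=> i _; rewrite mxE mul0r.
by apply: eq_bigr => i _; rewrite !mxE add0r.
Qed.

Lemma itv_integral_locally_constant i s p : graph_bv s 0 p p ->
  itv_integral i s = p i 0 * (beta i - alpha i)%:C%C.
Proof.
move=> [f [fs f0 fp _]]; rewrite scaler0 in f0; have ab := alpha_lt_beta i.
have [fr fi] := f0 i.
have lims := cdensity_limits alpha_lt_beta i f0.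
have z0 (E : set R) : measurable E -> \int[mu]_(x in E) re_ext (0 : L2) x = 0 /\
    \int[mu]_(x in E) im_ext (0 : L2) x = 0.
  move=> mE; have h0 : represents (0 : L2) (fun=> 0).
    by have := represents_scale 0 (represents_repr (0 : L2)); rewrite scale0r; apply: represents_eq => x _; rewrite mul0r.
  have h1 : {ae mu, forall x, E x -> re_ext (0 : L2) x = 0 /\ im_ext (0 : L2) x = 0}.
    apply: ae_imply (re_ext_represents h0) => x H _.
    have [/set_mem/H//|Dx] := boolP (x \in D).
    by rewrite /re_ext /im_ext !patchE (negbTE Dx).
  have i0 : mu.-integrable E (EFin \o (cst 0 : R -> R)) by exact: integrable0.
  have r0 : \int[mu]_(x in E) (cst 0 : R -> R) x = 0 by rewrite /Rintegral integral0.
  split; rewrite -[RHS]r0; apply: ae_eq_Rintegral => //.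
  - by apply: integrable_setS (integrable_re_ext _).
  - by apply: ae_imply h1 => x H /H[].
  - by apply: integrable_setS (integrable_im_ext _).
  - by apply: ae_imply h1 => x H /H[].
have fE x : alpha i < x -> x < beta i -> f x = p i 0.
  move=> ax xb.
  have [la [lb [cla _ hla _]]] := density_limits ab (integrable_re_ext _) fr.
  have [ka [kb [cka _ hka _]]] := density_limits ab (integrable_im_ext _) fi.
  have [z1 z2] := z0 `]alpha i, x]%classic (measurable_itv _).
  rewrite -fp mxE; apply: complex_eq.
    by have := hla x ax xb; rewrite z1 addr0 => /= ->; apply/esym/lim_of_cvg.
  by have := hka x ax xb; rewrite z2 addr0 => /= ->; apply/esym/lim_of_cvg.
have mJ : measurable (`]alpha i, beta i[ : set R) by exact: measurable_itv.
have mJE : mu `]alpha i, beta i[%classic = (beta i - alpha i)%:E.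
  by rewrite lebesgue_measure_itv/= lte_fin ab -EFinB.
have cstE (c : R) : \int[mu]_(x in `]alpha i, beta i[) (cst c : R -> R) x = c * (beta i - alpha i).
  by rewrite Rintegral_cst//; congr (_ * _); rewrite [X in fine X]mJE.
have icst (c : R) : mu.-integrable `]alpha i, beta i[ (EFin \o (cst c : R -> R)).
  apply/integrableP; split; first by apply/measurable_EFinP; exact: measurable_cst.
  by rewrite /= integral_cst// [X in (_ * X)%E]mJE -EFinM ltry.
apply: complex_eq; rewrite ?Defs.ReM ?Defs.ImM /= mulr0 ?subr0 ?add0r -cstE; apply: ae_eq_Rintegral => //.
- by apply: integrable_setS (integrable_re_ext s).
- apply: ae_imply (re_ext_represents fs) => x H; rewrite /= in_itv/= => /andP[ax xb].
  by have [-> _] := H (Omega_in ax xb); rewrite fE.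
- by apply: integrable_setS (integrable_im_ext s).
- apply: ae_imply (re_ext_represents fs) => x H; rewrite /= in_itv/= => /andP[ax xb].
  by have [_ ->] := H (Omega_in ax xb); rewrite fE.
Qed.

Lemma locally_constant_itv_integral p : exists s q, graph_bv s 0 q q /\
  forall i, itv_integral i s = p i 0.
Proof.
pose q : 'cV[R[i]]_n := \col_i (p i 0 / (beta i - alpha i)%:C%C).
have [s sq] := locally_constant_exists q; exists s, q; split=> // i.
rewrite (itv_integral_locally_constant i sq) mxE divfK//.
by rewrite eq_complex /= eqxx andbT subr_eq0 gt_eqF.
Qed.

Lemma kappaVK u : kappa R *: ((kappa R)^-1 *: u) = u.
Proof. by rewrite scalerA mulfV ?scale1r// kappa_neq0. Qed.

(** Realised by a function affine on each J_i: its derivative is the locally constant function with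
    integrals q_i - p_i. *)
Lemma graph_bv_surjective p q : exists u v, graph_bv u v p q.
Proof.
have [s [c [sc sE]]] := locally_constant_itv_integral (q - p).
have [u uP] := graph_bv_exists alpha_lt_beta beta_lt_alpha ((kappa R)^-1 *: s) p.
exists u, ((kappa R)^-1 *: s); move: uP; congr (graph_bv _ _ _ _); apply/matrixP => i j.
rewrite mxE kappaVK sE !mxE [j]ord1.
by rewrite addrCA subrr addr0.
Qed.

(* u differs from a primitive u0 of 2 pi i v by a function orthogonal to every y
   with zero mean on each interval, hence by a locally constant function. *)
Lemma adjoint_minimal u v : adjoint dot D0 (u, v) -> exists p q, graph_bv u v p q.
Proof.
move=> uv.
(* By approximation in the graph norm, the defining identity extends from test functions to all
   functions with zero boundary values. *)
have {}uv x y : graph_bv x y 0 0 -> dot y u = dot x v.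
  move=> xy0; apply: dot_eq_limit => e e0.
  have [x' [y' [D0' h1 h2]]] := graph_bv0_approx alpha_lt_beta beta_lt_alpha xy0 e0.
  by exists x', y'; split=> //; exact: (uv x' y' D0').
have [u0 u0v] := graph_bv_exists alpha_lt_beta beta_lt_alpha v 0.
have orth x y : graph_bv x y 0 0 -> dot y (u - u0) = 0.
  move=> xy; rewrite linearBr /= (uv x y xy).
  have := green_formula alpha_lt_beta beta_lt_alpha xy u0v.
  rewrite !cdot_sum !big1 ?subrr ?mulr0; last 2 first.
  - by move=> i _; rewrite !mxE mul0r.
  - by move=> i _; rewrite !mxE mul0r.
  by move/eqP; rewrite subr_eq0 => /eqP ->; rewrite subrr.
have [s [c [sc sE]]] := locally_constant_itv_integral (\col_i itv_integral i (u - u0)).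
(* [s] has the same integrals as [u - u0], so [y] has mean zero on each J_i and is, up to a factor,
   the image of some x with zero boundary values. It is then orthogonal to [u - u0] and to [s],
   hence to itself. *)
pose y := (u - u0) - s.
have y0 i : itv_integral i y = 0.
  rewrite /y addrC -scaleN1r itv_integral_lincomb sE mxE mulN1r addNr//.
have [x xy] : exists x, graph_bv x ((kappa R)^-1 *: y) 0 0.
  have [x xP] := graph_bv_exists alpha_lt_beta beta_lt_alpha ((kappa R)^-1 *: y) 0.
  exists x; move: xP; congr (graph_bv _ _ _ _); apply/matrixP => i j.
  by rewrite mxE kappaVK y0 !mxE addr0.
have yu : dot y (u - u0) = 0.
  have := orth _ _ xy; rewrite [dot _ _]L2dotZl => /eqP.
  by rewrite mulf_eq0 invr_eq0 (negbTE (kappa_neq0 R)) => /eqP.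
have ys : dot y s = 0.
  rewrite [dot _ _](L2dot_locally_constant y sc) cdot_sum big1// => i _.
  by rewrite mxE y0 mul0r.
have : dot y y = 0 by rewrite {2}/y linearBr/= yu ys subrr.
move/eqP; rewrite dnorm_eq0 subr_eq0 => /eqP us.
have := graph_bv_lincomb alpha_lt_beta 1 sc u0v.
by rewrite scaler0 add0r scale1r -us subrK => uvP; eexists; eexists; exact: uvP.
Qed.

(** Translates the domains of the theorem, [Dmax] with a condition Q on boundary values, into
    [graph_bv]. *)
Lemma momentum_on_graph_bv (Q : 'cV[R[i]]_n -> 'cV[R[i]]_n -> Prop) u v :
  momentum_on [set f | Dmax alpha beta f /\ Q (at_alpha alpha f) (at_beta beta f)] (u, v) <->
  exists p q, graph_bv u v p q /\ Q p q.
Proof.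
split=> [[f [[[acf _] Qf] /= uf /represents_momentum vf]]|[p [q [[f [uf fv <- <-]] Qf]]]].
  by exists (at_alpha alpha f), (at_beta beta f); split=> //; exists f; split=> //; exact: ac_cdensity.
have [acf vf] := cdensity_ac fv; exists f; split=> //=; last exact/represents_momentum.
by split=> //; split=> //; exists (kappa R *: v).
Qed.

End maximal_operator.

(** * Partial isometries and extensions *)

Section column_vectors.
Context (C : numClosedFieldType) (n : nat).
Implicit Types (x y v w p q : 'cV[C]_n) (A B : 'M[C]_n) (V : {vspace 'cV[C]_n}).

(* [cdot] is the instance C := R[i], up to conversion. *)
Definition dotc x y : C := dotmx x^T y^T.

Lemma dotcE x y : dotc x y = (x^T *m map_mx conjC y) 0 0.
Proof. by rewrite /dotc dotmxE trmxK. Qed.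

Let dotc_linearl v : linear_for *%R (dotc^~ v).
Proof. by move=> a x y; rewrite /dotc linearP/= linearPl. Qed.

Let dotc_linearr v : linear_for (conjC \; *%R) (dotc v).
Proof. by move=> a x y; rewrite /dotc linearP/= linearPr. Qed.

HB.instance Definition _ := bilinear_isBilinear.Build C 'cV[C]_n 'cV[C]_n C
  *%R (conjC \; *%R) dotc (dotc_linearl, dotc_linearr).

Let dotcC x y : dotc x y = (-1) ^+ false * (dotc y x)^*.
Proof. by rewrite /dotc hermC. Qed.

HB.instance Definition _ := isHermitianSesquilinear.Build C 'cV[C]_n
  false conjC dotc dotcC.

Let dotc_gt0 x : x != 0 -> 0 < dotc x x.
Proof. by move=> x0; rewrite dnorm_gt0 -(inj_eq trmx_inj) trmx0 in x0 *. Qed.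

HB.instance Definition _ := isDotProduct.Build C 'cV[C]_n dotc dotc_gt0.

Let form : {dot 'cV[C]_n for conjC} := dotc.

Lemma dotc_adjoint B x y : dotc (B^t* *m x) y = dotc x (B *m y).
Proof.
have BE : (B^t*)^T = map_mx conjC B by rewrite -map_trmx trmxK.
by rewrite !dotcE trmx_mul BE map_mxM mulmxA.
Qed.

Lemma dotc0l x : dotc 0 x = 0.
Proof. exact: linear0l. Qed.

Lemma dotcBl x y z : dotc (x - y) z = dotc x z - dotc y z.
Proof. exact: linearBl. Qed.

Lemma dotcBr x y z : dotc x (y - z) = dotc x y - dotc x z.
Proof. exact: linearBr. Qed.

Lemma dotc_sym x y : dotc x y = (dotc y x)^*.
Proof. by rewrite dotcC expr0 mul1r. Qed.

Lemma dotc_nondegenerate x : (forall y, dotc x y = 0) -> x = 0.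
Proof. by move=> /(_ x)/eqP; rewrite [_ == _](dnorm_eq0 form) => /eqP. Qed.

Lemma dotc_nondegenerate_in V x : x \in V -> (forall w, w \in V -> dotc x w = 0) -> x = 0.
Proof. by move=> xV /(_ x xV)/eqP; rewrite [_ == _](dnorm_eq0 form) => /eqP. Qed.

Lemma orthogonal_projection V x : exists2 y, y \in V & forall w, w \in V -> dotc (x - y) w = 0.
Proof.
have [y] := orthogonal_split form (vbasis V) x.
rewrite (span_basis (vbasisP V)) => yV [z [-> _ zV]]; exists y => // w.
rewrite addrC addKr -{1}(span_basis (vbasisP V)) => wV.
by apply: (span_orthogonal zV) => //; exact: memv_span1.
Qed.

Lemma orthogonal_complementK V x :
  (forall z, (forall w, w \in V -> dotc z w = 0) -> dotc z x = 0) -> x \in V.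
Proof.
move=> xV; have [y yV xy] := orthogonal_projection V x.
have E : dotc (x - y) (x - y) = 0 by rewrite linearBr/= (xV _ xy) (xy _ yV) subrr.
by move/eqP: E; rewrite [_ == _](dnorm_eq0 form) subr_eq0 => /eqP ->.
Qed.

(** The condition of the adjoint domain says that the boundary form of Green's identity vanishes
    between (p, q) and every pair (p', B p') with p' in V. *)
Lemma adjointP B V p q : (forall p', p' \in V -> dotc (B *m p') q = dotc p' p) <->
  (forall w, w \in V -> dotc (B^t* *m q - p) w = 0).
Proof.
split=> H w wV.
  by rewrite dotcBl dotc_adjoint dotc_sym (H w wV) (dotc_sym p) subrr.
have := H w wV; rewrite dotcBl dotc_adjoint => /eqP; rewrite subr_eq0 => /eqP E.
by rewrite dotc_sym E -dotc_sym.
Qed.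

(** In the space of boundary pairs, the graph of B over V equals its biadjoint. The pairs (z, 0)
    with z orthogonal to V force p into V, and the pairs (B' y, y), with B' the adjoint matrix,
    force B p = q. *)
Lemma biadjointP B V p q : (forall p' q',
    (forall w, w \in V -> dotc (B^t* *m q' - p') w = 0) -> dotc q' q = dotc p' p) <->
  p \in V /\ B *m p = q.
Proof.
split=> [H|[pV <-] p' q' H]; last first.
  by rewrite -dotc_adjoint; apply/eqP; rewrite -subr_eq0 -dotcBl H.
split.
  apply: orthogonal_complementK => z zV; rewrite -(H z 0) ?dotc0l// => w wV.
  by rewrite mulmx0 dotcBl dotc0l zV// subrr.
apply/eqP; rewrite -subr_eq0; apply/eqP; apply: dotc_nondegenerate => y.
by rewrite dotc_sym dotcBr -dotc_adjoint (H (B^t* *m y) y) ?subrr ?rmorph0// => w _; exact: dotc0l.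
Qed.

(** A subspace of maximal dimension inside S contains every x in S, for otherwise adding the line of
    x would enlarge it within S. *)
Lemma linear_set_vspace (S : 'cV[C]_n -> Prop) : S 0 ->
  (forall a x y, S x -> S y -> S (a *: x + y)) -> exists V, forall x, x \in V <-> S x.
Proof.
move=> S0 SP; pose P k := `[< exists V, \dim V = k /\ forall x, x \in V -> S x >].
have exP : exists k, P k.
  exists 0%N; apply/asboolP; exists 0%VS; rewrite dimv0; split=> // x.
  by rewrite memv0 => /eqP ->.
have ubP k : P k -> (k <= \dim {: 'cV[C]_n})%N.
  by move=> /asboolP[V [<- _]]; apply: dimvS; exact: subvf.
case: (ex_maxnP exP ubP) => k /asboolP[V [dV VS]] maxk; exists V => x; split; first exact: VS.
move=> Sx; have : P (\dim (<[x]> + V)%VS).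
  apply/asboolP; exists (<[x]> + V)%VS; split=> // y /memv_addP[_ /vlineP[a ->] [z zV ->]].
  exact: SP (VS _ zV).
move/maxk; rewrite -dV => dle.
have /eqP <- : (<[x]> + V == V)%VS by rewrite eq_sym eqEdim addvSr.
by rewrite memvE addvSl.
Qed.

(** Expanding the norm of v + w yields the real part of the inner product, and replacing w by i w
    the imaginary part. *)
Lemma polarization V B : (forall v, v \in V -> dotc (B *m v) (B *m v) = dotc v v) ->
  forall v w, v \in V -> w \in V -> dotc (B *m v) (B *m w) = dotc v w.
Proof.
move=> isoB v w vV wV.
have re u : u \in V -> dotc (B *m v) (B *m u) + (dotc (B *m v) (B *m u))^* =
    dotc v u + (dotc v u)^*.
  move=> uV; have := isoB (v + u); rewrite memvD// mulmxDr => /(_ isT).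
  have := dnormD form (B *m v) (B *m u); rewrite /form/= => ->.
  have := dnormD form v u; rewrite /form/= => ->.
  by rewrite !isoB// => /addrI.
have r1 := re w wV; have := re ('i *: w) (memvZ _ wV).
rewrite -scalemxAr !linearZr_LR/= !rmorphM/= conjCK conjCi !mulNr => r2.
have {}r2 : (dotc (B *m v) (B *m w) - (dotc (B *m v) (B *m w))^*) = dotc v w - (dotc v w)^*.
  apply: (mulfI (neq0Ci C)); rewrite !mulrBr; apply: oppr_inj.
  by rewrite !opprB addrC r2 addrC.
have two0 : (2 : C) != 0 by rewrite pnatr_eq0.
have s (z : C) : 2 * z = (z + z^*) + (z - z^*) by ring.
by apply: (mulfI two0); rewrite !s r1 r2.
Qed.

Lemma unitarymx_isometry B : B \is unitarymx <-> forall v, B^t* *m (B *m v) = v.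
Proof.
split=> [/unitarymxP BB v|BB].
  by rewrite mulmxA (mulmx1C BB) mul1mx.
apply/unitarymxP/mulmx1C; apply/trmx_inj/row_matrixP => i.
by rewrite -!tr_col !colE -mulmxA BB mul1mx.
Qed.

(** A vector orthogonal to V is killed by B, hence is 0 when B is unitary; conversely, polarization
    makes an isometry of the whole space unitary. *)
Lemma partial_isometry_unitarymx V B :
  (forall v, v \in V -> dotc (B *m v) (B *m v) = dotc v v) ->
  (forall v, (forall w, w \in V -> dotc v w = 0) -> B *m v = 0) ->
  B \is unitarymx <-> V = fullv.
Proof.
move=> iso BV; rewrite unitarymx_isometry; split=> [BB|VE].
  apply/vspaceP => x; rewrite memvf; apply: orthogonal_complementK => z /BV Bz.
  by rewrite -(BB z) Bz mulmx0 dotc0l.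
move=> v; apply/eqP; rewrite -subr_eq0; apply/eqP; apply: dotc_nondegenerate => w.
by rewrite dotcBl dotc_adjoint (polarization iso) ?VE ?memvf// subrr.
Qed.

Lemma adjoint_condition0 V B p : (forall w, w \in V -> dotc p w = 0) ->
  forall w, w \in V -> dotc (B^t* *m 0 - p) w = 0.
Proof. by move=> pV w wV; rewrite mulmx0 dotcBl dotc0l pV// subrr. Qed.

Lemma unitarymx_adjoint_condition B p q : B \is unitarymx ->
  (forall w, w \in fullv -> dotc (B^t* *m q - p) w = 0) <-> p \in fullv /\ B *m p = q.
Proof.
move=> BU; have BB := (unitarymx_isometry B).1 BU; have /unitarymxP BB' := BU.
split=> [H|[_ <-] w _]; last by rewrite BB subrr dotc0l.
split; first exact: memvf.
suff -> : p = B^t* *m q by rewrite mulmxA BB' mul1mx.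
apply/eqP; rewrite eq_sym -subr_eq0; apply/eqP; apply: dotc_nondegenerate => w.
exact/H/memvf.
Qed.

Lemma unitarymx_limg B : B \is unitarymx -> (linfun (mulmx B) @: {: 'cV[C]_n})%VS = fullv.
Proof.
move=> /unitarymxP BB; apply/vspaceP => x; rewrite memvf.
have -> : x = linfun (mulmx B) (B^t* *m x) by rewrite lfunE/= mulmxA BB mul1mx.
by rewrite memv_img// memvf.
Qed.

Lemma linear_function_mx (g : 'cV[C]_n -> 'cV[C]_n) :
  (forall a x y, g (a *: x + y) = a *: g x + g y) -> exists B, forall x, B *m x = g x.
Proof.
move=> glin; pose B := \matrix_(i, j) g (delta_mx j 0) i 0; exists B => x.
have g0 : g 0 = 0 by have := glin (-1) 0 0; rewrite scaler0 addr0 scaleN1r addNr.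
have gsum (I : Type) (r : seq I) (c : I -> C) (e : I -> 'cV[C]_n) :
    g (\sum_(i <- r) c i *: e i) = \sum_(i <- r) c i *: g (e i).
  by elim: r => [|i r IH]; rewrite ?big_nil ?big_cons ?g0// glin IH.
have xE : x = \sum_j x j 0 *: delta_mx j 0.
  rewrite {1}[x]matrix_sum_delta; apply: eq_bigr => j _; by rewrite big_ord1.
rewrite [in RHS]xE gsum; apply/matrixP => i j; rewrite ord1 summxE mxE.
by apply: eq_bigr => k _; rewrite !mxE mulrC.
Qed.

(** Isometry makes G single-valued, as a pair (0, d) in G has d of norm 0, and its domain is a
    subspace V. B is this map composed with the orthogonal projection onto V, so it vanishes on the
    orthogonal complement. *)
Lemma isotropic_partial_isometry (G : 'cV[C]_n -> 'cV[C]_n -> Prop) : G 0 0 ->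
  (forall a p q p' q', G p q -> G p' q' -> G (a *: p + p') (a *: q + q')) ->
  (forall p q p' q', G p q -> G p' q' -> dotc q q' = dotc p p') ->
  exists B V, [/\ forall p q, G p q <-> p \in V /\ B *m p = q,
    forall v, v \in V -> dotc (B *m v) (B *m v) = dotc v v &
    forall v, (forall w, w \in V -> dotc v w = 0) -> B *m v = 0].
Proof.
move=> G0 Glin Giso.
have Gfun p q q' : G p q -> G p q' -> q = q'.
  move=> Gq Gq'; have := Glin (-1) _ _ _ _ Gq' Gq; rewrite !scaleN1r addNr addrC => Gd.
  have := Giso _ _ _ _ Gd Gd; rewrite [RHS]linear0l => /eqP.
  by rewrite [_ == _](dnorm_eq0 form) subr_eq0 => /eqP.
have [V VP] := linear_set_vspace (S := fun p => exists q, G p q) (ex_intro _ 0 G0)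
  (fun a x y '(ex_intro q Gq) '(ex_intro q' Gq') => ex_intro _ _ (Glin a _ _ _ _ Gq Gq')).
have /choice[g gP] x : exists q, exists y, [/\ y \in V, G y q & forall w, w \in V -> dotc (x - y) w = 0].
  have [y yV xy] := orthogonal_projection V x; have [q Gq] := (VP y).1 yV.
  by exists q, y.
have uniq x y y' : y \in V -> y' \in V -> (forall w, w \in V -> dotc (x - y) w = 0) ->
    (forall w, w \in V -> dotc (x - y') w = 0) -> y = y'.
  move=> yV yV' xy xy'; apply/eqP; rewrite -subr_eq0 -(dnorm_eq0 form); apply/eqP.
  have -> : y - y' = (x - y') - (x - y) by rewrite opprB [RHS]addrC addrA subrK.
  rewrite {1}/form/= linearBl/=.
  have yyV : (x - y') - (x - y) \in V by rewrite opprB addrC addrA subrK memvB.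
  by rewrite xy// xy'// subrr.
have glin a x y : g (a *: x + y) = a *: g x + g y.
  have [x1 [x1V Gx xx]] := gP x; have [y1 [y1V Gy yy]] := gP y.
  have [z1 [z1V Gz zz]] := gP (a *: x + y).
  apply: Gfun Gz _; rewrite (uniq (a *: x + y) z1 (a *: x1 + y1))//.
  - exact: Glin.
  - by rewrite memvD ?memvZ.
  - move=> w wV; rewrite (_ : _ - _ = a *: (x - x1) + (y - y1)); last first.
      by rewrite scalerBr opprD addrACA.
    by rewrite linearPl/= xx// yy// mulr0 addr0.
have [B BE] := linear_function_mx glin.
have GB p q : G p q <-> p \in V /\ B *m p = q.
  have [y [yV Gy py]] := gP p.
  have yp : p \in V -> y = p.
    by move=> pV; apply: (uniq p) => // w _; rewrite subrr linear0l.
  split=> [Gpq|[pV <-]]; last by rewrite BE -{1}(yp pV).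
  have pV : p \in V by apply/VP; exists q.
  by split=> //; rewrite BE; apply: Gfun Gpq; rewrite -{1}(yp pV).
exists B, V; split=> //.
- by move=> v vV; apply: Giso; apply/GB.
- move=> v vV; rewrite BE; have [y [yV Gy vy]] := gP v.
  have y0 : y = 0 by apply: (uniq v) => //; [exact: mem0v|move=> w wV; rewrite subr0 vV].
  by apply: Gfun Gy _; rewrite y0.
Qed.

End column_vectors.

(** * Closed symmetric extensions and their adjoints *)

Section extensions.
Context (R : realType) (n : nat) (alpha beta : 'I_n -> R).
Hypothesis alpha_lt_beta : forall i, alpha i < beta i.
Hypothesis beta_lt_alpha : forall i j : 'I_n, (i < j)%N -> beta i < alpha j.
Local Notation L2 := (L2 alpha beta).
Local Notation graph_bv := (@graph_bv R n alpha beta).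
Local Notation D0 := (momentum_on (Cc_infty alpha beta)).
Implicit Types (p q : 'cV[R[i]]_n) (B : 'M[R[i]]_n) (V : {vspace 'cV[R[i]]_n}).

Let dot : {dot L2 for conjC} := @L2dot R n alpha beta.

(** Green's identity with its nonzero factor cancelled: symmetry becomes an algebraic condition on
    boundary values. *)
Lemma pairing_boundary u v p q u' v' p' q' : graph_bv u v p q -> graph_bv u' v' p' q' ->
  dot v u' = dot u v' <-> dotc q q' = dotc p p'.
Proof.
move=> g g'; have E := green_formula alpha_lt_beta beta_lt_alpha g g'.
split=> H.
  move: E; rewrite [L2dot v u']H subrr => /esym/eqP.
  by rewrite mulf_eq0 invr_eq0 (negbTE (kappa_neq0 R)) subr_eq0 => /eqP.
move: E; rewrite [cdot q q']H subrr mulr0 => /eqP; by rewrite subr_eq0 => /eqP.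
Qed.

(** The operator attached to B, with V in the role of B_l; [graph_adj] is its claimed adjoint. Both
    are expressed through [graph_bv] so that adjoints can be computed on boundary pairs. *)
Definition graph_ext B V : set (L2 * L2) := [set uv |
  exists p q, graph_bv uv.1 uv.2 p q /\ p \in V /\ B *m p = q].

Definition graph_adj B V : set (L2 * L2) := [set uv |
  exists p q, graph_bv uv.1 uv.2 p q /\ forall w, w \in V -> dotc (B^t* *m q - p) w = 0].

Lemma momentum_on_graph_ext B V :
  momentum_on [set f | [/\ Dmax alpha beta f, at_alpha alpha f \in V &
                           B *m at_alpha alpha f = at_beta beta f]] = graph_ext B V.
Proof.
apply/seteqP; split=> -[u v] /=.
  move=> [f [[Df fV Bf] uf vf]].
  apply/(momentum_on_graph_bv (fun p q => p \in V /\ B *m p = q)).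
  by exists f.
move=> /(momentum_on_graph_bv (fun p q => p \in V /\ B *m p = q))[f [[Df [fV Bf]] uf vf]].
by exists f.
Qed.

Lemma momentum_on_graph_adj B V :
  momentum_on [set f | Dmax alpha beta f /\
    forall w, w \in V -> cdot (B^t* *m at_beta beta f - at_alpha alpha f) w = 0] = graph_adj B V.
Proof.
apply/seteqP; split=> -[u v] /=.
  by move=> /(momentum_on_graph_bv (fun p q => forall w, w \in V -> cdot (B^t* *m q - p) w = 0)).
by move=> H; apply/(momentum_on_graph_bv (fun p q => forall w, w \in V -> cdot (B^t* *m q - p) w = 0)).
Qed.

Lemma adjoint_antimono (S T : set (L2 * L2)) : S `<=` T -> adjoint dot T `<=` adjoint dot S.
Proof. by move=> ST uv H x y /ST/H. Qed.

Lemma minimal_graph_ext B V : D0 `<=` graph_ext B V.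
Proof.
move=> [u v] /(minimal_graph_bv alpha_lt_beta beta_lt_alpha) g; exists 0, 0.
by rewrite mem0v mulmx0.
Qed.

Lemma minimal_graph_adj B V : D0 `<=` graph_adj B V.
Proof.
move=> [u v] /(minimal_graph_bv alpha_lt_beta beta_lt_alpha) g; exists 0, 0; split=> // w _.
by rewrite mulmx0 subr0 dotc0l.
Qed.

(** The extension contains the minimal operator, so elements of its adjoint have boundary values by
    [adjoint_minimal]. As every boundary pair occurs, the adjoint condition can be tested on each
    (p', B p'). *)
Lemma adjoint_graph_ext B V : adjoint dot (graph_ext B V) = graph_adj B V.
Proof.
apply/seteqP; split=> -[u v].
  move=> H; have /(adjoint_minimal alpha_lt_beta beta_lt_alpha)[p [q uv]] :=
    adjoint_antimono (@minimal_graph_ext B V) H.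
  exists p, q; split=> //; apply/adjointP => p' pV.
  have [x [y xy]] := graph_bv_surjective alpha_lt_beta beta_lt_alpha p' (B *m p').
  by apply/(pairing_boundary xy uv)/H; exists p', (B *m p').
move=> [p [q [uv /adjointP H]]] x y [p' [q' [xy [pV Bp]]]].
by apply/(pairing_boundary xy uv); rewrite -Bp; exact: H.
Qed.

(** The same argument with the two relations exchanged, through [biadjointP]. It exhibits
    [graph_ext B V] as an adjoint and thereby as closed. *)
Lemma adjoint_graph_adj B V : adjoint dot (graph_adj B V) = graph_ext B V.
Proof.
apply/seteqP; split=> -[u v].
  move=> H; have /(adjoint_minimal alpha_lt_beta beta_lt_alpha)[p [q uv]] :=
    adjoint_antimono (@minimal_graph_adj B V) H.
  exists p, q; split=> //; apply/biadjointP => p' q' pq.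
  have [x [y xy]] := graph_bv_surjective alpha_lt_beta beta_lt_alpha p' q'.
  by apply/(pairing_boundary xy uv)/H; exists p', q'.
move=> [p [q [uv /biadjointP H]]] x y [p' [q' [xy pq]]].
by apply/(pairing_boundary xy uv); exact: H.
Qed.

Lemma graph_ext_linear B V : linear_operator (graph_ext B V).
Proof.
split=> [|a x y x' y'|x y y'].
- have [u uP] := graph_bv_exists alpha_lt_beta beta_lt_alpha (0 : L2) 0.
  exists 0, 0; rewrite mem0v mulmx0; split=> //=.
  have := graph_bv_lincomb alpha_lt_beta (-1) uP uP.
  by rewrite !scaleN1r !addNr.
- move=> [p [q [g [pV Bp]]]] [p' [q' [g' [pV' Bp']]]].
  exists (a *: p + p'), (a *: q + q'); split; first exact: graph_bv_lincomb.
  by rewrite memvD ?memvZ//; split=> //; rewrite mulmxDr -scalemxAr Bp Bp'.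
- by move=> [p [q [g _]]] [p' [q' [g' _]]]; have [] := graph_bv_inj alpha_lt_beta g g'.
Qed.

Lemma densely_definedS (S T : set (L2 * L2)) : S `<=` T ->
  densely_defined dot S -> densely_defined dot T.
Proof. by move=> ST dS x e e0; have [z [y Szy] zx] := dS x e e0; exists z => //; exists y; exact: ST. Qed.

Lemma graph_ext_dense B V : densely_defined dot (graph_ext B V).
Proof. exact: densely_definedS (@minimal_graph_ext B V) (Cc_infty_dense beta_lt_alpha). Qed.

Lemma graph_ext_symmetric B V : (forall v, v \in V -> dotc (B *m v) (B *m v) = dotc v v) ->
  symmetric_operator dot (graph_ext B V).
Proof.
move=> iso; split; first exact: graph_ext_dense.
move=> x y x' y' [p [q [g [pV Bp]]]] [p' [q' [g' [pV' Bp']]]].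
by apply/(pairing_boundary g g'); rewrite -Bp -Bp'; exact: polarization iso _ _ pV pV'.
Qed.

(** A nonzero p orthogonal to V would give the adjoint an element with boundary values (p, 0), which
    the extension does not contain. For unitary B the two boundary conditions coincide. *)
Lemma self_adjoint_graph_ext B V :
  (forall v, v \in V -> dotc (B *m v) (B *m v) = dotc v v) ->
  (forall v, (forall w, w \in V -> dotc v w = 0) -> B *m v = 0) ->
  self_adjoint dot (graph_ext B V) <-> B \is unitarymx.
Proof.
move=> iso BV; rewrite /self_adjoint adjoint_graph_ext; split=> [[_ TE]|BU].
  apply/(partial_isometry_unitarymx iso BV)/vspaceP => x; rewrite memvf.
  apply: orthogonal_complementK => p pV.
  suff pV' : p \in V by rewrite (dotc_nondegenerate_in pV' pV) dotc0l.
  have [u [v uv]] := graph_bv_surjective alpha_lt_beta beta_lt_alpha p 0.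
  have : graph_adj B V (u, v).
    by exists p, 0; split; [exact: uv|exact: adjoint_condition0].
  by rewrite TE => -[p' [q' [uv' [+ _]]]]; have [_ -> _] := graph_bv_inj alpha_lt_beta uv uv'.
split; first exact: graph_ext_dense.
have VE : V = fullv by apply/(partial_isometry_unitarymx iso BV).
rewrite VE; apply/seteqP; split=> -[u v] [p [q [uv H]]]; exists p, q; split=> //.
  exact/(unitarymx_adjoint_condition _ _ BU).
exact/(unitarymx_adjoint_condition _ _ BU).
Qed.

(** Symmetry places T inside the adjoint of the minimal operator, so its elements have boundary
    values; closedness places all elements with zero boundary values in T. Hence T is determined by
    its boundary relation [G], which is isometric by symmetry. *)
Lemma symmetric_extension_graph (T : set (L2 * L2)) : linear_operator T ->
  closed_operator dot T -> symmetric_operator dot T -> D0 `<=` T ->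
  exists B V, [/\ T = graph_ext B V,
    forall v, v \in V -> dotc (B *m v) (B *m v) = dotc v v &
    forall v, (forall w, w \in V -> dotc v w = 0) -> B *m v = 0].
Proof.
move=> [T0 Tlin _] Tclosed [_ Tsym] D0T.
have Tbv u v : T (u, v) -> exists p q, graph_bv u v p q.
  move=> Tuv; apply: (adjoint_minimal alpha_lt_beta beta_lt_alpha) => x y /D0T Txy.
  exact: Tsym Txy Tuv.
have Tbv0 u v : graph_bv u v 0 0 -> T (u, v).
  move=> /(graph_bv0_approx alpha_lt_beta beta_lt_alpha) app.
  have k0 k : 0 < k.+1%:R^-1 :> R by rewrite invr_gt0.
  have /choice[x /choice[y xyP]] k := app _ (k0 k).
  have to0 (z : nat -> R) : (forall k, 0 <= z k) -> (forall k, z k < k.+1%:R^-1) ->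
      z k @[k --> \oo] --> (0 : R).
    move=> z0 zk; apply: (squeeze_cvgr _ (cvg_cst 0) (@cvg_harmonic R)).
    by near=> k; rewrite z0/= ltW.
  apply: (Tclosed x y) => [k||].
  - by have [/D0T] := xyP k.
  - by apply: to0 => k; [exact: hnorm_ge0|case: (xyP k)].
  - by apply: to0 => k; [exact: hnorm_ge0|case: (xyP k)].
pose G p q := exists u v, T (u, v) /\ graph_bv u v p q.
have Glin a p q p' q' : G p q -> G p' q' -> G (a *: p + p') (a *: q + q').
  move=> [u [v [Tuv g]]] [u' [v' [Tuv' g']]]; exists (a *: u + u'), (a *: v + v').
  by split; [exact: Tlin|exact: graph_bv_lincomb].
have G0 : G 0 0.
  have [p [q g]] := Tbv _ _ T0; have := graph_bv_lincomb alpha_lt_beta (-1) g g.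
  by rewrite !scaler0 !addr0 !scaleN1r !addNr => g0; exists 0, 0.
have Giso p q p' q' : G p q -> G p' q' -> dotc q q' = dotc p p'.
  move=> [u [v [Tuv g]]] [u' [v' [Tuv' g']]].
  by apply/(pairing_boundary g g'); exact: Tsym Tuv Tuv'.
have [B [V [GE iso BV]]] := isotropic_partial_isometry G0 Glin Giso.
exists B, V; split=> //; apply/seteqP; split=> -[u v].
  move=> Tuv; have [p [q g]] := Tbv _ _ Tuv; exists p, q; split=> //.
  by apply/GE; exists u, v.
move=> [p [q [g /GE[u' [v' [Tuv' g']]]]]].
(* Two elements with equal boundary values differ by one with zero boundary values, which lies in
   T. *)
have := graph_bv_lincomb alpha_lt_beta (-1) g' g.
rewrite !scaleN1r !addNr => /Tbv0 Td; have := Tlin 1 _ _ _ _ Td Tuv'.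
by rewrite !scale1r /= ![- _ + _]addrC !subrK.
Unshelve. all: by end_near. Qed.

End extensions.

Theorem theorem3p2 (R : realType) (n : nat) (alpha beta : 'I_n -> R)
    (n_gt0 : (0 < n)%N)
    (alpha_lt_beta : forall i, alpha i < beta i)
    (beta_lt_alpha : forall i j : 'I_n, (i < j)%N -> beta i < alpha j) :
  let dot : {dot L2 alpha beta for conjC} := @L2dot R n alpha beta in
  let D0 : set (L2 alpha beta * L2 alpha beta) :=
    momentum_on (Cc_infty alpha beta) in
  let DB (B : 'M[R[i]]_n) (Bl : {vspace 'cV[R[i]]_n}) :
      set (L2 alpha beta * L2 alpha beta) :=
    momentum_on [set f | [/\ Dmax alpha beta f, at_alpha alpha f \in Bl &
                             B *m at_alpha alpha f = at_beta beta f]] in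
  [/\ (forall T : set (L2 alpha beta * L2 alpha beta),
        linear_operator T -> closed_operator dot T ->
        symmetric_operator dot T -> D0 `<=` T ->
        exists (B : 'M[R[i]]_n) (Bl Br : {vspace 'cV[R[i]]_n}),
          partial_isometry B Bl Br /\ T = DB B Bl),
      (forall (B : 'M[R[i]]_n) (Bl Br : {vspace 'cV[R[i]]_n}),
        partial_isometry B Bl Br ->
        [/\ linear_operator (DB B Bl), closed_operator dot (DB B Bl),
            symmetric_operator dot (DB B Bl) & D0 `<=` DB B Bl]),
      (forall (B : 'M[R[i]]_n) (Bl Br : {vspace 'cV[R[i]]_n}),
        partial_isometry B Bl Br ->
        adjoint dot (DB B Bl) =
        momentum_on [set f | Dmax alpha beta f /\
          forall w, w \in Bl ->
            cdot (B^t* *m at_beta beta f - at_alpha alpha f) w = 0]) &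
      (forall (B : 'M[R[i]]_n) (Bl Br : {vspace 'cV[R[i]]_n}),
        partial_isometry B Bl Br ->
        ((self_adjoint dot (DB B Bl) /\ D0 `<=` DB B Bl) <->
           B \is unitarymx) /\
        (B \is unitarymx <-> Bl = fullv /\ Br = fullv))].
Proof.
move=> dot D0 DB.
have DBE B Bl : DB B Bl = graph_ext B Bl by exact: momentum_on_graph_ext.
split=> [T Tlin Tclosed Tsym D0T|B Bl Br [_ iso BV]|B Bl Br _|B Bl Br [BrE iso BV]].
- have [B [V [TE iso BV]]] := symmetric_extension_graph alpha_lt_beta beta_lt_alpha Tlin Tclosed Tsym D0T.
  (* B_r is taken to be the image of B_l under B. *)
  by exists B, V, (linfun (mulmx B) @: V)%VS; split; [split|rewrite DBE].
- rewrite DBE; split.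
  + exact: graph_ext_linear.
  + by rewrite -(adjoint_graph_adj alpha_lt_beta beta_lt_alpha); exact: adjoint_closed.
  + exact: graph_ext_symmetric.
  + exact: minimal_graph_ext.
- by rewrite DBE momentum_on_graph_adj; exact: adjoint_graph_ext.
- rewrite DBE; split.
    rewrite -(self_adjoint_graph_ext alpha_lt_beta beta_lt_alpha iso BV).
    by split=> [[]//|]; split=> //; exact: minimal_graph_ext.
  split=> [BU|[BlE _]]; last exact/(partial_isometry_unitarymx iso BV).
  have BlE : Bl = fullv by apply/(partial_isometry_unitarymx iso BV).
  by split=> //; rewrite -BrE BlE; exact: unitarymx_limg.
Qed.
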